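(* Let $\mathrm{k}$ be any algebraically closed field of characteristic $\neq 2,3$. There are exactly $35$ isomorphism classes of $8$-dimensional $2$-step nilpotent Lie algebras over $\mathrm{k}$.
   Context: A Lie algebra $\mathfrak g$ is called $2$-step nilpotent here if its commutator ideal is contained in its center, i.e. $[\mathfrak g,\mathfrak g]\subset\mathfrak z(\mathfrak g)$; in particular the abelian Lie algebra is included. *)

(* Defs.v *)
From HB Require Import structures.
From mathcomp Require Import all_boot all_order all_algebra.

Set Implicit Arguments.
Unset Strict Implicit.
Unset Printing Implicit Defensive.

Import GRing.Theory.
Local Open Scope ring_scope.

(* [lieAlgType k] is the type of finite-dimensional Lie algebras over [k].
   The bracket is required to be alternating, not merely antisymmetric. *)
HB.mixin Record isLieAlgebra (k : fieldType) V of Vector k V := {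
  lie : V -> V -> V;
  lie_linear_l : forall y : V, linear (lie^~ y);
  lie_linear_r : forall x : V, linear (lie x);
  liexx : forall x : V, lie x x = 0;
  lie_jacobi : forall x y z : V,
    lie x (lie y z) + lie y (lie z x) + lie z (lie x y) = 0
}.

#[short(type="lieAlgType")]
HB.structure Definition LieAlgebra (k : fieldType) :=
  { V of isLieAlgebra k V & Vector k V }.

HB.instance Definition _ (k : fieldType) (g : lieAlgType k) (x : g) :=
  GRing.isLinear.Build k g g _ (@lie k g x) (lie_linear_r x).

(* The linear span of all brackets; by bilinearity, brackets of basis vectors
   suffice (see [derived_algebra_subP]). *)
Definition derived_algebra (k : fieldType) (g : lieAlgType k) : {vspace g} :=
  <<[seq lie x y | x <- vbasis {:g}, y <- vbasis {:g}]>>%VS.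

(* It suffices to commute with a basis (see [lie_centerP]). *)
Definition lie_center (k : fieldType) (g : lieAlgType k) : {vspace g} :=
  (\bigcap_(i < \dim {:g}) lker (linfun (lie (vbasis {:g})`_i)))%VS.

Definition two_step_nilpotent (k : fieldType) (g : lieAlgType k) : bool :=
  (derived_algebra g <= lie_center g)%VS.

Definition lie_isomorphic (k : fieldType) (g h : lieAlgType k) : Prop :=
  exists f : {linear g -> h},
    bijective f /\ forall x y : g, f (lie x y) = lie (f x) (f y).

Section Facts.
Variables (k : fieldType) (g : lieAlgType k).
Implicit Types (x y z : g) (U : {vspace g}).

Lemma lieDl x y z : lie (x + y) z = lie x z + lie y z.
Proof. by have := lie_linear_l z 1 x y; rewrite !scale1r. Qed.

Lemma lie0l z : lie 0 z = 0.
Proof. by apply: (addIr (lie 0 z)); rewrite -lieDl !add0r. Qed.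

Lemma lieZl a x z : lie (a *: x) z = a *: lie x z.
Proof. by have := lie_linear_l z a x 0; rewrite lie0l !addr0. Qed.

Lemma lie_suml n (F : 'I_n -> g) z :
  lie (\sum_i F i) z = \sum_i lie (F i) z.
Proof.
apply: (big_morph (fun x => lie x z) (fun x y => lieDl x y z)).
exact: lie0l.
Qed.

Lemma lieC x y : lie x y = - lie y x.
Proof.
apply/eqP; rewrite -addr_eq0; apply/eqP.
by have := liexx (x + y); rewrite lieDl !linearD /= !liexx add0r addr0.
Qed.

Lemma derived_algebra_subP U :
  reflect (forall x y, lie x y \in U) (derived_algebra g <= U)%VS.
Proof.
apply: (iffP idP) => [/subvP sDU x y | inU]; last first.
  by apply/span_subvP => _ /allpairsP[p [_ _ ->]].
apply: sDU.
rewrite (coord_vbasis (memvf x)) (coord_vbasis (memvf y)) lie_suml.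
apply: memv_suml => i _; rewrite lieZl memvZ // linear_sum.
apply: memv_suml => j _; rewrite linearZ memvZ //.
by apply/memv_span/allpairs_f; rewrite mem_nth ?size_tuple.
Qed.

Lemma lie_centerP x : reflect (forall y, lie x y = 0) (x \in lie_center g).
Proof.
apply: (iffP idP) => [xZ y | xZ]; last first.
  rewrite memvE; apply/subv_bigcapP => i _.
  by rewrite -memvE memv_ker lfunE /= lieC xZ oppr0.
rewrite lieC (coord_vbasis (memvf y)) lie_suml big1 ?oppr0 // => i _.
move: xZ; rewrite memvE => /subv_bigcapP/(_ i isT).
by rewrite -memvE memv_ker lfunE lieZl => /eqP->; rewrite scaler0.
Qed.

End Facts.

(* Main.v *)
(* A 2-step nilpotent Lie algebra of dimension 8 with derived algebra of dimension d
   amounts to a d-dimensional space W of alternating forms on k^n, n = 8 - d: the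
   differentials of coordinates that complete a basis x_0, ..., x_(n-1) of the closed
   1-forms.  For n <= 3 there are too few forms, hence d <= 4, and one has to classify
   the spaces W up to GL_n.

   If d = 1, this is Darboux's theorem.  If d = 2, W contains a degenerate form, which
   can be taken to be e_0 ^ e_1 or e_0 ^ e_1 + e_2 ^ e_3, and the second form is then
   reduced.  If d = 4, the Pfaffian, a quadratic form on W, provides enough decomposable
   forms.  If d = 3, the product S^2 W -> L^4 k^5 goes from dimension 6 to dimension 5,
   so there is a quadratic relation between the forms of W.  A degenerate relation is a
   product of two linear forms, which yields a decomposable form e_0 ^ e_1 in W; then W
   is reduced according to the restriction of W to the subspace e_0 = e_1 = 0.  If the only
   relation is a nondegenerate conic, the five independent products of forms of W,
   seen as vectors of k^5, are a basis in which W is completely determined.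

   The algebras obtained are told apart by the dimensions of the derived algebra and of
   the center, and by the existence in W of independent forms with prescribed vanishing
   products, of degenerate forms, or of forms annihilating all of W. *)

Require Import Defs.
From HB Require Import structures.
From mathcomp Require Import all_boot all_order all_algebra.
From mathcomp Require Import ring zify.

Set Implicit Arguments.
Unset Strict Implicit.
Unset Printing Implicit Defensive.

Import GRing.Theory.
Local Open Scope ring_scope.

(** A state of the classification is a list of forms spanning [W] in some coframe, and a
    normalization is a pair of explicit invertible substitutions, one on the closed 1-forms and one
    on the list, so that each step costs only rational identities. Coefficients that have become
    irrelevant are not tracked: they are read off again as unknowns. The parameters that are not
    explicit come from a Darboux basis, a linear dependence, an eigenvalue, or a root of a quadratic
    or cubic equation.

    The obstacle is the nondegenerate conic, where no decomposable form is available as a starting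
    point. The way out is that an alternating form [p] on k^5 has in its radical the vector dual to
    the 4-form [p ^ p]. Polarized over three forms, this identity fixes, up to one common scalar,
    the value of every form of [W] on every pair of the five vectors coming from products.

    Separation is mechanical: truth values of invariants are proved entry by entry, and a
    computation compares them. *)

Notation "a # i" := (a i%N)
  (at level 3, i at level 2, left associativity, only parsing).

(** * Lie algebras given by alternating forms *)

Section Forms.
Variable k : fieldType.

Definition form := (nat -> k) -> (nat -> k) -> k.
Definition E (i j : nat) : form := fun a b => a i * b j - a j * b i.
Definition form0 : form := fun _ _ => 0.
Definition form_of (l : seq (nat * nat)) : form :=
  fun a b => foldr (fun ij s => E ij.1 ij.2 a b + s) 0 l.

Lemma form_of_ext n l a b a' b' :
  all (fun ij => (ij.1 < n) && (ij.2 < n))%N l ->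
  (forall i, (i < n)%N -> a i = a' i) -> (forall i, (i < n)%N -> b i = b' i) ->
  form_of l a b = form_of l a' b'.
Proof.
move=> + Ha Hb; elim: l => //= -[i j] l IH /= /andP[/andP[Hi Hj] /IH ->].
by rewrite /E !Ha ?Hb.
Qed.

Lemma form_ofC l a b : form_of l a b = - form_of l b a.
Proof. by elim: l => /= [|ij l ->]; rewrite ?oppr0 // /E; ring. Qed.

Lemma form_of_lin l c a a' b e :
  (forall i, e i = c * a i + a' i) ->
  form_of l e b = c * form_of l a b + form_of l a' b.
Proof.
move=> He; elim: l => /= [|ij l ->]; first by rewrite mulr0 addr0.
by rewrite /E !He; ring.
Qed.

Lemma form_ofxx l a : form_of l a a = 0.
Proof. by elim: l => //= ij l ->; rewrite /E; ring. Qed.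

End Forms.

(* In a table [(n, L)], a form of [L] is the list of the [(i, j)] for which it contains
   [e_i ^ e_j]; the [c]-th form is the coordinate [n + c] of the bracket. *)
Definition modelType (k : fieldType) (t : nat * seq (seq (nat * nat))) : Type :=
  'rV[k]_8.
HB.instance Definition _ k t := Vector.copy (@modelType k t) 'rV[k]_8.

Section Model.
Variables (k : fieldType) (t : nat * seq (seq (nat * nat))).
Local Notation model := (modelType k t).

Definition crd (a : model) (i : nat) : k := if (i < 8)%N then a 0 (inord i) else 0.

Definition model_form (c : nat) : form k := nth (@form0 k) (map (@form_of k) t.2) c.

(* Only coordinates below [t.1] enter the bracket, and only the others are hit
   by it, so the algebra is 2-step nilpotent whatever the table. *)
Definition low (a : model) (i : nat) : k := if (i < t.1)%N then crd a i else 0.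

Definition model_lie (a b : model) : model :=
  \row_(i < 8) if (i < t.1)%N then 0 else model_form (i - t.1) (low a) (low b).

Lemma model_formE c : model_form c = form_of (nth [::] t.2 c) \/ model_form c = @form0 k.
Proof.
rewrite /model_form; have [h|h] := ltnP c (size t.2); first by left; apply: nth_map.
by right; rewrite nth_default ?size_map.
Qed.

Lemma low_lin c a b i : low (c *: a + b) i = c * low a i + low b i.
Proof. by rewrite /low /crd; do ?case: ifP => _; rewrite ?mxE ?mulr0 ?addr0. Qed.

Lemma model_lie_linl y : linear (model_lie^~ y).
Proof.
move=> c a b; apply/rowP => i; rewrite !mxE; case: ifP => _; first by rewrite mulr0 addr0.
have [->|->] := model_formE (i - t.1); last by rewrite /form0 mulr0 addr0.
exact/form_of_lin/low_lin.
Qed.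

Lemma model_lieC a b : model_lie a b = - model_lie b a.
Proof.
apply/rowP => i; rewrite !mxE; case: ifP => _; first by rewrite oppr0.
by have [->|->] := model_formE (i - t.1); rewrite /form0 ?oppr0 // form_ofC.
Qed.

Lemma model_lie_linr y : linear (model_lie y).
Proof.
move=> c a b; rewrite ![model_lie y _]model_lieC model_lie_linl.
by rewrite opprD scalerN.
Qed.

Lemma model_liexx a : model_lie a a = 0.
Proof.
apply/rowP => i; rewrite !mxE; case: ifP => // _.
by have [->|->] := model_formE (i - t.1); rewrite ?form_ofxx.
Qed.

Lemma low_lie a b i : low (model_lie a b) i = 0.
Proof.
rewrite /low /crd; case: ifP => // ht; case: ifP => // h8.
by rewrite !mxE inordK // ht.
Qed.

Lemma model_lie_lie a b c : model_lie a (model_lie b c) = 0.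
Proof.
apply/rowP => i; rewrite !mxE; case: ifP => // _.
have [->|->] := model_formE (i - t.1); last by [].
by elim: (nth _ _ _) => //= ij l ->; rewrite /E !low_lie; ring.
Qed.

Lemma model_jacobi a b c : model_lie a (model_lie b c) +
  model_lie b (model_lie c a) + model_lie c (model_lie a b) = 0.
Proof. by rewrite !model_lie_lie !addr0. Qed.

HB.instance Definition _ := isLieAlgebra.Build k model
  model_lie_linl model_lie_linr model_liexx model_jacobi.

Lemma dim_model : \dim {:model} = 8%N.
Proof. by rewrite dimvf. Qed.

Lemma model_two_step : two_step_nilpotent model.
Proof.
apply/derived_algebra_subP => a b; apply/lie_centerP => c.
by rewrite lieC [lie c _]model_lie_lie oppr0.
Qed.

End Model.

(** * Coframes adapted to the derived algebra *)

Section Coframe.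
Variables (k : fieldType) (g : lieAlgType k).

Definition lin (f : g -> k) := forall c u v, f (c *: u + v) = c * f u + f v.

(** When [n + d = 8], triviality of the common kernel makes the [x i] and [z c] a basis of the dual
    space. Families are indexed by all of [nat] so that substitutions can be written with lists and
    [nth 0]; linearity and closedness are therefore required at every index. *)
Definition coframe n d (x z : nat -> g -> k) :=
  [/\ forall i, lin (x i), forall c, lin (z c),
      forall u, (forall i, (i < n)%N -> x i u = 0) ->
        (forall c, (c < d)%N -> z c u = 0) -> u = 0
    & forall i u v, x i (lie u v) = 0].

(* The [x i] are closed and the differential of [z c] is, up to sign, the [c]-th form of [W]
   evaluated on the [x i]. *)
Definition admits n (W : seq (form k)) := exists x z, coframe n (size W) x z /\
  forall c u v, z c (lie u v) = nth (@form0 k) W c (x^~ u) (x^~ v).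

Lemma lin0 f : lin f -> f 0 = 0.
Proof. by move=> h; have := h (-1) 0 0; rewrite scaler0 addr0 mulN1r addNr. Qed.

(** The coordinates of the coframe form an injective linear map between spaces of dimension 8, hence
    an isomorphism, and the bracket is compared coordinate by coordinate. *)
Lemma admits_model n L : \dim {:g} = 8%N -> (n + size L = 8)%N ->
  all (all (fun ij => (ij.1 < n) && (ij.2 < n))%N) L ->
  admits n (map (@form_of k) L) -> lie_isomorphic g (modelType k (n, L)).
Proof.
move=> dg e8 wf [x [z [[lx lz inj cl] Hz]]]; rewrite size_map in inj Hz.
pose F u : modelType k (n, L) := \row_(i < 8) if (i < n)%N then x i u else z (i - n)%N u.
have Flin : linear F.
  by move=> c u v; apply/rowP => i; rewrite !mxE; case: ifP; rewrite ?lx ?lz.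
pose FL : {linear g -> modelType k (n, L)} := HB.pack F (GRing.isLinear.Build _ _ _ _ F Flin).
have crdF u i (hi : (i < 8)%N) : crd (F u) i = if (i < n)%N then x i u else z (i - n)%N u.
  by rewrite /crd hi mxE inordK.
have Finj u : F u = 0 -> u = 0.
  move=> /rowP Fu; have C i (hi : (i < 8)%N) := Fu (Ordinal hi).
  apply: inj => [i hi|c hc].
    have h8 : (i < 8)%N by apply: leq_trans hi _; rewrite -e8 leq_addr.
    by have := C i h8; rewrite !mxE /= hi.
  have h8 : (n + c < 8)%N by rewrite -e8 ltn_add2l.
  by have := C _ h8; rewrite !mxE /= addKn ltnNge leq_addr.
have K0 : lker (linfun FL) == 0%VS.
  apply/lker0P => u v; rewrite !lfunE /= => /eqP; rewrite -subr_eq0 => /eqP h.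
  by apply/eqP; rewrite -subr_eq0; apply/eqP/Finj; rewrite -h -[F]/(FL : g -> _) linearB.
have im : limg (linfun FL) = fullv.
  apply/eqP; rewrite -dimv_leqif_eq ?subvf // dim_model.
  by rewrite limg_dim_eq ?dg // (eqP K0) capv0.
exists FL; split.
  exists (linfun FL)^-1%VF => u.
    by have := lker0_lfunK K0 u; rewrite lfunE.
  have : u \in limg (linfun FL) by rewrite im memvf.
  by move=> /limg_lfunVK; rewrite lfunE.
move=> u v; apply/rowP => i; rewrite !mxE /=; case: ifP => hn; first exact: cl.
have hc : (i - n < size L)%N by rewrite ltn_subLR ?e8 // leqNgt hn.
rewrite Hz // /model_form /= !(nth_map [::]) //.
apply: form_of_ext; first by move/all_nthP: wf; apply.
  by move=> j hj; rewrite /low /= hj crdF ?hj // -e8 ltn_addr.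
by move=> j hj; rewrite /low /= hj crdF ?hj // -e8 ltn_addr.
Qed.

(** [s] changes the closed 1-forms and [t] recombines the forms of [W]. Only left inverses [s'] and
    [t'] that send zero to zero are requested, because a new coframe needs just a trivial common
    kernel. The last hypothesis says that [W'] in the new variables is [t] applied to [W] in the old
    ones. *)
Lemma admits_change n W W' (s s' t t' : (nat -> k) -> seq k) :
  admits n W -> size W' = size W ->
  (forall i c a b e, (forall j, e j = c * a j + b j) ->
    nth 0 (s e) i = c * nth 0 (s a) i + nth 0 (s b) i) ->
  (forall i c a b e, (forall j, e j = c * a j + b j) ->
    nth 0 (t e) i = c * nth 0 (t a) i + nth 0 (t b) i) ->
  (forall a i, (i < n)%N -> nth 0 (s' (nth 0 (s a))) i = a i) ->
  (forall a i, (forall j, (j < n)%N -> a j = 0) -> (i < n)%N -> nth 0 (s' a) i = 0) ->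
  (forall a i, (i < size W)%N -> nth 0 (t' (nth 0 (t a))) i = a i) ->
  (forall a i, (forall j, (j < size W)%N -> a j = 0) -> (i < size W)%N -> nth 0 (t' a) i = 0) ->
  (forall c a b, nth (@form0 k) W' c (nth 0 (s a)) (nth 0 (s b)) =
    nth 0 (t (fun c => nth (@form0 k) W c a b)) c) ->
  admits n W'.
Proof.
move=> [x [z [[lx lz inj cl] Hz]]] sz ls lt ss' s0 tt' t0 HW.
have z0 (r : (nat -> k) -> seq k) a i : (forall i c a b e, (forall j, e j = c * a j + b j) ->
    nth 0 (r e) i = c * nth 0 (r a) i + nth 0 (r b) i) -> (forall j, a j = 0) ->
    nth 0 (r a) i = 0.
  move=> lr a0; have := lr i (-1) a a a; rewrite mulN1r addNr; apply => j.
  by rewrite a0 mulr0 addr0.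
exists (fun i u => nth 0 (s (x^~ u)) i), (fun i u => nth 0 (t (z^~ u)) i); rewrite sz.
split; first split.
- by move=> i c u v; apply: ls => j; rewrite lx.
- by move=> i c u v; apply: lt => j; rewrite lz.
- move=> u hx hz; apply: inj => i hi; first by rewrite -[LHS](ss' (x^~ u)) // s0.
  by rewrite -[LHS](tt' (z^~ u)) // t0.
- by move=> i u v; apply: z0 => // j; apply: cl.
move=> c u v; rewrite HW //.
have e0 : forall j, 0 = 0 :> k by [].
have := lt c 1 (fun c => nth (@form0 k) W c (x^~ u) (x^~ v)) (fun=> 0) (z^~ (lie u v)).
by rewrite [nth 0 (t (fun=> 0)) c]z0 // addr0 mul1r; apply=> j; rewrite Hz mul1r addr0.
Qed.
End Coframe.

Definition gen (k : fieldType) n (p : nat -> nat -> k) : form k :=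
  fun a b => \sum_(j < n) \sum_(i < j) p i j * E i j a b.

Lemma gen_skew (k : fieldType) n (q : nat -> nat -> k) (a b : nat -> k) :
  (forall i, q i i = 0) -> (forall i j, q i j = - q j i) ->
  \sum_(i < n) \sum_(j < n) a i * b j * q i j = gen n q a b.
Proof.
move=> q0 qN; elim: n => [|n IH]; rewrite /gen ?big_ord0 // !big_ord_recr /= -/(gen n q a b).
rewrite q0 mulr0 addr0 -IH.
under eq_bigr do rewrite big_ord_recr /=.
rewrite big_split /= -addrA; congr (_ + _); rewrite -big_split /=.
by apply: eq_bigr => i _; rewrite (qN n i) /E; ring.
Qed.

(** * Linear algebra of a coframe *)

Section Coframes.
Variables (k : fieldType) (g : lieAlgType k) (n d : nat).
Hypotheses (dg : \dim {:g} = 8%N) (ts : two_step_nilpotent g).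
Hypotheses (dD : \dim (derived_algebra g) = d) (nd : (n + d = 8)%N).

Lemma lin_sum (f : g -> k) (I : Type) (r : seq I) (F : I -> g) :
  lin f -> f (\sum_(i <- r) F i) = \sum_(i <- r) f (F i).
Proof.
move=> lf; apply: (big_morph f) => [u v|]; last exact: lin0.
by rewrite -[u]scale1r lf scale1r mul1r.
Qed.

Lemma linZ (f : g -> k) c u : lin f -> f (c *: u) = c * f u.
Proof. by move=> lf; rewrite -[c *: u]addr0 lf lin0 // addr0. Qed.

Lemma lie_derived u v : lie u v \in derived_algebra g.
Proof. by move: u v; apply/derived_algebra_subP. Qed.

Lemma derived_central u v : u \in derived_algebra g -> lie u v = 0.
Proof. by move=> /(subvP ts) /lie_centerP. Qed.

Section Dual.
Variables (x z : nat -> g -> k).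
Hypothesis cxz : coframe n d x z.

Lemma coframe_surj (a b : nat -> k) : exists u,
  (forall i, (i < n)%N -> x i u = a i) /\ (forall c, (c < d)%N -> z c u = b c).
Proof.
case: cxz => lx lz inj cl.
pose F u : 'rV[k]_8 := \row_(i < 8) if (i < n)%N then x i u else z (i - n)%N u.
have Flin : linear F.
  by move=> c u v; apply/rowP => i; rewrite !mxE; case: ifP; rewrite ?lx ?lz.
pose FL : {linear g -> 'rV[k]_8} := HB.pack F (GRing.isLinear.Build _ _ _ _ F Flin).
have FE u i (h8 : (i < 8)%N) : F u 0 (Ordinal h8) = if (i < n)%N then x i u else z (i - n)%N u.
  by rewrite mxE.
have h8n i : (i < n)%N -> (i < 8)%N by move=> hi; rewrite -nd ltn_addr.
have h8d c : (c < d)%N -> (n + c < 8)%N by rewrite -nd ltn_add2l.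
have Finj u : F u = 0 -> u = 0.
  move=> /rowP Fu; apply: inj => [i hi|c hc].
    by have := Fu (Ordinal (h8n i hi)); rewrite FE hi mxE.
  by have := Fu (Ordinal (h8d c hc)); rewrite FE mxE addKn ltnNge leq_addr.
have K0 : lker (linfun FL) == 0%VS.
  apply/lker0P => u v; rewrite !lfunE /= => /eqP; rewrite -subr_eq0 => /eqP h.
  by apply/eqP; rewrite -subr_eq0; apply/eqP/Finj; rewrite -h -[F]/(FL : g -> _) linearB.
have im : limg (linfun FL) = fullv.
  apply/eqP; rewrite -dimv_leqif_eq ?subvf // dimvf /=.
  by rewrite limg_dim_eq ?dg // (eqP K0) capv0.
pose y : 'rV[k]_8 := \row_(i < 8) if (i < n)%N then a i else b (i - n)%N.
have [u _ hu] : exists2 u, u \in fullv & y = linfun FL u.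
  by apply/memv_imgP; rewrite im memvf.
rewrite lfunE /= in hu; move/rowP: hu => hu; exists u; split=> [i hi|c hc].
  by have := hu (Ordinal (h8n i hi)); rewrite FE hi mxE /= hi.
have := hu (Ordinal (h8d c hc)); rewrite FE mxE /= addKn ltnNge leq_addr /=.
by [].
Qed.

(** The common kernel of the [x i] is spanned by the [d] vectors dual to the [z c], and contains the
    derived algebra because the [x i] are closed; the dimensions force equality. *)
Lemma coframe_kernel u : (forall i, (i < n)%N -> x i u = 0) -> u \in derived_algebra g.
Proof.
case: (cxz) => lx lz inj cl hu.
have /fin_all_exists [e He] : forall c : 'I_d, exists u,
  (forall i, (i < n)%N -> x i u = 0) /\
  (forall c' : nat, (c' < d)%N -> z c' u = (c' == c)%:R).
  move=> c; exact: (coframe_surj (fun=> 0) (fun c' => (c' == c)%:R)).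
have span v : (forall i, (i < n)%N -> x i v = 0) -> v \in <<codom e>>%VS.
  move=> hv; have -> : v = \sum_(c < d) z c v *: e c.
    apply/eqP; rewrite -subr_eq0; apply/eqP; apply: inj => [i hi|c hc].
      rewrite -scaleN1r addrC lx lin_sum // hv // addr0 big1 ?mulr0 // => c _.
      by rewrite linZ // (He c).1 // mulr0.
    rewrite -scaleN1r addrC lz lin_sum // (bigD1 (Ordinal hc)) //= big1 => [|c' hc'].
      by rewrite linZ // (He _).2 //= eqxx mulr1 addr0 mulN1r addNr.
    rewrite linZ // (He _).2 //; move: hc'; rewrite -val_eqE /= eq_sym => /negbTE ->.
    by rewrite mulr0.
  by apply: memv_suml => c _; apply/memvZ/memv_span/codom_f.
suff <- : <<codom e>>%VS = derived_algebra g by apply: span.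
apply/eqP; rewrite eq_sym eqEdim; apply/andP; split.
  by apply/derived_algebra_subP => v w; apply: span => i _; apply: cl.
by rewrite dD (leq_trans (dim_span _)) // size_codom card_ord.
Qed.

(** Modulo the derived algebra, which is central, a vector is determined by its [x i]; so the
    bracket depends on these only. *)
Lemma coframe_gen : exists p, forall c u v, z c (lie u v) = gen n (p c) (x^~ u) (x^~ v).
Proof.
case: (cxz) => lx lz inj cl.
have /fin_all_exists [e He] : forall c : 'I_n, exists u,
  (forall i, (i < n)%N -> x i u = (i == c)%:R) /\
  (forall c' : nat, (c' < d)%N -> z c' u = 0).
  move=> c; exact: (coframe_surj (fun c' => (c' == c)%:R) (fun=> 0)).
pose e' i := if insub i is Some j then e j else 0.
exists (fun c i j => z c (lie (e' i) (e' j))) => c u v.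
rewrite -gen_skew; last 2 first.
- by move=> i; rewrite liexx lin0.
- by move=> i j; rewrite lieC -scaleN1r linZ // mulN1r.
have dec w : exists2 r, r \in derived_algebra g & w = r + \sum_(i < n) x i w *: e' i.
  exists (w - \sum_(i < n) x i w *: e' i); last by rewrite subrK.
  apply: coframe_kernel => i hi; rewrite -scaleN1r addrC lx lin_sum //.
  rewrite (bigD1 (Ordinal hi)) //= big1 => [|j hj].
    by rewrite linZ // /e' insubT (He _).1 //= eqxx mulr1 addr0 mulN1r addNr.
  rewrite linZ // /e' valK (He _).1 //; move: hj; rewrite -val_eqE /= eq_sym => /negbTE ->.
  by rewrite mulr0.
have [r hr eu] := dec u; have [s hs ev] := dec v.
rewrite [in LHS]eu lieDl derived_central // add0r [in LHS]ev lieC lieDl derived_central // add0r.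
rewrite -lieC lie_suml lin_sum //; apply: eq_bigr => i _.
rewrite lieZl lieC lie_suml scalerN -scaleNr linZ // lin_sum // mulr_sumr.
apply: eq_bigr => j _; rewrite lieZl linZ // lieC -scaleN1r linZ //; ring.
Qed.

(** A relation says that a combination of the [z c] vanishes on the derived algebra, which contains
    the vectors dual to the [z c]. *)
Lemma coframe_indep (q : nat -> k) :
  (forall u v, \sum_(c < d) q c * z c (lie u v) = 0) -> forall c, (c < d)%N -> q c = 0.
Proof.
case: (cxz) => lx lz inj cl H c hc.
have [u [hx hz]] := coframe_surj (fun=> 0) (fun c' => (c' == c)%:R).
pose f w := \sum_(c < d) q c * z c w.
have lf : lin f.
  move=> a v w; rewrite /f mulr_sumr -big_split /=; apply: eq_bigr => i _.
  by rewrite lz; ring.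
have Flin : linear (f : g -> k^o) by [].
pose FL : {linear g -> k^o} := HB.pack (f : g -> k^o) (GRing.isLinear.Build _ _ _ _ (f : g -> k^o) Flin).
have : (derived_algebra g <= lker (linfun FL))%VS.
  by apply/derived_algebra_subP => v w; rewrite memv_ker lfunE /= /f H.
move=> /subvP /(_ u (coframe_kernel hx)); rewrite memv_ker lfunE /= /f.
rewrite (bigD1 (Ordinal hc)) //= big1 => [|c' hc'].
  by rewrite addr0 hz // eqxx mulr1 => /eqP.
by rewrite hz //; move: hc'; rewrite -val_eqE /= => /negbTE ->; rewrite mulr0.
Qed.

End Dual.

Lemma coframe_exists : exists x z : nat -> g -> k, coframe n d x z /\ forall c u, (d <= c)%N -> z c u = 0.
Proof.
pose D := derived_algebra g; pose B := vbasis D^C ++ vbasis D.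
have szC : size (vbasis D^C) = n by rewrite size_tuple dimv_compl dg dD -nd addnK.
have szB : size B == 8%N by rewrite size_cat szC size_tuple dD nd.
pose Bt : 8.-tuple g := Tuple szB.
have bB : basis_of fullv Bt.
  rewrite -(addv_complf D) addvC; apply: cat_basis; rewrite ?vbasisP //.
  by apply/directv_addP; rewrite capvC capv_compl.
have fB := basis_free bB.
pose cc i u : k := if insub i is Some j then coord Bt j u else 0.
have lcc i : lin (cc i).
  by move=> c u v; rewrite /cc; case: insub => [j|]; rewrite ?linearP // mulr0 addr0.
(* The first family is cut off at [n]: beyond it, [cc] yields coordinates on the derived algebra,
   which are not closed. *)
exists (fun i => if (i < n)%N then cc i else fun=> 0), (fun c => cc (n + c)%N); split.
  split=> //.
  - by move=> i; case: ifP => _ // c u v; rewrite mulr0 addr0.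
  - move=> u hx hz; rewrite (coord_basis bB (memvf u)) big1 // => i _.
    have [hi|hi] := ltnP i n.
      by have := hx i hi; rewrite hi /cc valK => ->; rewrite scale0r.
    have h : (i - n < d)%N by rewrite ltn_subLR // nd.
    by have := hz _ h; rewrite subnKC // /cc valK => ->; rewrite scale0r.
  - move=> i u v; case: ifP => hi //.
    have := lie_derived u v; rewrite -/D => /coord_vbasis ->.
    rewrite lin_sum // big1 // => c _; rewrite linZ //.
    have hc : (n + c < 8)%N by rewrite -nd ltn_add2l (leq_trans (ltn_ord c)) ?dD.
    have -> : (vbasis D)`_c = Bt`_(Ordinal hc) by rewrite nth_cat /= szC ltnNge leq_addr addKn.
    rewrite /cc; case: insubP => [j _ ej|_]; last by rewrite mulr0.
    rewrite coord_free // -val_eqE /= ej; case: eqP => [e|_]; last by rewrite mulr0.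
    by move: hi; rewrite -e ltnNge leq_addr.
move=> c u hc; rewrite /cc insubN //.
by rewrite -leqNgt -nd leq_add2l.
Qed.

Lemma admits_gen : exists p, admits g n [seq gen n (p c) | c <- iota 0 d].
Proof.
have [x [z [cxz z0]]] := coframe_exists; have [p Hp] := coframe_gen cxz.
exists p, x, z; rewrite size_map size_iota; split=> // c u v.
have [hc|hc] := ltnP c d; last by rewrite z0 // nth_default // size_map size_iota.
by rewrite (nth_map 0%N) ?size_iota // nth_iota // add0n Hp.
Qed.

Lemma admits_indep W (q : nat -> k) : admits g n W -> size W = d ->
  (forall a b, \sum_(c < d) q c * nth (@form0 k) W c a b = 0) ->
  forall c, (c < d)%N -> q c = 0.
Proof.
move=> [x [z [cxz Hz]]] sz H; rewrite sz in cxz; apply: (coframe_indep cxz) => u v.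
by rewrite -[RHS](H (x^~ u) (x^~ v)); apply: eq_bigr => c _; rewrite Hz.
Qed.

End Coframes.

(** * Darboux bases *)

Definition swap (i j l : nat) : nat := if l == i then j else if l == j then i else l.

Lemma swapP i j l : l = i /\ swap i j l = j \/ l <> i /\ l = j /\ swap i j l = i
  \/ l <> i /\ l <> j /\ swap i j l = l.
Proof. by rewrite /swap; do 2?case: eqP => ?; tauto. Qed.

Lemma swapK i j : involutive (swap i j).
Proof. by move=> l; rewrite /swap; do !case: eqP => //; move=> *; subst. Qed.

Lemma swap_lt n i j l : (i < n)%N -> (j < n)%N -> (l < n)%N -> (swap i j l < n)%N.
Proof. by move=> *; rewrite /swap; do !case: eqP. Qed.

Section Darboux.
Variables (k : fieldType) (g : lieAlgType k) (n d : nat).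
Hypotheses (dg : \dim {:g} = 8%N) (ts : two_step_nilpotent g).
Hypotheses (dD : \dim (derived_algebra g) = d) (nd : (n + d = 8)%N).
Variable z : nat -> g -> k.

Lemma coframe_swap x i j : (i < n)%N -> (j < n)%N ->
  coframe n d x z -> coframe n d (fun l => x (swap i j l)) z.
Proof.
move=> hi hj [lx lz inj cl]; split=> // u hx; apply: inj => l hl.
by rewrite -(swapK i j l); apply/hx/swap_lt.
Qed.

Lemma darboux_step x (h : g -> g -> k) r :
  coframe n d x z -> (forall v, lin (h^~ v)) -> (forall u, h u u = 0) ->
  (forall u v, h u v = - h v u) ->
  (forall u v, (forall i, (r.*2 <= i < n)%N -> x i u = 0) -> h u v = 0) ->
  (forall u v, h u v = 0) \/ (r.+1.*2 <= n)%N /\ exists X h',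
    [/\ coframe n d X z /\ (forall l, (l < r.*2)%N -> X l = x l), (forall v, lin (h'^~ v)),
      (forall u, h' u u = 0) /\ (forall u v, h' u v = - h' v u),
      (forall u v, (forall i, (r.+1.*2 <= i < n)%N -> X i u = 0) -> h' u v = 0)
      & forall u v, h u v = E r.*2 r.*2.+1 (X^~ u) (X^~ v) + h' u v].
Proof.
move=> cxz lh h0 hN hw; case: (cxz) => lx lz inj cl.
have /fin_all_exists [e He] : forall c : 'I_n, exists u,
  (forall i, (i < n)%N -> x i u = (i == c)%:R) /\
  (forall c' : nat, (c' < d)%N -> z c' u = 0).
  move=> c; exact: (coframe_surj dg nd cxz (fun c' => (c' == c)%:R) (fun=> 0)).
have xe (c : 'I_n) i : (i < n)%N -> x i (e c) = (i == c)%:R by apply: (He c).1.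
have lE a u u' v : h (a *: u + u') v = a * h u v + h u' v := lh v a u u'.
have dec u v : h u v = \sum_(i < n) x i u * h (e i) v.
  rewrite -[u in LHS](subrK (\sum_(i < n) x i u *: e i)) -[_ - _]scale1r lE mul1r hw.
    by rewrite add0r (lin_sum _ _ (lh v)); apply: eq_bigr => i _; rewrite (linZ _ _ (lh v)).
  move=> i /andP[_ hi]; rewrite -scaleN1r addrC lx lin_sum //.
  rewrite (bigD1 (Ordinal hi)) //= big1 => [|j hj].
    by rewrite linZ // xe //= eqxx mulr1 addr0 mulN1r addNr.
  rewrite linZ // xe //; move: hj; rewrite -val_eqE /= eq_sym => /negbTE ->.
  by rewrite mulr0.
have hlow (i : 'I_n) v : (i < r.*2)%N -> h (e i) v = 0.
  by move=> hi; apply: hw => l /andP[hl hl']; rewrite xe //; case: eqP => // el; lia.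
have [/existsP[i /existsP[j hij]]|/existsPn ne] :=
    boolP [exists i : 'I_n, exists j : 'I_n, h (e i) (e j) != 0]; last first.
  left=> u v; rewrite dec big1 // => i _; rewrite hN dec big1 ?oppr0 ?mulr0 // => j _.
  by move: (ne i) => /existsPn /(_ j); rewrite negbK hN oppr_eq0 => /eqP ->; rewrite mulr0.
right; set c := h (e i) (e j) in hij.
have hi : (r.*2 <= i)%N by rewrite leqNgt; apply/negP => hi; rewrite /c hlow ?eqxx in hij.
have hj : (r.*2 <= j)%N.
  by rewrite leqNgt; apply/negP => hj; rewrite /c hN hlow ?oppr0 ?eqxx in hij.
have nij : (i : nat) <> j by move=> /val_inj eij; rewrite /c eij h0 eqxx in hij.
have hin := ltn_ord i; have hjn := ltn_ord j.
split; first lia.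
(* The product of [y] and [y'] takes the same values as [h] against [e i] and against [e j], so the
   difference no longer involves [x i] and [x j]. *)
pose y u := h u (e j) / c; pose y' u := h (e i) u.
pose x1 l u := if l == i :> nat then y u else if l == j :> nat then y' u else x l u.
have dec2 u : (forall l, (r.*2 <= l < n)%N -> l <> i -> l <> j -> x l u = 0) ->
    forall v, h u v = x i u * y' v - x j u * c * y v.
  move=> hu v; rewrite dec (bigD1 i) //= (bigD1 j) /=; last by apply/eqP => /(congr1 val) /esym.
  rewrite big1 => [|l /andP[/eqP li /eqP lj]].
    by rewrite addr0 /y' /y [h (e j) v]hN; field.
  have [hl|hl] := ltnP l r.*2; first by rewrite hlow ?mulr0.
  by rewrite hu ?mul0r ?hl ?ltn_ord // => el; [apply: li|apply: lj]; apply: val_inj.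
have yi : y (e j) = 0 by rewrite /y h0 mul0r.
have y'i : y' (e i) = 0 by rewrite /y' h0.
have y'j : y' (e j) = c by [].
have yie : y (e i) = 1 by rewrite /y divff.
have lr u v w a : h w (a *: u + v) = a * h w u + h w v.
  by rewrite hN lE opprD -mulrN -!hN.
have cx1 : coframe n d x1 z.
  split=> //.
  - move=> l a u v; rewrite /x1; case: eqP => _; first by rewrite /y lE; ring.
    by case: (l == j :> nat); [rewrite /y' lr|rewrite lx].
  - move=> u hx; have hl l : (r.*2 <= l < n)%N -> l <> i -> l <> j -> x l u = 0.
      by move=> /andP[_ hl] li lj; have := hx l hl; rewrite /x1; do 2!case: eqP => // _.
    have ui : x i u = 0.
      have := hx i hin; rewrite /x1 eqxx /y dec2 // y'j yi mulr0 subr0 mulfK //.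
    have uj : x j u = 0.
      have := hx j hjn; rewrite /x1 eqxx; case: eqP => [/esym //|_].
      rewrite /y' hN dec2 // y'i yie ui mul0r mulr1 sub0r opprK => /eqP.
      by rewrite mulf_eq0 (negbTE hij) orbF => /eqP.
    apply: inj => l hl'; have := hx l hl'; rewrite /x1.
    case: (@eqP _ l i) => [->|_]; first by rewrite ui.
    by case: (@eqP _ l j) => [->|_]; first by rewrite uj.
  - move=> l u v; rewrite /x1 /y /y' [h (e i) _]hN !hw ?oppr0 ?mul0r ?cl //; do 2?case: ifP => //.
(* The transposition that brings [i] to [2r] may move [j]; [j'] is where it lands, and the second
   transposition brings it to [2r + 1]. *)
pose j' := swap i r.*2 j; pose X l := x1 (swap i r.*2 (swap j' r.*2.+1 l)).
have j'n : (j' < n)%N by apply: swap_lt => //; lia.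
have X0 : X r.*2 = y.
  have e1 : swap j' r.*2.+1 r.*2 = r.*2.
    by have := swapP j' r.*2.+1 r.*2; have := swapP i r.*2 j; rewrite -/j'; lia.
  have e2 : swap i r.*2 r.*2 = i by have := swapP i r.*2 r.*2; lia.
  by rewrite /X e1 e2 /x1 eqxx.
have X1 : X r.*2.+1 = y'.
  rewrite /X; have -> : swap j' r.*2.+1 r.*2.+1 = j'.
    by have := swapP j' r.*2.+1 r.*2.+1; lia.
  by rewrite swapK /x1; case: eqP => [/esym //|_]; rewrite eqxx.
have Xlow l : (l < r.*2)%N -> X l = x l.
  move=> hl; rewrite /X /x1.
  have -> : swap j' r.*2.+1 l = l.
    by have := swapP j' r.*2.+1 l; have := swapP i r.*2 j; rewrite -/j'; lia.
  have -> : swap i r.*2 l = l by have := swapP i r.*2 l; lia.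
  by do 2!(case: eqP; first lia).
have Xwin l : (r.*2 <= l < n)%N -> l <> i -> l <> j -> exists2 l', (r.+1.*2 <= l' < n)%N & X l' = x l.
  move=> hl li lj; exists (swap j' r.*2.+1 (swap i r.*2 l)).
    have h1 : (swap i r.*2 l < n)%N by apply: swap_lt; lia.
    have h2 : (swap j' r.*2.+1 (swap i r.*2 l) < n)%N by apply: swap_lt; lia.
    rewrite h2 andbT; have := swapP i r.*2 l; have := swapP i r.*2 j; rewrite -/j'.
    by have := swapP j' r.*2.+1 (swap i r.*2 l); lia.
  by rewrite /X !swapK /x1; do 2!case: eqP => // _.
exists X, (fun u v => h u v - E r.*2 r.*2.+1 (X^~ u) (X^~ v)).
have EX u v : E r.*2 r.*2.+1 (X^~ u) (X^~ v) = y u * y' v - y' u * y v by rewrite /E X0 X1.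
split.
- split=> //; apply: (@coframe_swap (fun l => x1 (swap i r.*2 l))); [lia|lia|].
  by apply: coframe_swap => //; lia.
- by move=> v a u u'; rewrite !EX lE /y /y' lr lE; ring.
- by split=> [u|u v]; rewrite !EX ?h0 1?hN; ring.
- move=> u v hu; rewrite EX.
  have hl l : (r.*2 <= l < n)%N -> l <> i -> l <> j -> x l u = 0.
    by move=> h1 h2 h3; have [l' hl' <-] := Xwin l h1 h2 h3; apply: hu.
  have -> : y u = x i u by rewrite /y dec2 // y'j yi; field.
  have -> : y' u = x j u * c by rewrite /y' hN dec2 // y'i yie; ring.
  by rewrite dec2 //; ring.
- by move=> u v; rewrite addrC subrK.
Qed.

Lemma darboux x (f : g -> g -> k) :
  coframe n d x z -> (forall v, lin (f^~ v)) -> (forall u, f u u = 0) ->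
  (forall u v, f u v = - f v u) ->
  (forall u v, (forall i, (i < n)%N -> x i u = 0) -> f u v = 0) ->
  exists X r, [/\ (r.*2 <= n)%N, coframe n d X z &
    forall u v, f u v = \sum_(l < r) E l.*2 l.*2.+1 (X^~ u) (X^~ v)].
Proof.
move=> cx lf f0 fN fw.
(* Induction on a bound [m] for the number of 1-forms not yet used, the first [r] products being
   already split off. *)
suff H : forall m r x h, (n - r.*2 <= m)%N -> (r.*2 <= n)%N -> coframe n d x z ->
  (forall v, lin (h^~ v)) -> (forall u, h u u = 0) -> (forall u v, h u v = - h v u) ->
  (forall u v, (forall i, (r.*2 <= i < n)%N -> x i u = 0) -> h u v = 0) ->
  (forall u v, f u v = \sum_(l < r) E l.*2 l.*2.+1 (x^~ u) (x^~ v) + h u v) ->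
  exists X r, [/\ (r.*2 <= n)%N, coframe n d X z &
    forall u v, f u v = \sum_(l < r) E l.*2 l.*2.+1 (X^~ u) (X^~ v)].
  apply: (H n 0%N x f) => //; first by rewrite subn0.
  by move=> u v; rewrite big_ord0 add0r.
clear x cx fw; elim=> [|m IH] r x h hm hr cx lh h0 hN hw fE;
  have [hz|[hr' [X [h' [[cX Xl] lh' [h0' hN'] hw' hE]]]]] := darboux_step cx lh h0 hN hw.
- by exists x, r; split=> // u v; rewrite fE hz addr0.
- by move: hr' hm; rewrite -!muln2; lia.
- by exists x, r; split=> // u v; rewrite fE hz addr0.
apply: (IH r.+1 X h') => //; first by move: hm hr'; rewrite doubleS; lia.
move=> u v; rewrite fE hE big_ord_recr /= addrA; congr (_ + _ + _).
by apply: eq_bigr => l _; rewrite /E !Xl // ?ltn_Sdouble ?ltn_double //; have := ltn_ord l; lia.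
Qed.

End Darboux.

(** * Choosing the first form of W *)

Section Lead.
Variables (k : fieldType) (g : lieAlgType k) (n d : nat).
Hypotheses (dg : \dim {:g} = 8%N) (ts : two_step_nilpotent g).
Hypotheses (dD : \dim (derived_algebra g) = d.+1) (nd : (n + d.+1 = 8)%N).

Definition comb (z : nat -> g -> k) (q : nat -> k) (u v : g) : k :=
  \sum_(c < d.+1) q c * z c (lie u v).

(** The combination [q] replaces [z c0], which [q c0 != 0] allows, and is moved to the front; the
    remaining forms become unknowns. *)
Lemma admits_lead (x z : nat -> g -> k) (q : nat -> k) c0 (F : form k) :
  coframe n d.+1 x z -> (c0 < d.+1)%N -> q c0 != 0 ->
  (forall u v, comb z q u v = F (x^~ u) (x^~ v)) ->
  exists p, admits g n (F :: [seq gen n (p c) | c <- iota 1 d]).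
Proof.
move=> [lx lz inj cl] hc0 qc0 HF.
pose z' l u := if l == 0%N then \sum_(c < d.+1) q c * z c u
  else if (l < d.+1)%N then z (swap 0 c0 l) u else 0.
have lz' l : lin (z' l).
  move=> a u v; rewrite /z'; case: ifP => _; last first.
    by case: ifP => _; rewrite ?lz // mulr0 addr0.
  rewrite mulr_sumr -big_split /=; apply: eq_bigr => c _; rewrite lz; ring.
have cxz' : coframe n d.+1 x z'.
  split=> // u hx hz; apply: inj => // c hc.
  have zc c' : (c' < d.+1)%N -> c' <> c0 -> z c' u = 0.
    move=> h1 h2; pose l := swap 0 c0 c'.
    have h3 : (l < d.+1)%N by apply: swap_lt.
    have h4 : l <> 0%N by have := swapP 0 c0 c'; rewrite -/l; lia.
    have := hz l h3; rewrite /z' (introF eqP h4) h3 /l swapK //.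
  have [e|/eqP/zc -> //] := eqVneq c c0; rewrite e.
  have := hz 0%N isT; rewrite /z' /= (bigD1 (Ordinal hc0)) //= big1 => [|c' hc'].
    by move/eqP; rewrite addr0 mulf_eq0 (negbTE qc0) => /eqP.
  by rewrite zc ?mulr0 //; apply/eqP; move: hc'; rewrite -val_eqE.
have [p Hp] := coframe_gen dg ts dD nd cxz'.
exists p, x, z'; rewrite /= size_map size_iota; split=> // -[|c] u v /=; first exact: HF.
have [hc|hc] := ltnP c d; last by rewrite nth_default ?size_map ?size_iota // /z' /= ltnS ltnNge hc.
by rewrite (nth_map 0%N) ?size_iota // nth_iota // add1n Hp.
Qed.

Lemma comb_neq0 (x z : nat -> g -> k) (q : nat -> k) c0 : coframe n d.+1 x z ->
  (c0 < d.+1)%N -> q c0 != 0 -> ~ (forall u v, comb z q u v = 0).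
Proof. by move=> cxz hc + h; rewrite (coframe_indep dg dD nd cxz h) // eqxx. Qed.

(** The rank is positive because the forms of [W] are independent. *)
Lemma darboux_comb (x z : nat -> g -> k) (q : nat -> k) c0 : coframe n d.+1 x z ->
  (c0 < d.+1)%N -> q c0 != 0 -> exists X r,
  [/\ (0 < r)%N, (r.*2 <= n)%N, coframe n d.+1 X z &
    forall u v, comb z q u v = \sum_(l < r) E l.*2 l.*2.+1 (X^~ u) (X^~ v)].
Proof.
move=> cxz hc qc; have [lx lz inj cl] := cxz.
have [|||u v hu|X [r [hr cX HX]]] := @darboux k g n d.+1 dg ts dD nd z x (comb z q) cxz.
- move=> v a u u'; rewrite /comb mulr_sumr -big_split /=; apply: eq_bigr => c _.
  by rewrite lieDl lieZl lz; ring.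
- by move=> u; rewrite /comb big1 // => c _; rewrite liexx lin0 ?mulr0.
- move=> u v; rewrite /comb -sumrN; apply: eq_bigr => c _.
  by rewrite lieC -scaleN1r linZ //; ring.
- have uD := coframe_kernel dg dD nd cxz hu.
  by rewrite /comb big1 // => c _; rewrite derived_central // lin0 ?mulr0.
exists X, r; split=> //; case: r HX {hr} => // HX.
by case: (comb_neq0 cxz hc qc) => u v; rewrite HX big_ord0.
Qed.

End Lead.

(* [(f ^ h)(u1, u2, u3, u4)] for two alternating forms [f] and [h]. *)
Definition wedge (k : fieldType) T (f h : T -> T -> k) u1 u2 u3 u4 : k :=
  f u1 u2 * h u3 u4 + f u3 u4 * h u1 u2 - (f u1 u3 * h u2 u4 + f u2 u4 * h u1 u3)
  + (f u1 u4 * h u2 u3 + f u2 u3 * h u1 u4).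

Definition wedge0 (k : fieldType) T (f h : T -> T -> k) :=
  forall u1 u2 u3 u4, wedge f h u1 u2 u3 u4 = 0.

Lemma gen4E (k : fieldType) (p : nat -> nat -> k) (a b : nat -> k) : gen 4 p a b =
  p#0#1 * E 0 1 a b + p#0#2 * E 0 2 a b + p#0#3 * E 0 3 a b +
  p#1#2 * E 1 2 a b + p#1#3 * E 1 3 a b + p#2#3 * E 2 3 a b.
Proof. by rewrite /gen !big_ord_recr !big_ord0 /=; ring. Qed.

Lemma gen5E (k : fieldType) (p : nat -> nat -> k) (a b : nat -> k) : gen 5 p a b =
  p#0#1 * E 0 1 a b + p#0#2 * E 0 2 a b + p#0#3 * E 0 3 a b + p#0#4 * E 0 4 a b +
  p#1#2 * E 1 2 a b + p#1#3 * E 1 3 a b + p#1#4 * E 1 4 a b + p#2#3 * E 2 3 a b +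
  p#2#4 * E 2 4 a b + p#3#4 * E 3 4 a b.
Proof. by rewrite /gen !big_ord_recr !big_ord0 /=; ring. Qed.

Lemma gen6E (k : fieldType) (p : nat -> nat -> k) (a b : nat -> k) : gen 6 p a b =
  p#0#1 * E 0 1 a b + p#0#2 * E 0 2 a b + p#0#3 * E 0 3 a b + p#0#4 * E 0 4 a b +
  p#0#5 * E 0 5 a b + p#1#2 * E 1 2 a b + p#1#3 * E 1 3 a b + p#1#4 * E 1 4 a b +
  p#1#5 * E 1 5 a b + p#2#3 * E 2 3 a b + p#2#4 * E 2 4 a b + p#2#5 * E 2 5 a b +
  p#3#4 * E 3 4 a b + p#3#5 * E 3 5 a b + p#4#5 * E 4 5 a b.
Proof. by rewrite /gen !big_ord_recr !big_ord0 /=; ring. Qed.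

Definition cross4 (k : fieldType) (m02 m03 m12 m13 : k) : form k := fun a b =>
  m02 * E 0 2 a b + m03 * E 0 3 a b + m12 * E 1 2 a b + m13 * E 1 3 a b.

(* [e0 ^ (a2 e2 + a3 e3 + a4 e4) + e1 ^ (b2 e2 + b3 e3 + b4 e4)] *)
Definition cross (k : fieldType) (a2 a3 a4 b2 b3 b4 : k) : form k := fun a b =>
  a2 * E 0 2 a b + a3 * E 0 3 a b + a4 * E 0 4 a b +
  (b2 * E 1 2 a b + b3 * E 1 3 a b + b4 * E 1 4 a b).

Definition cross8 (k : fieldType) (a2 a3 a4 a5 b2 b3 b4 b5 : k) : form k := fun a b =>
  a2 * E 0 2 a b + a3 * E 0 3 a b + a4 * E 0 4 a b + a5 * E 0 5 a b +
  (b2 * E 1 2 a b + b3 * E 1 3 a b + b4 * E 1 4 a b + b5 * E 1 5 a b).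

Definition sp4 {k : fieldType} : form k := fun a b => E 0 1 a b + E 2 3 a b.

Definition eta6 (k : fieldType) (l h01 h02 h03 h12 h13 h23 : k) : form k := fun a b =>
  l * E 4 5 a b + h01 * E 0 1 a b + h02 * E 0 2 a b + h03 * E 0 3 a b +
  h12 * E 1 2 a b + h13 * E 1 3 a b + h23 * E 2 3 a b.

(* [(a0 e0 + ... + a3 e3) ^ e4 + (b0 e0 + ... + b3 e3) ^ e5] plus a form on [e0, ..., e3]. *)
Definition arm (k : fieldType) (a0 a1 a2 a3 b0 b1 b2 b3 h01 h02 h03 h12 h13 h23 : k) : form k := fun a b =>
  a0 * E 0 4 a b + a1 * E 1 4 a b + a2 * E 2 4 a b + a3 * E 3 4 a b +
  b0 * E 0 5 a b + b1 * E 1 5 a b + b2 * E 2 5 a b + b3 * E 3 5 a b +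
  eta6 0 h01 h02 h03 h12 h13 h23 a b.

Ltac nth_cases i := do 9?[case: i => [|i]] => //=; rewrite ?nth_nil.

Ltac fld := rewrite ?add0r ?addr0; field; rewrite ?andbT; repeat (apply/andP; split); try assumption; try done.

Ltac chg_side :=
  first
  [ by []
  | match goal with
    | |- forall i c a b e, (forall j, e j = _) -> _ =>
        let i := fresh "i" in let He := fresh "He" in
        move=> i ? ? ? ? He; nth_cases i; rewrite ?He; try ring
    | |- forall a i, is_true (i < _)%N -> _ =>
        let i := fresh "i" in move=> ? i; nth_cases i; move=> _; try fld
    | |- forall a i, (forall j, _ -> a j = 0) -> _ =>
        let i := fresh "i" in let He := fresh "He" in
        move=> ? i He; nth_cases i; move=> _; rewrite !He //; try ring
    end ].

Ltac chg_eq :=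
  let c := fresh "c" in
  move=> c ? ?; nth_cases c;
  rewrite ?(gen4E, gen5E, gen6E) /form_of /cross4 /cross8 /cross /arm /eta6 /sp4 /E /form0 /=; try fld.

(* Applies [admits_change] with lists of linear expressions; the obligations are rational identities
   in the coefficients, with denominators known to be nonzero from the context. *)
Tactic Notation "chg" constr(H) uconstr(s) uconstr(s') uconstr(t) uconstr(t') :=
  apply (admits_change (s := s) (s' := s') (t := t) (t' := t') H); [chg_side..|chg_eq].

Lemma quad_root (k : closedFieldType) (a b c : k) : a != 0 ->
  exists x, a * x ^+ 2 + b * x + c = 0.
Proof.
move=> a0; have [x hx] := @solve_monicpoly k 2 (nth 0 [:: - c / a; - b / a]) isT.
exists x; rewrite hx !big_ord_recr big_ord0 /= expr0 expr1; field; exact: a0.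
Qed.

Definition std (k : fieldType) (g : lieAlgType k) n (Ts : seq (seq (seq (nat * nat)))) :=
  exists2 T, T \in Ts & admits g n (map (@form_of k) T).

Tactic Notation "fin" constr(T) constr(H) uconstr(s) uconstr(s') uconstr(t) uconstr(t') :=
  exists T; [by []|]; chg H s s' t t'.
Definition id3 (k : fieldType) (a : nat -> k) := [:: a#0; a#1; a#2].
Definition id5 (k : fieldType) (a : nat -> k) := [:: a#0; a#1; a#2; a#3; a#4].

(** * Derived algebra of dimension 3 *)

(** Every entry but the last contains [e_0 ^ e_1]; the last is the space of the nondegenerate
    conic. *)
Definition T53 : seq (seq (seq (nat * nat))) := [::
  [:: [:: (0,1)]; [:: (0,2)]; [:: (1,2)]];
  [:: [:: (0,1)]; [:: (0,2)]; [:: (0,3)]];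
  [:: [:: (0,1)]; [:: (0,2)]; [:: (0,3); (1,2)]];
  [:: [:: (0,1)]; [:: (0,2)]; [:: (1,3)]];
  [:: [:: (0,1)]; [:: (0,2); (1,3)]; [:: (2,3)]];
  [:: [:: (0,1)]; [:: (0,4)]; [:: (2,3)]];
  [:: [:: (0,1)]; [:: (0,4); (1,2)]; [:: (2,3)]];
  [:: [:: (0,1)]; [:: (2,3)]; [:: (2,4); (0,4)]];
  [:: [:: (0,1)]; [:: (2,3); (0,4); (1,3)]; [:: (2,4)]];
  [:: [:: (0,1)]; [:: (2,3); (0,4)]; [:: (2,4); (1,3)]];
  [:: [:: (0,1)]; [:: (0,3); (1,2)]; [:: (2,3); (0,4)]];
  [:: [:: (0,1)]; [:: (1,2)]; [:: (2,3); (0,4)]];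
  [:: [:: (0,1)]; [:: (1,4)]; [:: (2,3); (0,4)]];
  [:: [:: (0,1)]; [:: (1,4); (0,2)]; [:: (2,3); (0,4)]];
  [:: [:: (0,1)]; [:: (0,2); (1,3)]; [:: (0,3); (1,4)]];
  [:: [:: (0,1)]; [:: (0,2)]; [:: (0,4); (2,3)]];
  [:: [:: (0,3); (1,2)]; [:: (0,4); (1,3)]; [:: (1,4); (2,3)]]]%N.

(** * A decomposable form with a restriction of dimension 2: subspaces of sl2 *)

Section CaseA.
Variables (k : closedFieldType) (g : lieAlgType k).
Hypothesis two_neq0 : (2 : k) != 0.

(** The coefficients of [e_0 ^ e_3] and [e_0 ^ e_4] in the last two forms are the rows of a
    traceless matrix [(m0, n0; l0, -m0)], and those with [e_1] give a second one. Changes of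
    [e_3, e_4] conjugate both matrices and changes of [e_0, e_1] combine them: what is classified is
    a subspace of sl2 up to conjugation. *)
Definition sl2_pair (m0 n0 l0 m1 n1 l1 : k) : seq (form k) :=
  [:: E 0 1;
      fun a b => E 2 3 a b + m0 * E 0 3 a b + n0 * E 0 4 a b + m1 * E 1 3 a b + n1 * E 1 4 a b;
      fun a b => E 2 4 a b + l0 * E 0 3 a b - m0 * E 0 4 a b + l1 * E 1 3 a b - m1 * E 1 4 a b].

Lemma sl2_swap m0 n0 l0 m1 n1 l1 :
  admits g 5 (sl2_pair m0 n0 l0 m1 n1 l1) -> admits g 5 (sl2_pair m1 n1 l1 m0 n0 l0).
Proof.
move=> H.
by chg H (fun a => [:: a#1; a#0; a#2; a#3; a#4]) (fun a => [:: a#1; a#0; a#2; a#3; a#4])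
  (fun a => [:: - a#0; a#1; a#2]) (fun a => [:: - a#0; a#1; a#2]).
Qed.

(** The subspaces of sl2 to be met: zero ([sl2_A0]), a nilpotent line ([sl2_Ae]), a semisimple line
    ([sl2_Ah]), a Borel subalgebra ([sl2_Ab]), and a plane on which the determinant is nondegenerate
    ([sl2_Aef]). *)
Lemma sl2_A0 : admits g 5 (sl2_pair 0 0 0 0 0 0) -> std g 5 T53.
Proof.
move=> H.
by fin [:: [:: (0,1)]; [:: (0,4)]; [:: (2,3)]]%N H
  (fun a => [:: a#2; a#3; a#0; a#1; a#4]) (fun a => [:: a#2; a#3; a#0; a#1; a#4])
  (fun a => [:: a#1; a#2; a#0]) (fun a => [:: a#2; a#0; a#1]).
Qed.

Lemma sl2_Ae : admits g 5 (sl2_pair 0 0 0 0 1 0) -> std g 5 T53.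
Proof.
move=> H.
by fin [:: [:: (0,1)]; [:: (0,4); (1,2)]; [:: (2,3)]]%N H
  (fun a => [:: a#2; a#4; - a#1; a#0; a#3]) (fun a => [:: a#3; - a#2; a#0; a#4; a#1])
  (fun a => [:: a#2; a#1; a#0]) (fun a => [:: a#2; a#1; a#0]).
Qed.

Lemma sl2_Aef l m : l != 0 -> admits g 5 (sl2_pair m 0 l 0 1 0) -> std g 5 T53.
Proof.
move=> l0 H.
by fin [:: [:: (0,1)]; [:: (2,3); (0,4)]; [:: (2,4); (1,3)]]%N H
  (fun a => [:: a#1 + m ^+ 2 / l * a#0; l * a#0; a#2; a#3 - m / l * a#4; a#4])
  (fun a => [:: a#1 / l; a#0 - m ^+ 2 / l * (a#1 / l); a#2; a#3 + m / l * a#4; a#4])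
  (fun a => [:: - l * a#0; a#1 - m / l * a#2; a#2])
  (fun a => [:: - a#0 / l; a#1 + m / l * a#2; a#2]).
Qed.

Lemma sl2_Ab m : m != 0 -> admits g 5 (sl2_pair m 0 0 0 1 0) -> std g 5 T53.
Proof.
move=> m0 H.
by fin [:: [:: (0,1)]; [:: (2,3); (0,4); (1,3)]; [:: (2,4)]]%N H
  (fun a => [:: a#1; 2 * m * a#0; a#2 - m * a#0; a#3; a#4])
  (fun a => [:: a#1 / (2 * m); a#0; a#2 + a#1 / 2; a#3; a#4])
  (fun a => [:: - (2 * m) * a#0; a#1; a#2])
  (fun a => [:: - a#0 / (2 * m); a#1; a#2]).
Qed.

Lemma sl2_Ah m : m != 0 -> admits g 5 (sl2_pair m 0 0 0 0 0) -> std g 5 T53.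
Proof.
move=> m0 H.
by fin [:: [:: (0,1)]; [:: (2,3)]; [:: (2,4); (0,4)]]%N H
  (fun a => [:: - (2 * m) * a#0; a#1; a#2 + m * a#0; a#3; a#4])
  (fun a => [:: - a#0 / (2 * m); a#1; a#2 + a#0 / 2; a#3; a#4])
  (fun a => [:: - (2 * m) * a#0; a#1; a#2])
  (fun a => [:: - a#0 / (2 * m); a#1; a#2]).
Qed.

(* The second matrix is the nilpotent [e]; subtracting a multiple of it from the
   first one clears the upper right entry of the latter. *)
Lemma sl2_nilp_std m n l : admits g 5 (sl2_pair m n l 0 1 0) -> std g 5 T53.
Proof.
move=> H.
have {}H : admits g 5 (sl2_pair m 0 l 0 1 0).
  by chg H (fun a => [:: a#0; a#1 + n * a#0; a#2; a#3; a#4])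
    (fun a => [:: a#0; a#1 - n * a#0; a#2; a#3; a#4])
    (fun a => [:: a#0; a#1; a#2]) (fun a => [:: a#0; a#1; a#2]).
have [l0|l0] := eqVneq l 0; last exact: sl2_Aef H.
rewrite l0 in H; have [m0|m0] := eqVneq m 0; last exact: sl2_Ab H.
by rewrite m0 in H; apply: sl2_Ae.
Qed.

(** A nonzero traceless singular matrix is conjugate to [e]: its first row becomes the new [e_4],
    and if that row is zero [e_3] and [e_4] are exchanged. *)
Lemma sl2_nilp m0 n0 l0 m n l : m ^+ 2 + n * l = 0 -> (n != 0) || (l != 0) ->
  admits g 5 (sl2_pair m0 n0 l0 m n l) -> std g 5 T53.
Proof.
move=> hd hnl H; have [n_0|n_0] := eqVneq n 0.
  rewrite n_0 eqxx /= in hnl.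
  have m_0 : m = 0 by apply/eqP; rewrite -sqrf_eq0 -hd n_0 mul0r addr0.
  rewrite n_0 m_0 in H; apply: (@sl2_nilp_std (- m0) (l0 / l) (n0 * l)).
  by chg H (fun a => [:: a#0; a#1; a#2; a#4; l * a#3])
    (fun a => [:: a#0; a#1; a#2; a#4 / l; a#3])
    (fun a => [:: a#0; a#2; l * a#1]) (fun a => [:: a#0; a#2 / l; a#1]).
have hl : l = - m ^+ 2 / n.
  by apply: (mulfI n_0); rewrite mulrC mulrCA divff // mulr1; apply/eqP; rewrite -addr_eq0 mulrC addrC hd.
rewrite hl in H.
apply: (@sl2_nilp_std (m0 - n0 * m / n) (n0 / n) (2 * m * m0 - n0 * m ^+ 2 / n + n * l0)).
by chg H (fun a => [:: a#0; a#1; a#2; a#3; m * a#3 + n * a#4])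
    (fun a => [:: a#0; a#1; a#2; a#3; (a#4 - m * a#3) / n])
    (fun a => [:: a#0; a#1; m * a#1 + n * a#2])
    (fun a => [:: a#0; a#1; (a#2 - m * a#1) / n]).
Qed.

(** The eigenvalues are the two square roots of [m^2 + n l], which differ since 2 is invertible; the
    matrix can be diagonalized. *)
Lemma sl2_ss m n l : m ^+ 2 + n * l != 0 ->
  admits g 5 (sl2_pair m n l 0 0 0) -> std g 5 T53.
Proof.
move=> hd H; have [n_0|n_0] := eqVneq n 0.
  have m0 : m != 0 by move: hd; rewrite n_0 mul0r addr0 sqrf_eq0.
  rewrite n_0 in H.
  apply: (@sl2_Ah m) => //.
  by chg H (fun a => [:: a#0; a#1; a#2; a#3; l * a#3 - 2 * m * a#4])
    (fun a => [:: a#0; a#1; a#2; a#3; (l * a#3 - a#4) / (2 * m)])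
    (fun a => [:: a#0; a#1; l * a#1 - 2 * m * a#2])
    (fun a => [:: a#0; a#1; (l * a#1 - a#2) / (2 * m)]).
have [r] := @quad_root k 1 0 (- (m ^+ 2 + n * l)) (oner_neq0 _).
rewrite mul0r addr0 mul1r => /eqP; rewrite subr_eq0 => /eqP hr.
have r0 : r != 0 by move: hd; rewrite -hr sqrf_eq0.
have hl : l = (r ^+ 2 - m ^+ 2) / n by rewrite hr; field.
rewrite hl in H; apply: (@sl2_Ah r) => //.
by chg H (fun a => [:: a#0; a#1; a#2; (m + r) * a#3 + n * a#4; (m - r) * a#3 + n * a#4])
    (fun a => [:: a#0; a#1; a#2; (a#3 - a#4) / (2 * r); ((m + r) * a#4 - (m - r) * a#3) / (2 * r * n)])
    (fun a => [:: a#0; (m + r) * a#1 + n * a#2; (m - r) * a#1 + n * a#2])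
    (fun a => [:: a#0; (a#1 - a#2) / (2 * r); ((m + r) * a#2 - (m - r) * a#1) / (2 * r * n)]).
Qed.

Lemma sl2_std m0 n0 l0 m n l : admits g 5 (sl2_pair m0 n0 l0 m n l) -> std g 5 T53.
Proof.
have step m0' n0' l0' m' n' l' : m' ^+ 2 + n' * l' = 0 ->
    admits g 5 (sl2_pair m0' n0' l0' m' n' l') -> std g 5 T53.
  move=> hd H; have [|] := boolP ((n' != 0) || (l' != 0)); first by move=> hnl; apply: sl2_nilp hd hnl H.
  rewrite negb_or !negbK => /andP[/eqP n0_ /eqP l0_].
  have m0_ : m' = 0 by apply/eqP; rewrite -sqrf_eq0 -hd n0_ mul0r addr0.
  rewrite m0_ n0_ l0_ in H; have [hd0|hd0] := eqVneq (m0' ^+ 2 + n0' * l0') 0; last exact: sl2_ss hd0 H.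
  have [|] := boolP ((n0' != 0) || (l0' != 0)); first by move=> hnl; apply: sl2_nilp hd0 hnl (sl2_swap H).
  rewrite negb_or !negbK => /andP[/eqP n00 /eqP l00].
  have m00 : m0' = 0 by apply/eqP; rewrite -sqrf_eq0 -hd0 n00 mul0r addr0.
  by rewrite m00 n00 l00 in H; apply: sl2_A0.
move=> H; have [hd|hd] := eqVneq (m0 ^+ 2 + n0 * l0) 0.
  exact: step hd (sl2_swap H).
(* The determinant is quadratic, so some matrix [M + s M0] of the plane is singular. *)
have [s hs] := quad_root (2 * m0 * m + n0 * l + n * l0) (m ^+ 2 + n * l) hd.
apply: (step m0 n0 l0 (m + s * m0) (n + s * n0) (l + s * l0)); first by rewrite -hs; ring.
by chg H (fun a => [:: a#0 - s * a#1; a#1; a#2; a#3; a#4])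
  (fun a => [:: a#0 + s * a#1; a#1; a#2; a#3; a#4])
  (fun a => [:: a#0; a#1; a#2]) (fun a => [:: a#0; a#1; a#2]).
Qed.
End CaseA.

(** * A decomposable form with a restriction of dimension 1 *)

Section CaseB.
Variables (k : closedFieldType) (g : lieAlgType k).

Definition caseB (r a2 a3 a4 b2 b3 b4 : k) : seq (form k) :=
  [:: E 0 1; fun a b => E 2 3 a b + r * E 0 4 a b; cross a2 a3 a4 b2 b3 b4].

Definition caseC (a2 a3 a4 b2 b3 b4 c2 c3 c4 d2 d3 d4 : k) : seq (form k) :=
  [:: E 0 1; cross a2 a3 a4 b2 b3 b4; cross c2 c3 c4 d2 d3 d4].

Hypothesis indep : forall W, admits g 5 W -> size W = 3%N ->
  forall q0 q1 q2, (forall a b, q0 * nth (@form0 k) W 0 a b + q1 * nth (@form0 k) W 1 a b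
    + q2 * nth (@form0 k) W 2 a b = 0) -> [&& q0 == 0, q1 == 0 & q2 == 0].

(* Moves the covector [e2] of the plane [<e2, e3>] to [b2 e2 + b3 e3], keeping [e2 ^ e3]. *)
Lemma caseB_rot r a2 a3 a4 b2 b3 b4 : (b2 != 0) || (b3 != 0) ->
  admits g 5 (caseB r a2 a3 a4 b2 b3 b4) ->
  exists c2 c3, admits g 5 (caseB r c2 c3 a4 1 0 b4).
Proof.
have [b20|b20] := eqVneq b2 0 => /= [b30|_] H.
  exists (a3 / b3), (- a2 * b3); rewrite b20 in H.
  by chg H (fun a => [:: a#0; a#1; b3 * a#3; - a#2 / b3; a#4])
    (fun a => [:: a#0; a#1; - b3 * a#3; a#2 / b3; a#4]) (@id3 k) (@id3 k).
exists (a2 / b2), (a3 * b2 - a2 * b3).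
by chg H (fun a => [:: a#0; a#1; b2 * a#2 + b3 * a#3; a#3 / b2; a#4])
    (fun a => [:: a#0; a#1; a#2 / b2 - b3 * a#3; b2 * a#3; a#4]) (@id3 k) (@id3 k).
Qed.

Lemma caseB_swap0 a2 a3 a4 b2 b3 b4 :
  admits g 5 (caseB 0 a2 a3 a4 b2 b3 b4) -> admits g 5 (caseB 0 b2 b3 b4 a2 a3 a4).
Proof.
move=> H.
by chg H (fun a => [:: a#1; a#0; a#2; a#3; a#4])
  (fun a => [:: a#1; a#0; a#2; a#3; a#4])
  (fun a => [:: - a#0; a#1; a#2]) (fun a => [:: - a#0; a#1; a#2]).
Qed.

(** The covector multiplied by [e_0] involves [e_4] and can replace it; adding a multiple of [e_1]
    to [e_0] then frees the covector multiplied by [e_1] from [e_4]. *)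
Lemma caseB_r0_a4 a2 a3 a4 b2 b3 b4 : a4 != 0 ->
  admits g 5 (caseB 0 a2 a3 a4 b2 b3 b4) -> std g 5 T53.
Proof.
move=> a40 H.
have {}H : admits g 5 (caseB 0 0 0 1 (b2 - b4 / a4 * a2) (b3 - b4 / a4 * a3) 0).
  by chg H (fun a => [:: a#0 + b4 / a4 * a#1; a#1; a#2; a#3; a2 * a#2 + a3 * a#3 + a4 * a#4])
    (fun a => [:: a#0 - b4 / a4 * a#1; a#1; a#2; a#3; (a#4 - a2 * a#2 - a3 * a#3) / a4]) (@id3 k) (@id3 k).
move: (b2 - _) (b3 - _) H => c2 c3 H; have [hc|] := boolP ((c2 != 0) || (c3 != 0)).
  have [d2 [d3 {}H]] := caseB_rot hc H.
  by fin [:: [:: (0,1)]; [:: (0,4); (1,2)]; [:: (2,3)]]%N H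
    (fun a => [:: a#0; a#1; a#2; a#3; a#4 + d2 * a#2 + d3 * a#3])
    (fun a => [:: a#0; a#1; a#2; a#3; a#4 - d2 * a#2 - d3 * a#3])
    (fun a => [:: a#0; a#2; a#1]) (fun a => [:: a#0; a#2; a#1]).
rewrite negb_or !negbK => /andP[/eqP c20 /eqP c30]; rewrite c20 c30 in H.
by fin [:: [:: (0,1)]; [:: (0,4)]; [:: (2,3)]]%N H (@id5 k) (@id5 k)
    (fun a => [:: a#0; a#2; a#1]) (fun a => [:: a#0; a#2; a#1]).
Qed.

Lemma caseB_r0_b23 a2 a3 b2 b3 : (b2 != 0) || (b3 != 0) ->
  admits g 5 (caseB 0 a2 a3 0 b2 b3 0) -> std g 5 T53.
Proof.
move=> hb H; have [c2 [c3 {}H]] := caseB_rot hb H.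
have [c30|c30] := eqVneq c3 0.
  rewrite c30 in H.
  by fin [:: [:: (0,1)]; [:: (0,2)]; [:: (1,3)]]%N H
    (fun a => [:: a#1 + c2 * a#0; a#2; a#0; a#3; a#4])
    (fun a => [:: a#2; a#0 - c2 * a#2; a#1; a#3; a#4])
    (fun a => [:: a#2; - a#0; a#1]) (fun a => [:: - a#1; a#2; a#0]).
by fin [:: [:: (0,1)]; [:: (0,2); (1,3)]; [:: (2,3)]]%N H
    (fun a => [:: a#1 + c2 * a#0; c3 * a#0; a#2; a#3; a#4])
    (fun a => [:: a#1 / c3; a#0 - c2 * a#1 / c3; a#2; a#3; a#4])
    (fun a => [:: - c3 * a#0; a#2; a#1]) (fun a => [:: - a#0 / c3; a#2; a#1]).
Qed.

Lemma caseB_r0 a2 a3 a4 b2 b3 b4 :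
  admits g 5 (caseB 0 a2 a3 a4 b2 b3 b4) -> std g 5 T53.
Proof.
move=> H; have [a40|a40] := eqVneq a4 0; last exact: caseB_r0_a4 a40 H.
have [b40|b40] := eqVneq b4 0; last exact: caseB_r0_a4 b40 (caseB_swap0 H).
rewrite a40 b40 in H.
have [hb|] := boolP ((b2 != 0) || (b3 != 0)); first exact: caseB_r0_b23 hb H.
have [ha _|] := boolP ((a2 != 0) || (a3 != 0)); first exact: caseB_r0_b23 ha (caseB_swap0 H).
rewrite !negb_or !negbK => /andP[/eqP a20 /eqP a30] /andP[/eqP b20 /eqP b30].
rewrite a20 a30 b20 b30 in H.
suff : [&& (0 : k) == 0, (0 : k) == 0 & (1 : k) == 0] by rewrite oner_eq0 !andbF.
by apply: (indep H) => // a b; rewrite /= /cross; ring.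
Qed.

Lemma caseB_rota r a2 a3 a4 b4 : (a2 != 0) || (a3 != 0) ->
  admits g 5 (caseB r a2 a3 a4 0 0 b4) -> admits g 5 (caseB r 1 0 a4 0 0 b4).
Proof.
have [a20|a20] := eqVneq a2 0 => /= [a30|_] H.
  rewrite a20 in H.
  by chg H (fun a => [:: a#0; a#1; a3 * a#3; - a#2 / a3; a#4])
    (fun a => [:: a#0; a#1; - a3 * a#3; a#2 / a3; a#4]) (@id3 k) (@id3 k).
by chg H (fun a => [:: a#0; a#1; a2 * a#2 + a3 * a#3; a#3 / a2; a#4])
    (fun a => [:: a#0; a#1; a#2 / a2 - a3 * a#3; a2 * a#3; a#4]) (@id3 k) (@id3 k).
Qed.

Lemma caseB_r1_b4 a2 a3 a4 b2 b3 b4 : b4 != 0 ->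
  admits g 5 (caseB 1 a2 a3 a4 b2 b3 b4) -> std g 5 T53.
Proof.
move=> b40 H.
have {}H : admits g 5 (caseB 1 (b4 * a2 - a4 * b2) (b4 * a3 - a4 * b3) 0 0 0 1).
  by chg H (fun a => [:: a#0 / b4; a#1 + a4 / b4 * a#0; a#2 - b3 / b4 * a#0;
      a#3 + b2 / b4 * a#0; b2 * a#2 + b3 * a#3 + b4 * a#4])
    (fun a => [:: b4 * a#0; a#1 - a4 * a#0; a#2 + b3 * a#0; a#3 - b2 * a#0;
      (a#4 - b2 * a#2 - b3 * a#3) / b4])
    (fun a => [:: a#0 / b4; a#1; a#2]) (fun a => [:: b4 * a#0; a#1; a#2]).
move: (_ - _) (_ - _) H => c3 c2 H; have [hc|] := boolP ((c2 != 0) || (c3 != 0)).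
  have {}H := caseB_rota hc H.
  by fin [:: [:: (0,1)]; [:: (1,4); (0,2)]; [:: (2,3); (0,4)]]%N H (@id5 k) (@id5 k)
    (fun a => [:: a#0; a#2; a#1]) (fun a => [:: a#0; a#2; a#1]).
rewrite negb_or !negbK => /andP[/eqP c20 /eqP c30]; rewrite c20 c30 in H.
by fin [:: [:: (0,1)]; [:: (1,4)]; [:: (2,3); (0,4)]]%N H (@id5 k) (@id5 k)
    (fun a => [:: a#0; a#2; a#1]) (fun a => [:: a#0; a#2; a#1]).
Qed.

Lemma caseB_r1_b23 a2 a3 a4 b2 b3 : (b2 != 0) || (b3 != 0) ->
  admits g 5 (caseB 1 a2 a3 a4 b2 b3 0) -> std g 5 T53.
Proof.
move=> hb H; have [c2 [c3 {}H]] := caseB_rot hb H.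
have {}H : admits g 5 (caseB 1 0 c3 a4 1 0 0).
  by chg H (fun a => [:: a#0; a#1 + c2 * a#0; a#2; a#3; a#4])
    (fun a => [:: a#0; a#1 - c2 * a#0; a#2; a#3; a#4]) (@id3 k) (@id3 k).
have [a40|a40] := eqVneq a4 0; last first.
  (* Modulo [e_0 ^ e_1], the second form minus [1 / a4] times the third is decomposable; it becomes
     [e_2 ^ e_3]. *)
  by fin [:: [:: (0,1)]; [:: (0,4); (1,2)]; [:: (2,3)]]%N H
    (fun a => [:: a#0; a#1; a#2 - c3 / a4 * a#0; a#3 + a#1 / a4; c3 * a#3 + a4 * a#4])
    (fun a => [:: a#0; a#1; a#2 + c3 / a4 * a#0; a#3 - a#1 / a4;
       (a#4 - c3 * (a#3 - a#1 / a4)) / a4])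
    (fun a => [:: a#0; a#2 + c3 / a4 * a#0; a#1 - a#2 / a4 - c3 / a4 ^+ 2 * a#0])
    (fun a => [:: a#0; a#2 + a#1 / a4; a#1 - c3 / a4 * a#0]).
rewrite a40 in H; have [c30|c30] := eqVneq c3 0.
  rewrite c30 in H.
  by fin [:: [:: (0,1)]; [:: (1,2)]; [:: (2,3); (0,4)]]%N H (@id5 k) (@id5 k)
    (fun a => [:: a#0; a#2; a#1]) (fun a => [:: a#0; a#2; a#1]).
by fin [:: [:: (0,1)]; [:: (0,3); (1,2)]; [:: (2,3); (0,4)]]%N H
    (fun a => [:: a#0; a#1; a#2; c3 * a#3; c3 * a#4])
    (fun a => [:: a#0; a#1; a#2; a#3 / c3; a#4 / c3])
    (fun a => [:: a#0; a#2; c3 * a#1]) (fun a => [:: a#0; a#2 / c3; a#1]).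
Qed.

Lemma caseB_r1 a2 a3 a4 b2 b3 b4 :
  admits g 5 (caseB 1 a2 a3 a4 b2 b3 b4) -> std g 5 T53.
Proof.
move=> H; have [b40|b40] := eqVneq b4 0; last exact: caseB_r1_b4 b40 H.
rewrite b40 in H.
have [hb|] := boolP ((b2 != 0) || (b3 != 0)); first exact: caseB_r1_b23 hb H.
rewrite negb_or !negbK => /andP[/eqP b20 /eqP b30]; rewrite b20 b30 in H.
have [a40|a40] := eqVneq a4 0; last first.
  by fin [:: [:: (0,1)]; [:: (0,4)]; [:: (2,3)]]%N H
    (fun a => [:: a#0; a#1; a#2 - a3 / a4 * a#0; a#3 + a2 / a4 * a#0;
       a2 * a#2 + a3 * a#3 + a4 * a#4])
    (fun a => [:: a#0; a#1; a#2 + a3 / a4 * a#0; a#3 - a2 / a4 * a#0;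
       (a#4 - a2 * a#2 - a3 * a#3) / a4])
    (fun a => [:: a#0; a#2; a#1 - a#2 / a4])
    (fun a => [:: a#0; a#2 + a#1 / a4; a#1]).
rewrite a40 in H.
have [ha|] := boolP ((a2 != 0) || (a3 != 0)).
  have {}H := caseB_rota ha H.
  by fin [:: [:: (0,1)]; [:: (0,2)]; [:: (0,4); (2,3)]]%N H (@id5 k) (@id5 k)
    (fun a => [:: a#0; a#2; a#1]) (fun a => [:: a#0; a#2; a#1]).
rewrite negb_or !negbK => /andP[/eqP a20 /eqP a30]; rewrite a20 a30 in H.
suff : [&& (0 : k) == 0, (0 : k) == 0 & (1 : k) == 0] by rewrite oner_eq0 !andbF.
by apply: (indep H) => // a b; rewrite /= /cross; ring.
Qed.

(* The forms [E 0 1 ^ _] are irrelevant modulo the first form, so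
   [r e0 + s e1] can be made a basis vector of [<e0, e1>]. *)
Lemma caseB_std r s a2 a3 a4 b2 b3 b4 : admits g 5 [:: E 0 1;
    fun a b => E 2 3 a b + r * E 0 4 a b + s * E 1 4 a b; cross a2 a3 a4 b2 b3 b4] ->
  std g 5 T53.
Proof.
move=> H; have [r0|r0] := eqVneq r 0; last first.
  apply: (@caseB_r1 (a2 / r) (a3 / r) (a4 / r) (r * b2 - s * a2) (r * b3 - s * a3) (r * b4 - s * a4)).
  by chg H (fun a => [:: r * a#0 + s * a#1; a#1 / r; a#2; a#3; a#4])
    (fun a => [:: a#0 / r - s * a#1; r * a#1; a#2; a#3; a#4]) (@id3 k) (@id3 k).
rewrite r0 in H; have [s0|s0] := eqVneq s 0; last first.
  apply: (@caseB_r1 (b2 / s) (b3 / s) (b4 / s) (- s * a2) (- s * a3) (- s * a4)).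
  by chg H (fun a => [:: s * a#1; - a#0 / s; a#2; a#3; a#4])
    (fun a => [:: - s * a#1; a#0 / s; a#2; a#3; a#4]) (@id3 k) (@id3 k).
rewrite s0 in H; apply: (@caseB_r0 a2 a3 a4 b2 b3 b4).
by chg H (@id5 k) (@id5 k) (@id3 k) (@id3 k).
Qed.

End CaseB.

(** * A decomposable form with a zero restriction *)

Section CaseC.
Variables (k : closedFieldType) (g : lieAlgType k).

Hypothesis indep : forall W, admits g 5 W -> size W = 3%N ->
  forall q0 q1 q2, (forall a b, q0 * nth (@form0 k) W 0 a b + q1 * nth (@form0 k) W 1 a b
    + q2 * nth (@form0 k) W 2 a b = 0) -> [&& q0 == 0, q1 == 0 & q2 == 0].

Lemma caseC_swap34 a2 a3 a4 b2 b3 b4 c2 c3 c4 d2 d3 d4 :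
  admits g 5 (caseC a2 a3 a4 b2 b3 b4 c2 c3 c4 d2 d3 d4) ->
  admits g 5 (caseC a2 a4 a3 b2 b4 b3 c2 c4 c3 d2 d4 d3).
Proof.
move=> H.
by chg H (fun a => [:: a#0; a#1; a#2; a#4; a#3])
  (fun a => [:: a#0; a#1; a#2; a#4; a#3]) (@id3 k) (@id3 k).
Qed.

Lemma caseC_swap24 a2 a3 a4 b2 b3 b4 c2 c3 c4 d2 d3 d4 :
  admits g 5 (caseC a2 a3 a4 b2 b3 b4 c2 c3 c4 d2 d3 d4) ->
  admits g 5 (caseC a4 a3 a2 b4 b3 b2 c4 c3 c2 d4 d3 d2).
Proof.
move=> H.
by chg H (fun a => [:: a#0; a#1; a#4; a#3; a#2])
  (fun a => [:: a#0; a#1; a#4; a#3; a#2]) (@id3 k) (@id3 k).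
Qed.

Lemma caseC_swap23 a2 a3 a4 b2 b3 b4 c2 c3 c4 d2 d3 d4 :
  admits g 5 (caseC a2 a3 a4 b2 b3 b4 c2 c3 c4 d2 d3 d4) ->
  admits g 5 (caseC a3 a2 a4 b3 b2 b4 c3 c2 c4 d3 d2 d4).
Proof.
move=> H.
by chg H (fun a => [:: a#0; a#1; a#3; a#2; a#4])
  (fun a => [:: a#0; a#1; a#3; a#2; a#4]) (@id3 k) (@id3 k).
Qed.

Lemma caseC_b3 a2 a3 a4 b2 b3 b4 : b3 != 0 ->
  admits g 5 (caseC a2 a3 a4 b2 b3 b4 1 0 0 0 0 0) -> std g 5 T53.
Proof.
move=> b30 H.
have {}H : admits g 5 (caseC 0 0 (a4 - a3 / b3 * b4) 0 1 0 1 0 0 0 0 0).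
  by chg H (fun a => [:: a#0; a#1 + a3 / b3 * a#0; a#2; b2 * a#2 + b3 * a#3 + b4 * a#4; a#4])
    (fun a => [:: a#0; a#1 - a3 / b3 * a#0; a#2; (a#3 - b2 * a#2 - b4 * a#4) / b3; a#4])
    (fun a => [:: a#0; a#1 - (a2 - a3 / b3 * b2) * a#2; a#2])
    (fun a => [:: a#0; a#1 + (a2 - a3 / b3 * b2) * a#2; a#2]).
move: (a4 - a3 / b3 * b4) H => c H; have [c0|c0] := eqVneq c 0.
  rewrite c0 in H.
  by fin [:: [:: (0,1)]; [:: (0,2)]; [:: (1,3)]]%N H (@id5 k) (@id5 k)
    (fun a => [:: a#0; a#2; a#1]) (fun a => [:: a#0; a#2; a#1]).
by fin [:: [:: (0,1)]; [:: (0,2)]; [:: (0,4); (2,3)]]%N H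
    (fun a => [:: a#0; a#2; a#1; a#3; c * a#4])
    (fun a => [:: a#0; a#2; a#1; a#3; a#4 / c])
    (fun a => [:: a#2; a#0; a#1]) (fun a => [:: a#1; a#2; a#0]).
Qed.

(* [a3 e3 + a4 e4] is made the basis vector [e3]. *)
Lemma caseC_rot a2 a3 a4 b2 : (a3 != 0) || (a4 != 0) ->
  admits g 5 (caseC a2 a3 a4 b2 0 0 1 0 0 0 0 0) ->
  admits g 5 (caseC 0 1 0 b2 0 0 1 0 0 0 0 0).
Proof.
wlog a30 : a3 a4 / a3 != 0 => [IH|_ H].
  have [a30|a30] := eqVneq a3 0; last by move=> _; apply: IH; rewrite ?a30.
  by move=> /= a40 /caseC_swap34; apply: IH; rewrite ?a40.
by chg H (fun a => [:: a#0; a#1; a#2; a3 * a#3 + a4 * a#4; a#4])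
    (fun a => [:: a#0; a#1; a#2; (a#3 - a4 * a#4) / a3; a#4])
    (fun a => [:: a#0; a#1 - a2 * a#2; a#2])
    (fun a => [:: a#0; a#1 + a2 * a#2; a#2]).
Qed.

Lemma caseC_b34 a2 a3 a4 b2 :
  admits g 5 (caseC a2 a3 a4 b2 0 0 1 0 0 0 0 0) -> std g 5 T53.
Proof.
move=> H; have [ha|] := boolP ((a3 != 0) || (a4 != 0)).
  have {}H := caseC_rot ha H; have [b20|b20] := eqVneq b2 0.
    rewrite b20 in H.
    by fin [:: [:: (0,1)]; [:: (0,2)]; [:: (0,3)]]%N H (@id5 k) (@id5 k)
      (fun a => [:: a#0; a#2; a#1]) (fun a => [:: a#0; a#2; a#1]).
  by fin [:: [:: (0,1)]; [:: (0,2)]; [:: (0,3); (1,2)]]%N H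
      (fun a => [:: a#0; b2 * a#1; a#2; a#3; a#4])
      (fun a => [:: a#0; a#1 / b2; a#2; a#3; a#4])
      (fun a => [:: b2 * a#0; a#2; a#1]) (fun a => [:: a#0 / b2; a#2; a#1]).
rewrite negb_or !negbK => /andP[/eqP a30 /eqP a40]; rewrite a30 a40 in H.
have [b20|b20] := eqVneq b2 0; last first.
  by fin [:: [:: (0,1)]; [:: (0,2)]; [:: (1,2)]]%N H
      (fun a => [:: a#0; b2 * a#1; a#2; a#3; a#4])
      (fun a => [:: a#0; a#1 / b2; a#2; a#3; a#4])
      (fun a => [:: b2 * a#0; a#2; a#1 - a2 * a#2])
      (fun a => [:: a#0 / b2; a#2 + a2 * a#1; a#1]).
rewrite b20 in H.
suff : [&& (0 : k) == 0, (1 : k) == 0 & (- a2 : k) == 0] by rewrite oner_eq0 !andbF.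
by apply: (indep H) => // a b; rewrite /= /cross; ring.
Qed.

Lemma caseC_e2 a2 a3 a4 b2 b3 b4 :
  admits g 5 (caseC a2 a3 a4 b2 b3 b4 1 0 0 0 0 0) -> std g 5 T53.
Proof.
move=> H; have [b30|b30] := eqVneq b3 0; last exact: caseC_b3 b30 H.
have [b40|b40] := eqVneq b4 0; last exact: caseC_b3 b40 (caseC_swap34 H).
by rewrite b30 b40 in H; apply: caseC_b34 H.
Qed.

Lemma caseC_decomp_c2 a2 a3 a4 b2 b3 b4 c2 c3 c4 : c2 != 0 ->
  admits g 5 (caseC a2 a3 a4 b2 b3 b4 c2 c3 c4 0 0 0) -> std g 5 T53.
Proof.
move=> c20 H.
apply: (@caseC_e2 (a2 / c2) (a3 - a2 / c2 * c3) (a4 - a2 / c2 * c4)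
  (b2 / c2) (b3 - b2 / c2 * c3) (b4 - b2 / c2 * c4)).
by chg H (fun a => [:: a#0; a#1; c2 * a#2 + c3 * a#3 + c4 * a#4; a#3; a#4])
    (fun a => [:: a#0; a#1; (a#2 - c3 * a#3 - c4 * a#4) / c2; a#3; a#4])
    (@id3 k) (@id3 k).
Qed.

Lemma caseC_decomp a2 a3 a4 b2 b3 b4 c2 c3 c4 :
  admits g 5 (caseC a2 a3 a4 b2 b3 b4 c2 c3 c4 0 0 0) -> std g 5 T53.
Proof.
move=> H; have [c20|c20] := eqVneq c2 0; last exact: caseC_decomp_c2 c20 H.
have [c30|c30] := eqVneq c3 0; last exact: caseC_decomp_c2 c30 (caseC_swap23 H).
have [c40|c40] := eqVneq c4 0; last exact: caseC_decomp_c2 c40 (caseC_swap24 H).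
rewrite c20 c30 c40 in H.
suff : [&& (0 : k) == 0, (0 : k) == 0 & (1 : k) == 0] by rewrite oner_eq0 !andbF.
by apply: (indep H) => // a b; rewrite /= /cross; ring.
Qed.

(* A combination of the last two forms whose coefficients on [e0] and [e1] are
   dependent is decomposable. *)
Lemma caseC_rank1 a2 a3 a4 b2 b3 b4 c2 c3 c4 d2 d3 d4 t0 t1 u0 u1 :
  (t0 != 0) || (t1 != 0) -> (u0 != 0) || (u1 != 0) ->
  u0 * (t0 * a2 + t1 * c2) + u1 * (t0 * b2 + t1 * d2) = 0 ->
  u0 * (t0 * a3 + t1 * c3) + u1 * (t0 * b3 + t1 * d3) = 0 ->
  u0 * (t0 * a4 + t1 * c4) + u1 * (t0 * b4 + t1 * d4) = 0 ->
  admits g 5 (caseC a2 a3 a4 b2 b3 b4 c2 c3 c4 d2 d3 d4) -> std g 5 T53.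
Proof.
wlog t10 : a2 a3 a4 b2 b3 b4 c2 c3 c4 d2 d3 d4 t0 t1 / t1 != 0 => [IH|_].
  have [t10|t10] := eqVneq t1 0; last by move=> _; apply: IH; rewrite ?t10 ?orbT.
  rewrite orbF => t00 hu h2 h3 h4 H.
  apply: (IH c2 c3 c4 d2 d3 d4 a2 a3 a4 b2 b3 b4 t1 t0) => //; rewrite ?t00 ?orbT //.
  - by rewrite -[RHS]h2; ring.
  - by rewrite -[RHS]h3; ring.
  - by rewrite -[RHS]h4; ring.
  by chg H (@id5 k) (@id5 k) (fun a => [:: a#0; a#2; a#1])
    (fun a => [:: a#0; a#2; a#1]).
move=> hu h2 h3 h4 H.
have {}H : admits g 5 (caseC a2 a3 a4 b2 b3 b4 (t0 * a2 + t1 * c2) (t0 * a3 + t1 * c3)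
    (t0 * a4 + t1 * c4) (t0 * b2 + t1 * d2) (t0 * b3 + t1 * d3) (t0 * b4 + t1 * d4)).
  by chg H (@id5 k) (@id5 k) (fun a => [:: a#0; a#1; t0 * a#1 + t1 * a#2])
    (fun a => [:: a#0; a#1; (a#2 - t0 * a#1) / t1]).
move: (t0 * a2 + t1 * c2) (t0 * a3 + t1 * c3) (t0 * a4 + t1 * c4) (t0 * b2 + t1 * d2)
  (t0 * b3 + t1 * d3) (t0 * b4 + t1 * d4) h2 h3 h4 H => {t10}.
move=> {t0 t1 c2 c3 c4 d2 d3 d4} c2 c3 c4 d2 d3 d4 h2 h3 h4 H.
have [u10|u10] := eqVneq u1 0.
  rewrite u10 eqxx orbF in hu; rewrite u10 in h2 h3 h4.
  have z c : u0 * c + 0 = 0 -> c = 0.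
    by rewrite addr0 => /eqP; rewrite mulf_eq0 (negbTE hu) => /eqP.
  rewrite !mul0r in h2 h3 h4; rewrite (z _ h2) (z _ h3) (z _ h4) in H.
  apply: (@caseC_decomp b2 b3 b4 a2 a3 a4 d2 d3 d4).
  by chg H (fun a => [:: a#1; a#0; a#2; a#3; a#4])
    (fun a => [:: a#1; a#0; a#2; a#3; a#4])
    (fun a => [:: - a#0; a#1; a#2]) (fun a => [:: - a#0; a#1; a#2]).
have z c d : u0 * c + u1 * d = 0 -> d = - u0 / u1 * c.
  by move=> e; apply: (mulfI u10); apply/eqP; rewrite -subr_eq0 -e; apply/eqP; field.
rewrite (z _ _ h2) (z _ _ h3) (z _ _ h4) in H.
apply: (@caseC_decomp a2 a3 a4 (b2 + u0 / u1 * a2) (b3 + u0 / u1 * a3) (b4 + u0 / u1 * a4) c2 c3 c4).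
by chg H (fun a => [:: a#0 - u0 / u1 * a#1; a#1; a#2; a#3; a#4])
    (fun a => [:: a#0 + u0 / u1 * a#1; a#1; a#2; a#3; a#4]) (@id3 k) (@id3 k).
Qed.

End CaseC.

Lemma lin_dep (k : fieldType) m n (M : nat -> nat -> k) : (m < n)%N ->
  exists v i0, [/\ (i0 < n)%N, v i0 != 0 &
    forall j, (j < m)%N -> \sum_(i < n) v i * M i j = 0].
Proof.
move=> lt; pose A := \matrix_(i < n, j < m) M i j.
have : kermx A != 0.
  by rewrite -mxrank_eq0 mxrank_ker -lt0n subn_gt0 (leq_ltn_trans (rank_leq_col A)).
move=> /rowV0Pn [v /sub_kermxP vA /rV0Pn [i vi]].
exists (fun i => if insub i is Some i' then v 0 i' else 0), i; split=> //; first by rewrite valK.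
move=> j hj; have := congr1 (fun B : 'rV_m => B 0 (Ordinal hj)) vA.
rewrite !mxE => e; rewrite -[RHS]e; apply: eq_bigr => l _.
by rewrite valK mxE.
Qed.

Lemma det3 (k : fieldType) (M : nat -> nat -> k) :
  \det (\matrix_(i < 3, j < 3) M i j) =
  M#0#0 * (M#1#1 * M#2#2 - M#1#2 * M#2#1) - M#0#1 * (M#1#0 * M#2#2 - M#1#2 * M#2#0)
  + M#0#2 * (M#1#0 * M#2#1 - M#1#1 * M#2#0).
Proof.
rewrite (expand_det_row _ ord0) !big_ord_recl big_ord0 /cofactor.
rewrite !(expand_det_row _ (ord0 : 'I_2)) !big_ord_recl !big_ord0 /cofactor !det_mx11 !mxE /=.
rewrite /bump /=; ring.
Qed.

Lemma rank1_mx (k : fieldType) (v0 v1 v2 v3 : k) : v0 * v3 = v1 * v2 ->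
  exists t0 t1 u0 u1, [/\ v0 = t0 * u0, v1 = t0 * u1, v2 = t1 * u0 & v3 = t1 * u1].
Proof.
move=> h; have [v00|v00] := eqVneq v0 0; last first.
  by exists v0, v2, 1, (v1 / v0); split; rewrite ?mulr1 //; [field|apply: (mulfI v00); rewrite h; field].
have [v10|v10] := eqVneq v1 0; first by exists 0, 1, v2, v3; rewrite !mul0r !mul1r.
exists v1, v3, 0, 1; rewrite !mulr0 !mulr1; split=> //.
by apply: (mulfI v10); rewrite -h v00 mul0r mulr0.
Qed.

(** * All spaces of dimension 3 containing a decomposable form *)

Section Rank2.
Variables (k : closedFieldType) (g : lieAlgType k).
Hypotheses (two_neq0 : (2 : k) != 0) (dg : \dim {:g} = 8%N) (ts : two_step_nilpotent g).
Hypothesis dD : \dim (derived_algebra g) = 3%N.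

Lemma indep53 W : admits g 5 W -> size W = 3%N ->
  forall q0 q1 q2, (forall a b, q0 * nth (@form0 k) W 0 a b + q1 * nth (@form0 k) W 1 a b
    + q2 * nth (@form0 k) W 2 a b = 0) -> [&& q0 == 0, q1 == 0 & q2 == 0].
Proof.
move=> H sz q0 q1 q2 hq.
have h := admits_indep dg dD (erefl : (5 + 3 = 8)%N) (q := nth 0 [:: q0; q1; q2]) H sz.
have {}h c : (c < 3)%N -> nth 0 [:: q0; q1; q2] c = 0.
  by apply: h => a b; rewrite !big_ord_recr big_ord0 /= add0r hq.
by have /= -> := h 0%N isT; have /= -> := h 1%N isT; have /= -> := h 2%N isT; rewrite eqxx.
Qed.

(** The [v i] are a relation between the four covectors that accompany [e_0] and [e_1] in the two
    forms. If they form a matrix of rank 1, the product of [t] and [u], then the combination [t] of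
    the two forms has dependent covectors. *)
Lemma caseC_rel a2 a3 a4 b2 b3 b4 c2 c3 c4 d2 d3 d4 v0 v1 v2 v3 :
  ~~ [&& v0 == 0, v1 == 0, v2 == 0 & v3 == 0] -> v0 * v3 = v1 * v2 ->
  v0 * a2 + v1 * b2 + v2 * c2 + v3 * d2 = 0 ->
  v0 * a3 + v1 * b3 + v2 * c3 + v3 * d3 = 0 ->
  v0 * a4 + v1 * b4 + v2 * c4 + v3 * d4 = 0 ->
  admits g 5 (caseC a2 a3 a4 b2 b3 b4 c2 c3 c4 d2 d3 d4) -> std g 5 T53.
Proof.
move=> hv /rank1_mx [t0 [t1 [u0 [u1 [e0 e1 e2 e3]]]]] h2 h3 h4; subst v0 v1 v2 v3.
apply: (caseC_rank1 indep53 (t0 := t0) (t1 := t1) (u0 := u0) (u1 := u1)).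
- by rewrite -negb_and; apply: contra hv => /andP[/eqP-> /eqP->]; rewrite !mul0r eqxx.
- by rewrite -negb_and; apply: contra hv => /andP[/eqP-> /eqP->]; rewrite !mulr0 eqxx.
- by rewrite -[RHS]h2; ring.
- by rewrite -[RHS]h3; ring.
- by rewrite -[RHS]h4; ring.
Qed.

Lemma det3_eq0 (A : nat -> nat -> k) :
  A#0#0 * (A#1#1 * A#2#2 - A#1#2 * A#2#1) - A#0#1 * (A#1#0 * A#2#2 - A#1#2 * A#2#0)
  + A#0#2 * (A#1#0 * A#2#1 - A#1#1 * A#2#0) = 0 -> exists p q r,
  ~~ [&& p == 0, q == 0 & r == 0] /\ forall j, (j < 3)%N -> p * A 0 j + q * A 1 j + r * A 2 j = 0.
Proof.
rewrite -det3 => /eqP /det0P [v v0 vM].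
exists (v 0 0), (v 0 1), (v 0 (1 + 1)); split.
  apply: contra v0 => /and3P[/eqP h0 /eqP h1 /eqP h2]; apply/eqP/rowP => i; rewrite mxE.
  case: i => -[|[|[|//]]] hi; [rewrite -[RHS]h0|rewrite -[RHS]h1|rewrite -[RHS]h2];
  by congr (v _ _); apply: val_inj.
move=> j hj; have := congr1 (fun B : 'rV_3 => B 0 (Ordinal hj)) vM.
rewrite !mxE !big_ord_recl big_ord0 !mxE addr0 addrA => <-.
by do 2?congr (_ + _); congr (v _ _ * _); apply: val_inj.
Qed.

Lemma caseC_sym a2 a3 a4 b2 b3 b4 c2 c3 c4 :
  admits g 5 (caseC a2 a3 a4 b2 b3 b4 b2 b3 b4 c2 c3 c4) -> std g 5 T53.
Proof.
move=> H; pose M i j := nth 0 (nth [::] [:: [:: a2; a3; a4]; [:: b2; b3; b4]; [:: c2; c3; c4]] i) j.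
pose D := a2 * (b3 * c4 - b4 * c3) - a3 * (b2 * c4 - b4 * c2) + a4 * (b2 * c3 - b3 * c2).
have [D0|D0] := eqVneq D 0.
  have [p [q [r [hn hr]]]] := @det3_eq0 M D0.
  (* The coefficient [q] of the covector that occurs twice is split as [x + (q - x)] with
     [x (q - x) = p r], which makes the relation one of rank 1. *)
  have [|x hx] := @quad_root k (-1) q (- (p * r)); first by rewrite oppr_eq0 oner_eq0.
  apply: (caseC_rel (v0 := p) (v1 := x) (v2 := q - x) (v3 := r)) H.
  - apply: contra hn => /and4P[/eqP p0 /eqP x0 /eqP qx /eqP r0].
    by rewrite -[q](subrK x) qx x0 p0 r0 addr0 !eqxx.
  - by apply/eqP; rewrite -subr_eq0 -oppr_eq0 -hx; apply/eqP; ring.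
  - by rewrite -(hr 0%N isT) /M /=; ring.
  - by rewrite -(hr 1%N isT) /M /=; ring.
  - by rewrite -(hr 2%N isT) /M /=; ring.
fin [:: [:: (0,1)]; [:: (0,2); (1,3)]; [:: (0,3); (1,4)]]%N H
  (fun a => [:: a#0; a#1; a2 * a#2 + a3 * a#3 + a4 * a#4;
    b2 * a#2 + b3 * a#3 + b4 * a#4; c2 * a#2 + c3 * a#3 + c4 * a#4])
  (fun a => [:: a#0; a#1;
    ((b3 * c4 - b4 * c3) * a#2 - (a3 * c4 - a4 * c3) * a#3 + (a3 * b4 - a4 * b3) * a#4) / D;
    (- (b2 * c4 - b4 * c2) * a#2 + (a2 * c4 - a4 * c2) * a#3 - (a2 * b4 - a4 * b2) * a#4) / D;
    ((b2 * c3 - b3 * c2) * a#2 - (a2 * c3 - a3 * c2) * a#3 + (a2 * b3 - a3 * b2) * a#4) / D])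
  (@id3 k) (@id3 k);
  rewrite /D; fld.
Qed.

(** Four covectors in a space of dimension 3 satisfy a relation. Of rank 1, it is covered by
    [caseC_rel]; of rank 2, it is a change of basis of the two forms after which the covector of
    [e_1] in one equals that of [e_0] in the other. *)
Lemma caseC_std a2 a3 a4 b2 b3 b4 c2 c3 c4 d2 d3 d4 :
  admits g 5 (caseC a2 a3 a4 b2 b3 b4 c2 c3 c4 d2 d3 d4) -> std g 5 T53.
Proof.
move=> H; pose M i j := nth 0 (nth [::] [:: [:: a2; a3; a4]; [:: b2; b3; b4];
  [:: c2; c3; c4]; [:: d2; d3; d4]] i) j.
have [v [i [hi vi hv]]] := lin_dep M (isT : (3 < 4)%N).
have {}hv j : (j < 3)%N -> v#0 * M#0 j + v#1 * M#1 j + v#2 * M#2 j + v#3 * M#3 j = 0.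
  by move=> hj; rewrite -(hv j hj) !big_ord_recr big_ord0 /= add0r.
have v0 : ~~ [&& v#0 == 0, v#1 == 0, v#2 == 0 & v#3 == 0].
  by apply: contra vi => /and4P[h0 h1 h2 h3]; case: i hi => [|[|[|[|]]]].
have h2 := hv 0%N isT; have h3 := hv 1%N isT; have h4 := hv 2%N isT.
rewrite /M /= in h2 h3 h4 => {M hv vi hi i}.
have [e|e] := eqVneq (v#0 * v#3) (v#1 * v#2); first exact: caseC_rel v0 e h2 h3 h4 H.
move: (v#0) (v#1) (v#2) (v#3) v0 h2 h3 h4 e => {v} v0 v1 v2 v3 hv h2 h3 h4 hdet.
have hd : v0 * v3 - v1 * v2 != 0 by rewrite subr_eq0.
have {}H : admits g 5 (caseC (v1 * a2 + v3 * c2) (v1 * a3 + v3 * c3) (v1 * a4 + v3 * c4)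
    (v1 * b2 + v3 * d2) (v1 * b3 + v3 * d3) (v1 * b4 + v3 * d4)
    (- (v0 * a2 + v2 * c2)) (- (v0 * a3 + v2 * c3)) (- (v0 * a4 + v2 * c4))
    (- (v0 * b2 + v2 * d2)) (- (v0 * b3 + v2 * d3)) (- (v0 * b4 + v2 * d4))).
  by chg H (@id5 k) (@id5 k) (fun a => [:: a#0; v1 * a#1 + v3 * a#2; - v0 * a#1 - v2 * a#2])
    (fun a => [:: a#0; (- v2 * a#1 - v3 * a#2) / (v0 * v3 - v1 * v2);
      (v0 * a#1 + v1 * a#2) / (v0 * v3 - v1 * v2)]).
have sol a b c d : v0 * a + v1 * b + v2 * c + v3 * d = 0 -> - (v0 * a + v2 * c) = v1 * b + v3 * d.
  by move=> h; apply/eqP; rewrite -subr_eq0 -oppr_eq0 -h; apply/eqP; ring.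
rewrite (sol _ _ _ _ h2) (sol _ _ _ _ h3) (sol _ _ _ _ h4) in H.
exact: caseC_sym H.
Qed.

(** Forgets the expression of the third form after a substitution and renames its coefficients. *)
Lemma admits_regen2 (f0 f1 f2 : form k) : admits g 5 [:: f0; f1; f2] ->
  exists q, admits g 5 [:: f0; f1; gen 5 q].
Proof.
move=> [x [z [cxz Hz]]]; have [p Hp] := coframe_gen dg ts dD (erefl : (5 + 3 = 8)%N) cxz.
exists (p 2), x, z; split=> // -[|[|[|c]]] u v; rewrite ?Hz //=.
by rewrite -Hp Hz.
Qed.

Definition caseA1 (r s q2 q3 q4 q12 q13 q14 q24 q34 : k) : seq (form k) := [:: E 0 1;
  fun a b => E 2 3 a b + r * E 0 4 a b + s * E 1 4 a b;
  fun a b => cross q2 q3 q4 q12 q13 q14 a b + q24 * E 2 4 a b + q34 * E 3 4 a b].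

Lemma caseA1_q24 r s q2 q3 q4 q12 q13 q14 q24 q34 : q24 != 0 ->
  admits g 5 (caseA1 r s q2 q3 q4 q12 q13 q14 q24 q34) -> std g 5 T53.
Proof.
move=> h H; pose c := q34 / q24.
have {}H : admits g 5 (caseA1 (r / q24) (s / q24) q2 (q3 - c * q2) (q4 / q24)
    q12 (q13 - c * q12) (q14 / q24) 1 0).
  by rewrite /c; chg H (fun a => [:: a#0; a#1; a#2 + q34 / q24 * a#3; a#3; q24 * a#4])
    (fun a => [:: a#0; a#1; a#2 - q34 / q24 * a#3; a#3; a#4 / q24]) (@id3 k) (@id3 k).
move: (r / q24) (s / q24) (q3 - _) (q4 / _) (q13 - _) (q14 / _) H => {}r {}s {}q3 {}q4 {}q13 {}q14 H.
(* Adding [q4 / 2] times [e_0] and [q14 / 2] times [e_1] to [e_2] makes both matrices traceless. *)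
apply: (@sl2_std k g two_neq0 (- q4 / 2) r q3 (- q14 / 2) s q13).
by chg H (fun a => [:: a#0; a#1; a#2 + q4 / 2 * a#0 + q14 / 2 * a#1; a#3;
      a#4 - q2 * a#0 - q12 * a#1])
    (fun a => [:: a#0; a#1; a#2 - q4 / 2 * a#0 - q14 / 2 * a#1; a#3;
      a#4 + q2 * a#0 + q12 * a#1])
    (fun a => [:: a#0; a#1 + (s * q2 - r * q12) * a#0;
       a#2 + (q14 * q2 - q4 * q12) * a#0])
    (fun a => [:: a#0; a#1 - (s * q2 - r * q12) * a#0;
       a#2 - (q14 * q2 - q4 * q12) * a#0]).
Qed.

Lemma caseA1_std r s q2 q3 q4 q12 q13 q14 q24 q34 :
  admits g 5 (caseA1 r s q2 q3 q4 q12 q13 q14 q24 q34) -> std g 5 T53.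
Proof.
have [h|h] := eqVneq q24 0; last exact: caseA1_q24.
have [h' H|h' H] := eqVneq q34 0.
  rewrite h h' in H; apply: (@caseB_std k g indep53 r s q2 q3 q4 q12 q13 q14).
  by chg H (@id5 k) (@id5 k) (@id3 k) (@id3 k).
rewrite h in H; apply: (@caseA1_q24 r s q3 (- q2) q4 q13 (- q12) q14 q34 0) => //.
by chg H (fun a => [:: a#0; a#1; a#3; - a#2; a#4])
  (fun a => [:: a#0; a#1; - a#3; a#2; a#4]) (@id3 k) (@id3 k).
Qed.

Lemma rank2_p23 (p q : nat -> nat -> k) : p#2#3 != 0 -> admits g 5 [:: E 0 1; gen 5 p; gen 5 q] -> std g 5 T53.
Proof.
move=> h H.
(* What remains of [p] modulo [e_0 ^ e_1] once a product is split off with pivot [p_23]: the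
   Pfaffians on the indices 0234 and 1234, divided by the pivot. *)
pose r04 := (p#0#2 * p#3#4 - p#0#3 * p#2#4 + p#0#4 * p#2#3) / p#2#3.
pose r14 := (p#1#2 * p#3#4 - p#1#3 * p#2#4 + p#1#4 * p#2#3) / p#2#3.
pose s' := fun a : nat -> k => [:: a#0; a#1;
  a#2 - p#0#3 / p#2#3 * a#0 - p#1#3 / p#2#3 * a#1 + p#3#4 / p#2#3 * a#4;
  (a#3 - p#2#4 * a#4 + p#0#2 * a#0 + p#1#2 * a#1) / p#2#3; a#4].
have {}H : admits g 5 [:: E 0 1; fun a b => E 2 3 a b + r04 * E 0 4 a b + r14 * E 1 4 a b;
    fun a b => gen 5 q (nth 0 (s' a)) (nth 0 (s' b))].
  by rewrite /r04 /r14 /s'; chg H (fun a => [:: a#0; a#1;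
    a#2 + p#0#3 / p#2#3 * a#0 + p#1#3 / p#2#3 * a#1 - p#3#4 / p#2#3 * a#4;
    p#2#3 * a#3 + p#2#4 * a#4 - p#0#2 * a#0 - p#1#2 * a#1; a#4]) s'
   (fun a => [:: a#0; a#1 - (p#0#1 * p#2#3 - p#0#2 * p#1#3 + p#0#3 * p#1#2) / p#2#3 * a#0; a#2])
   (fun a => [:: a#0; a#1 + (p#0#1 * p#2#3 - p#0#2 * p#1#3 + p#0#3 * p#1#2) / p#2#3 * a#0; a#2]).
have {q}[q {}H] := admits_regen2 H.
apply: (@caseA1_std r04 r14 (q#0#2) (q#0#3) (q#0#4 - q#2#3 * r04) (q#1#2) (q#1#3)
  (q#1#4 - q#2#3 * r14) (q#2#4) (q#3#4)).
by chg H (@id5 k) (@id5 k) (fun a => [:: a#0; a#1; a#2 - q#2#3 * a#1 - q#0#1 * a#0])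
  (fun a => [:: a#0; a#1; a#2 + q#2#3 * a#1 + q#0#1 * a#0]).
Qed.

(* The coefficients of a form after a permutation of the basis. *)
Definition skew (p : nat -> nat -> k) (s : nat -> nat) i j :=
  if (s i < s j)%N then p (s i) (s j) else - p (s j) (s i).

Lemma rank2_p (p q : nat -> nat -> k) : (p#2#3 != 0) || ((p#2#4 != 0) || (p#3#4 != 0)) ->
  admits g 5 [:: E 0 1; gen 5 p; gen 5 q] -> std g 5 T53.
Proof.
have [h|h] := eqVneq (p#2#3) 0; last by move=> _; apply: rank2_p23.
have [h'|h'] := eqVneq (p#2#4) 0 => /= [h'' H|_ H].
  apply: (@rank2_p23 (skew p (swap 2 4)) (skew q (swap 2 4))); first by rewrite /skew /= oppr_eq0.
  by chg H (fun a => [:: a#0; a#1; a#4; a#3; a#2])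
    (fun a => [:: a#0; a#1; a#4; a#3; a#2]) (@id3 k) (@id3 k);
    rewrite /skew /swap /=; ring.
apply: (@rank2_p23 (skew p (swap 3 4)) (skew q (swap 3 4))); first by [].
by chg H (fun a => [:: a#0; a#1; a#2; a#4; a#3])
    (fun a => [:: a#0; a#1; a#2; a#4; a#3]) (@id3 k) (@id3 k);
    rewrite /skew /swap /=; ring.
Qed.

Lemma rank2_std (p q : nat -> nat -> k) : admits g 5 [:: E 0 1; gen 5 p; gen 5 q] -> std g 5 T53.
Proof.
have [hp|] := boolP ((p#2#3 != 0) || ((p#2#4 != 0) || (p#3#4 != 0))); first exact: rank2_p.
have [hq _ H|] := boolP ((q#2#3 != 0) || ((q#2#4 != 0) || (q#3#4 != 0))).
  apply: (rank2_p (q := p) hq).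
  by chg H (@id5 k) (@id5 k) (fun a => [:: a#0; a#2; a#1])
    (fun a => [:: a#0; a#2; a#1]).
rewrite !negb_or !negbK => /and3P[/eqP q23 /eqP q24 /eqP q34] /and3P[/eqP p23 /eqP p24 /eqP p34] H.
apply: (@caseC_std (p#0#2) (p#0#3) (p#0#4) (p#1#2) (p#1#3) (p#1#4)
  (q#0#2) (q#0#3) (q#0#4) (q#1#2) (q#1#3) (q#1#4)).
by chg H (@id5 k) (@id5 k) (fun a => [:: a#0; a#1 - p#0#1 * a#0; a#2 - q#0#1 * a#0])
  (fun a => [:: a#0; a#1 + p#0#1 * a#0; a#2 + q#0#1 * a#0]);
  rewrite ?p23 ?p24 ?p34 ?q23 ?q24 ?q34; ring.
Qed.

End Rank2.

(* Twice the Pfaffian of the 4x4 minor, polarized. *)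
Definition pf (k : fieldType) (p q : nat -> nat -> k) i j l m : k :=
  p i j * q l m + p l m * q i j - (p i l * q j m + p j m * q i l)
  + (p i m * q j l + p j l * q i m).

Lemma wedge_gen5 (k : fieldType) (p q : nat -> nat -> k) a b c d :
  wedge (gen 5 p) (gen 5 q) a b c d =
  pf p q 0 1 2 3 * wedge (E 0 1) (E 2 3) a b c d +
  pf p q 0 1 2 4 * wedge (E 0 1) (E 2 4) a b c d +
  pf p q 0 1 3 4 * wedge (E 0 1) (E 3 4) a b c d +
  pf p q 0 2 3 4 * wedge (E 0 2) (E 3 4) a b c d +
  pf p q 1 2 3 4 * wedge (E 1 2) (E 3 4) a b c d.
Proof. rewrite /wedge !gen5E /pf /E. ring. Qed.

(* The 4-form [p ^ q] on k^5, seen as a vector. *)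
Definition hodge (k : fieldType) (p q : nat -> nat -> k) : nat -> k :=
  nth 0 [:: pf p q 1 2 3 4; - pf p q 0 2 3 4; pf p q 0 1 3 4; - pf p q 0 1 2 4; pf p q 0 1 2 3].

(** If [p] has rank 4, the vector dual to [p ^ p] spans its radical. The next two identities are
    polarizations of this one, which is cubic in [p]. *)
Lemma hodge1 (k : fieldType) (p : nat -> nat -> k) b : gen 5 p (hodge p p) b = 0.
Proof. rewrite gen5E /hodge /pf /E /=. ring. Qed.

Lemma hodge2 (k : fieldType) (p q : nat -> nat -> k) b :
  gen 5 p (hodge q q) b = - (2 * gen 5 q (hodge p q) b).
Proof. rewrite !gen5E /hodge /pf /E /=. ring. Qed.

Lemma hodge3 (k : fieldType) (p q r : nat -> nat -> k) b :
  gen 5 p (hodge q r) b + gen 5 q (hodge p r) b + gen 5 r (hodge p q) b = 0.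
Proof. rewrite !gen5E /hodge /pf /E /=. ring. Qed.

(** * Ternary quadratic forms over an algebraically closed field *)

Section QuadraticForms.
Variable k : closedFieldType.
Hypothesis two_neq0 : (2 : k) != 0.

(* A quadratic form in three variables is given by its coefficients
   [s_i] on squares and [m_i] on the product of the two other variables. *)
Definition is_prod (s0 s1 s2 m0 m1 m2 : k) (q q' : nat -> k) :=
  [/\ s0 = q#0 * q'#0, s1 = q#1 * q'#1 & s2 = q#2 * q'#2] /\
  [/\ m0 = q#1 * q'#2 + q#2 * q'#1, m1 = q#0 * q'#2 + q#2 * q'#0 & m2 = q#0 * q'#1 + q#1 * q'#0].

Definition nz3 (q : nat -> k) := ~~ [&& q#0 == 0, q#1 == 0 & q#2 == 0].

(** Four times the determinant of the symmetric matrix of the quadratic form. *)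
Definition disc3 (s0 s1 s2 m0 m1 m2 : k) : k :=
  4 * s0 * s1 * s2 + m0 * m1 * m2 - s0 * m0 ^+ 2 - s1 * m1 ^+ 2 - s2 * m2 ^+ 2.

Lemma sqrt_exists (a : k) : exists x, x ^+ 2 = a.
Proof.
have [x] := @quad_root k 1 0 (- a) (oner_neq0 _).
by rewrite mul1r mul0r addr0 => /eqP; rewrite subr_eq0 => /eqP; exists x.
Qed.

(** As a polynomial in the first variable, the form has for discriminant the binary form with
    coefficients [A, B, C]. This is a square because [disc3] vanishes, and the quadratic formula
    yields the two linear factors. *)
Lemma split_s0 s0 s1 s2 m0 m1 m2 : s0 != 0 -> disc3 s0 s1 s2 m0 m1 m2 = 0 ->
  exists q q', [/\ nz3 q, nz3 q' & is_prod s0 s1 s2 m0 m1 m2 q q'].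
Proof.
move=> h hd.
pose A := m2 ^+ 2 - 4 * s0 * s1; pose B := 2 * m1 * m2 - 4 * s0 * m0.
pose C := m1 ^+ 2 - 4 * s0 * s2.
have hAB : B ^+ 2 = 4 * A * C.
  apply/eqP; rewrite -subr_eq0; have -> : B ^+ 2 - 4 * A * C = - 16 * s0 * disc3 s0 s1 s2 m0 m1 m2.
    by rewrite /A /B /C /disc3; ring.
  by rewrite hd mulr0.
have [a [b [ha hb hab]]] : exists a b, [/\ a ^+ 2 = A, b ^+ 2 = C & 2 * a * b = B].
  have [a ha] := sqrt_exists A; have [a0|a0] := eqVneq a 0.
    have [b hb] := sqrt_exists C; exists a, b; split=> //; rewrite a0 mulr0 mul0r.
    by apply/esym/eqP; rewrite -sqrf_eq0 hAB -ha a0 expr0n /= mulr0 mul0r.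
  exists a, (B / (2 * a)); split=> //; last by field; rewrite a0 two_neq0.
  by rewrite expr_div_n hAB -ha; field; rewrite a0 two_neq0.
have f0 : (4 : k) != 0 by rewrite (_ : 4 = 2 * 2) ?mulf_neq0 //; ring.
have e1 : s1 = (m2 ^+ 2 - a ^+ 2) / (4 * s0) by rewrite ha /A; field; rewrite h f0.
have e2 : s2 = (m1 ^+ 2 - b ^+ 2) / (4 * s0) by rewrite hb /C; field; rewrite h f0.
have e0 : m0 = (2 * m1 * m2 - 2 * a * b) / (4 * s0) by rewrite hab /B; field; rewrite h f0.
exists (nth 0 [:: s0; (m2 + a) / 2; (m1 + b) / 2]),
  (nth 0 [:: 1; (m2 - a) / (2 * s0); (m1 - b) / (2 * s0)]).
rewrite /nz3 /is_prod /= (negbTE h) oner_eq0; do !split=> //.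
- by rewrite mulr1.
- by rewrite e1; field; rewrite h two_neq0.
- by rewrite e2; field; rewrite h two_neq0.
- by rewrite e0; field; rewrite h two_neq0.
- by field; rewrite h two_neq0.
- by field; rewrite h two_neq0.
Qed.

Lemma split_deg s0 s1 s2 m0 m1 m2 :
  ~~ [&& s0 == 0, s1 == 0, s2 == 0, m0 == 0, m1 == 0 & m2 == 0] ->
  disc3 s0 s1 s2 m0 m1 m2 = 0 ->
  exists q q', [/\ nz3 q, nz3 q' & is_prod s0 s1 s2 m0 m1 m2 q q'].
Proof.
move=> hn hd; have [h0|h0] := eqVneq s0 0; last exact: split_s0.
have [h1|h1] := eqVneq s1 0; last first.
  have [|q [q' [hq hq' [[e0 e1 e2] [f0 f1 f2]]]]] := @split_s0 s1 s0 s2 m1 m0 m2 h1.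
    by rewrite -hd /disc3; ring.
  exists (nth 0 [:: q#1; q#0; q#2]), (nth 0 [:: q'#1; q'#0; q'#2]); split.
  - by apply: contra hq => /and3P[-> -> ->].
  - by apply: contra hq' => /and3P[-> -> ->].
  - by do !split => //=; rewrite ?f0 ?f1 ?f2 // addrC.
have [h2|h2] := eqVneq s2 0; last first.
  have [|q [q' [hq hq' [[e0 e1 e2] [f0 f1 f2]]]]] := @split_s0 s2 s1 s0 m2 m1 m0 h2.
    by rewrite -hd /disc3; ring.
  exists (nth 0 [:: q#2; q#1; q#0]), (nth 0 [:: q'#2; q'#1; q'#0]).
  split.
  - by apply: contra hq => /and3P[-> -> ->].
  - by apply: contra hq' => /and3P[-> -> ->].
  - by do !split => //=; rewrite ?f0 ?f1 ?f2 // addrC.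
rewrite h0 h1 h2 !eqxx /= in hn.
have : m0 * m1 * m2 = 0 by rewrite -hd h0 h1 h2 /disc3; ring.
(* Without square terms, a zero among the mixed coefficients leaves a variable that divides the
   form. *)
move/eqP; rewrite !mulf_eq0 -orbA => /or3P[]/eqP e; rewrite e eqxx ?andbT /= in hn *.
- exists (nth 0 [:: 1; 0; 0]), (nth 0 [:: 0; m2; m1]); rewrite /nz3 /= oner_eq0 eqxx /= andbC hn.
  by do !split => //=; rewrite ?h0 ?h1 ?h2; ring.
- exists (nth 0 [:: 0; 1; 0]), (nth 0 [:: m2; 0; m0]); rewrite /nz3 /= oner_eq0 eqxx /= andbC hn.
  by do !split => //=; rewrite ?h0 ?h1 ?h2; ring.
- exists (nth 0 [:: 0; 0; 1]), (nth 0 [:: m1; m0; 0]); rewrite /nz3 /= oner_eq0 eqxx /= andbT andbC hn.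
  by do !split => //=; rewrite ?h0 ?h1 ?h2; ring.
Qed.

(* The quadratic form is [c y0^2 + y1 y2]. *)
Definition is_conic (s0 s1 s2 m0 m1 m2 c : k) (y0 y1 y2 : nat -> k) :=
  [/\ s0 = c * y0#0 ^+ 2 + y1#0 * y2#0, s1 = c * y0#1 ^+ 2 + y1#1 * y2#1
    & s2 = c * y0#2 ^+ 2 + y1#2 * y2#2] /\
  [/\ m0 = 2 * c * y0#1 * y0#2 + (y1#1 * y2#2 + y1#2 * y2#1),
      m1 = 2 * c * y0#0 * y0#2 + (y1#0 * y2#2 + y1#2 * y2#0)
    & m2 = 2 * c * y0#0 * y0#1 + (y1#0 * y2#1 + y1#1 * y2#0)].

Definition vdet (y0 y1 y2 : nat -> k) : k :=
  y0#0 * (y1#1 * y2#2 - y1#2 * y2#1) - y0#1 * (y1#0 * y2#2 - y1#2 * y2#0)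
  + y0#2 * (y1#0 * y2#1 - y1#1 * y2#0).

(** Completing the square in the first variable leaves a binary form of nonzero discriminant, which
    splits into two linear factors. *)
Lemma conic_s0 s0 s1 s2 m0 m1 m2 : s0 != 0 -> disc3 s0 s1 s2 m0 m1 m2 != 0 ->
  exists c y0 y1 y2, [/\ c != 0, vdet y0 y1 y2 != 0 & is_conic s0 s1 s2 m0 m1 m2 c y0 y1 y2].
Proof.
move=> h hd.
pose A := m2 ^+ 2 - 4 * s0 * s1; pose B := 2 * m1 * m2 - 4 * s0 * m0.
pose C := m1 ^+ 2 - 4 * s0 * s2.
have f0 : (4 : k) != 0 by rewrite (_ : 4 = 2 * 2) ?mulf_neq0 //; ring.
have hAB : B ^+ 2 - 4 * A * C != 0.
  have -> : B ^+ 2 - 4 * A * C = - ((4 * 4) * s0 * disc3 s0 s1 s2 m0 m1 m2).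
    by rewrite /A /B /C /disc3; ring.
  by rewrite oppr_eq0 !mulf_neq0.
have e1 : s1 = (m2 ^+ 2 - A) / (4 * s0) by rewrite /A; field; rewrite h f0.
have e2 : s2 = (m1 ^+ 2 - C) / (4 * s0) by rewrite /C; field; rewrite h f0.
have e0 : m0 = (2 * m1 * m2 - B) / (4 * s0) by rewrite /B; field; rewrite h f0.
exists s0, (nth 0 [:: 1; m2 / (2 * s0); m1 / (2 * s0)]).
move: A B C hAB e1 e2 e0 => A B C hAB -> -> ->.
have [A0|A0] := eqVneq A 0.
  exists (nth 0 [:: 0; 0; - 1 / (4 * s0)]), (nth 0 [:: 0; B; C]).
  rewrite A0 in hAB *; have B0 : B != 0 by apply: contraNneq hAB => ->; apply/eqP; ring.
  rewrite /vdet /is_conic /=; split=> //.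
    have -> : 1 * (0 * C - -1 / (4 * s0) * B) - m2 / (2 * s0) * (0 * C - -1 / (4 * s0) * 0) +
        m1 / (2 * s0) * (0 * B - 0 * 0) = B / (4 * s0) by field; rewrite h f0 two_neq0.
    by rewrite mulf_neq0 ?invr_neq0 ?mulf_neq0.
  by do !split=> //; field; rewrite ?h ?f0 ?two_neq0.
have [r hr] := quad_root B C A0.
have eC : C = - (A * r ^+ 2 + B * r) by apply/eqP; rewrite -addr_eq0 -hr; apply/eqP; ring.
exists (nth 0 [:: 0; - A / (4 * s0); r * A / (4 * s0)]), (nth 0 [:: 0; 1; B / A + r]).
rewrite eC in hAB *; have hr2 : 2 * A * r + B != 0.
  apply: contraNneq hAB => e; have -> : B = - (2 * A * r) by apply/eqP; rewrite -addr_eq0 addrC e.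
  by apply/eqP; ring.
rewrite /vdet /is_conic /=; split=> //.
  set D := (X in X != 0); have -> : D = - (2 * A * r + B) / (4 * s0).
    by rewrite /D; field; rewrite h f0 two_neq0 A0.
  by rewrite mulf_neq0 ?invr_neq0 ?mulf_neq0 // oppr_eq0.
by do !split=> //; field; rewrite ?h ?f0 ?two_neq0 ?A0.
Qed.

Lemma conic_nd s0 s1 s2 m0 m1 m2 : disc3 s0 s1 s2 m0 m1 m2 != 0 ->
  exists c y0 y1 y2, [/\ c != 0, vdet y0 y1 y2 != 0 & is_conic s0 s1 s2 m0 m1 m2 c y0 y1 y2].
Proof.
move=> hd; have [h0|h0] := eqVneq s0 0; last exact: conic_s0.
have [h1|h1] := eqVneq s1 0; last first.
  have [|c [y0 [y1 [y2 [hc hy [[e0 e1 e2] [f0 f1 f2]]]]]]] := @conic_s0 s1 s0 s2 m1 m0 m2 h1.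
    by apply: contraNneq hd => e; rewrite -e /disc3; apply/eqP; ring.
  exists c, (nth 0 [:: y0#1; y0#0; y0#2]), (nth 0 [:: y1#1; y1#0; y1#2]), (nth 0 [:: y2#1; y2#0; y2#2]).
  split=> //; first by apply: contraNneq hy; rewrite /vdet /= -oppr_eq0 => <-; apply/eqP; ring.
  by do !split=> //=; rewrite ?e0 ?e1 ?e2 ?f0 ?f1 ?f2; ring.
have [h2|h2] := eqVneq s2 0; last first.
  have [|c [y0 [y1 [y2 [hc hy [[e0 e1 e2] [f0 f1 f2]]]]]]] := @conic_s0 s2 s1 s0 m2 m1 m0 h2.
    by apply: contraNneq hd => e; rewrite -e /disc3; apply/eqP; ring.
  exists c, (nth 0 [:: y0#2; y0#1; y0#0]), (nth 0 [:: y1#2; y1#1; y1#0]), (nth 0 [:: y2#2; y2#1; y2#0]).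
  split=> //; first by apply: contraNneq hy; rewrite /vdet /= -oppr_eq0 => <-; apply/eqP; ring.
  by do !split=> //=; rewrite ?e0 ?e1 ?e2 ?f0 ?f1 ?f2; ring.
have hm : m0 * m1 * m2 != 0.
  by apply: contraNneq hd => e; rewrite /disc3 h0 h1 h2 e; apply/eqP; ring.
have [[m00 m10] m20] : (m0 != 0) * (m1 != 0) * (m2 != 0).
  by move: hm; rewrite !mulf_eq0 !negb_or -andbA => /and3P[].
(* In variables [t0, t1, t2], the product [(m2 t0 + m0 t2)(t1 + (m1 / m2) t2)] exceeds the form by
   [(m0 m1 / m2) t2^2]. *)
exists (- (m0 * m1 / m2)), (nth 0 [:: 0; 0; 1]), (nth 0 [:: m2; 0; m0]), (nth 0 [:: 0; 1; m1 / m2]).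
split; first by rewrite oppr_eq0 !mulf_neq0 ?invr_neq0.
  by apply: contraNneq m20; rewrite /vdet /= => <-; apply/eqP; ring.
by do !split=> //=; rewrite ?h0 ?h1 ?h2; field.
Qed.
End QuadraticForms.

(** * Quadratic relations between three forms on k^5 *)

Section NoRank2.
Variables (k : closedFieldType) (g : lieAlgType k).
Hypotheses (two_neq0 : (2 : k) != 0) (dg : \dim {:g} = 8%N) (ts : two_step_nilpotent g).
Hypothesis dD : \dim (derived_algebra g) = 3%N.
Let e53 : (5 + 3 = 8)%N := erefl.

Lemma nz3_ex (q : nat -> k) : nz3 q -> exists2 c, (c < 3)%N & q c != 0.
Proof. by rewrite /nz3 !negb_and => /or3P[h|h|h]; [exists 0%N|exists 1%N|exists 2%N]. Qed.

Lemma dual53 (x z : nat -> g -> k) : coframe 5 3 x z -> forall j : nat, exists u : g,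
  forall i, (i < 5)%N -> x i u = (i == j)%:R.
Proof.
move=> cxz j; have [u [hu _]] := coframe_surj dg e53 cxz (fun i => (i == j)%:R) (fun=> 0).
by exists u.
Qed.

Lemma comb_darboux (x z : nat -> g -> k) q : coframe 5 3 x z -> nz3 q ->
  std g 5 T53 \/ exists X : nat -> g -> k, coframe 5 3 X z /\
    forall u v, comb 2 z q u v = E 0 1 (X^~ u) (X^~ v) + E 2 3 (X^~ u) (X^~ v).
Proof.
move=> cxz /nz3_ex [c hc qc].
have [X [r [r0 r5 cX hX]]] := darboux_comb dg ts dD e53 cxz hc qc.
case: r r0 r5 hX => [//|[|[|[|r]]]] // _ _ hX.
  left; have [|p H] := admits_lead dg ts dD e53 (F := E 0 1) cX hc qc.
    by move=> u v; rewrite hX big_ord1.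
  exact: rank2_std H.
by right; exists X; split=> // u v; rewrite hX !big_ord_recr big_ord0 /= add0r.
Qed.

Lemma rk2_std (x z : nat -> g -> k) q : coframe 5 3 x z -> nz3 q ->
  wedge0 (comb 2 z q) (comb 2 z q) -> std g 5 T53.
Proof.
move=> cxz hq hw; have [//|[X [cX hX]]] := comb_darboux cxz hq.
have d := dual53 cX; have [u0 h0] := d 0%N; have [u1 h1] := d 1%N.
have [u2 h2] := d 2; have [u3 h3] := d 3.
have := hw u0 u1 u2 u3; rewrite /wedge !hX /E ?h0 ?h1 ?h2 ?h3 //= => /eqP.
by rewrite !(mulr0, mul0r, mulr1, subr0, sub0r, addr0, add0r) (negbTE two_neq0).
Qed.

(** With [q] in the form [e_0 ^ e_1 + e_2 ^ e_3], a form whose product with it vanishes does not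
    involve [e_4]. On k^4 the Pfaffian of [q' + s q] is quadratic in [s], and a root yields a
    decomposable form. *)
Lemma prod_std (x z : nat -> g -> k) q q' : coframe 5 3 x z -> nz3 q -> nz3 q' ->
  wedge0 (comb 2 z q) (comb 2 z q') -> std g 5 T53.
Proof.
move=> cxz hq hq' hw; have [//|[X [cX hX]]] := comb_darboux cxz hq.
have [p hp] := coframe_gen dg ts dD e53 cX.
pose P i j := q'#0 * p#0 i j + q'#1 * p#1 i j + q'#2 * p#2 i j.
have hP u v : comb 2 z q' u v = gen 5 P (X^~ u) (X^~ v).
  by rewrite /comb !big_ord_recr big_ord0 /= !hp !gen5E /P; ring.
have d := dual53 cX; have [u0 h0] := d 0%N; have [u1 h1] := d 1%N.
have [u2 h2] := d 2; have [u3 h3] := d 3; have [u4 h4] := d 4.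
have ev a b c e : wedge (comb 2 z q) (comb 2 z q') a b c e = 0 := hw a b c e.
have e0123 : P#0#1 + P#2#3 = 0.
  rewrite -[RHS](ev u0 u1 u2 u3) /wedge !hX !hP !gen5E /E ?h0 ?h1 ?h2 ?h3 //=; ring.
have e24 : P#2#4 = 0.
  by rewrite -[RHS](ev u0 u1 u2 u4) /wedge !hX !hP !gen5E /E ?h0 ?h1 ?h2 ?h4 //=; ring.
have e34 : P#3#4 = 0.
  by rewrite -[RHS](ev u0 u1 u3 u4) /wedge !hX !hP !gen5E /E ?h0 ?h1 ?h3 ?h4 //=; ring.
have e04 : P#0#4 = 0.
  by rewrite -[RHS](ev u0 u2 u3 u4) /wedge !hX !hP !gen5E /E ?h0 ?h2 ?h3 ?h4 //=; ring.
have e14 : P#1#4 = 0.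
  by rewrite -[RHS](ev u1 u2 u3 u4) /wedge !hX !hP !gen5E /E ?h1 ?h2 ?h3 ?h4 //=; ring.
have [s hs] := @quad_root k 1 (P#0#1 + P#2#3)
  (P#0#1 * P#2#3 - P#0#2 * P#1#3 + P#0#3 * P#1#2) (oner_neq0 _).
pose q2 c := q' c + s * q c.
have hq2 u v : comb 2 z q2 u v = gen 5 P (X^~ u) (X^~ v) +
    s * (E 0 1 (X^~ u) (X^~ v) + E 2 3 (X^~ u) (X^~ v)).
  by rewrite -hP -hX /comb !big_ord_recr !big_ord0 /= /q2; ring.
have [nq2|] := boolP (nz3 q2).
  apply: (rk2_std cX nq2) => v0 v1 v2 v3; rewrite /wedge !hq2 !gen5E e24 e34 e04 e14.
  transitivity (2 * (1 * s ^+ 2 + (P#0#1 + P#2#3) * s + (P#0#1 * P#2#3 - P#0#2 * P#1#3 + P#0#3 * P#1#2))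
    * wedge (E 0 1) (E 2 3) (X^~ v0) (X^~ v1) (X^~ v2) (X^~ v3)); last by rewrite hs mulr0 mul0r.
  rewrite /wedge /E; ring.
(* If [q' + s q] were zero, the vanishing of the product of [q] and [q'] would give [s = 0], then
   [q' = 0]. *)
rewrite negbK => /and3P[/eqP z0 /eqP z1 /eqP z2].
have cz u v : comb 2 z q2 u v = 0.
  by rewrite /comb !big_ord_recr !big_ord0 /= z0 z1 z2; ring.
have e01 : P#0#1 + s = 0.
  by rewrite -[RHS](cz u0 u1) hq2 gen5E /E ?h0 ?h1 //=; ring.
have e23 : P#2#3 + s = 0.
  by rewrite -[RHS](cz u2 u3) hq2 gen5E /E ?h2 ?h3 //=; ring.
have s0 : s = 0.
  apply: (mulfI two_neq0); rewrite mulr0 -[RHS]oppr0 -e0123; apply/eqP; rewrite -subr_eq0.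
  have -> : 2 * s - - (P#0#1 + P#2#3) = (P#0#1 + s) + (P#2#3 + s) by ring.
  by rewrite e01 e23 addr0.
by case/negP: hq'; move: z0 z1 z2; rewrite /q2 s0 !mul0r !addr0 => -> -> ->; rewrite eqxx.
Qed.

Definition zlie (z : nat -> g -> k) c : g -> g -> k := fun u v => z c (lie u v).

Definition relation (z : nat -> g -> k) (s0 s1 s2 m0 m1 m2 : k) := forall u1 u2 u3 u4,
  s0 * wedge (zlie z 0) (zlie z 0) u1 u2 u3 u4 + s1 * wedge (zlie z 1) (zlie z 1) u1 u2 u3 u4 +
  s2 * wedge (zlie z 2) (zlie z 2) u1 u2 u3 u4 + m0 * wedge (zlie z 1) (zlie z 2) u1 u2 u3 u4 +
  m1 * wedge (zlie z 0) (zlie z 2) u1 u2 u3 u4 + m2 * wedge (zlie z 0) (zlie z 1) u1 u2 u3 u4 = 0.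

Lemma rel_deg (x z : nat -> g -> k) s0 s1 s2 m0 m1 m2 : coframe 5 3 x z ->
  ~~ [&& s0 == 0, s1 == 0, s2 == 0, m0 == 0, m1 == 0 & m2 == 0] ->
  disc3 s0 s1 s2 m0 m1 m2 = 0 -> relation z s0 s1 s2 m0 m1 m2 -> std g 5 T53.
Proof.
move=> cxz hn hd hr; have [q [q' [hq hq' [[e0 e1 e2] [f0 f1 f2]]]]] := split_deg two_neq0 hn hd.
apply: (prod_std cxz hq hq') => u1 u2 u3 u4; rewrite -[RHS](hr u1 u2 u3 u4).
rewrite e0 e1 e2 f0 f1 f2 /wedge /comb /zlie !big_ord_recr !big_ord0 /=; ring.
Qed.

Lemma hodgeC (p q : nat -> nat -> k) i : hodge p q i = hodge q p i.
Proof. by do 5?[case: i => [|i] //=]; rewrite /hodge /pf /=; ring. Qed.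

Lemma gen5C (p : nat -> nat -> k) a b : gen 5 p a b = - gen 5 p b a.
Proof. by rewrite !gen5E /E; ring. Qed.

Lemma gen5_ext (p : nat -> nat -> k) a a' b b' :
  (forall i, (i < 5)%N -> a i = a' i) -> (forall i, (i < 5)%N -> b i = b' i) ->
  gen 5 p a b = gen 5 p a' b'.
Proof. by move=> ha hb; rewrite !gen5E /E !ha ?hb. Qed.

Lemma pf_wedge (x z : nat -> g -> k) (p : nat -> nat -> nat -> k) i j l m :
  coframe 5 3 x z -> (forall c u v, z c (lie u v) = gen 5 (p c) (x^~ u) (x^~ v)) ->
  (i, j, l, m) \in [:: (0,1,2,3); (0,1,2,4); (0,1,3,4); (0,2,3,4); (1,2,3,4)]%N -> exists u1 u2 u3 u4 : g, forall c d,
  pf (p c) (p d) i j l m = wedge (zlie z c) (zlie z d) u1 u2 u3 u4.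
Proof.
move=> cxz hp h; have dl := dual53 cxz.
have [u1 e1] := dl i; have [u2 e2] := dl j; have [u3 e3] := dl l; have [u4 e4] := dl m.
exists u1, u2, u3, u4 => c d.
rewrite /wedge /zlie !hp !gen5E /E !e1 ?e2 ?e3 ?e4 // /pf.
clear -h; rewrite !inE in h.
by move: h; do 4?[case/orP]; move=> /eqP[-> -> -> ->] /=; ring.
Qed.

(** [y0, y1, y2] are the rows of a change of basis of [W], inverted by Cramer's rule, after which
    the relation consists of [c] times the square of the form 0 plus the product of the forms 1 and
    2. *)
Lemma conic_basis (x z : nat -> g -> k) c y0 y1 y2 s0 s1 s2 m0 m1 m2 :
  coframe 5 3 x z -> vdet y0 y1 y2 != 0 -> is_conic s0 s1 s2 m0 m1 m2 c y0 y1 y2 ->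
  relation z s0 s1 s2 m0 m1 m2 ->
  exists z', coframe 5 3 x z' /\ relation z' c 0 0 1 0 0.
Proof.
move=> [lx lz inj cl] hy [[e0 e1 e2] [f0 f1 f2]] hr.
pose lc (y : nat -> k) u : k := y#0 * z#0 u + y#1 * z#1 u + y#2 * z#2 u.
pose z' i u := nth 0 [:: lc y0 u; lc y1 u; lc y2 u] i.
exists z'; split; last first.
  move=> u1 u2 u3 u4; rewrite -[RHS](hr u1 u2 u3 u4) e0 e1 e2 f0 f1 f2.
  by rewrite /wedge /zlie /z' /lc /=; ring.
split=> //.
  by move=> i a u v; rewrite /z'; nth_cases i; rewrite /lc ?lz; ring.
move=> u hx hz; apply: inj => // i hi; apply: (mulfI hy); rewrite mulr0.
have := hz 0%N isT; have := hz 1%N isT; have := hz 2 isT; rewrite /z' /= => h2 h1 h0.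
case: i hi => [|[|[|//]]] _.
- transitivity (lc y0 u * (y1#1 * y2#2 - y1#2 * y2#1) - lc y1 u * (y0#1 * y2#2 - y0#2 * y2#1)
    + lc y2 u * (y0#1 * y1#2 - y0#2 * y1#1)); last by rewrite h0 h1 h2; ring.
  by rewrite /lc /vdet; ring.
- transitivity (- lc y0 u * (y1#0 * y2#2 - y1#2 * y2#0) + lc y1 u * (y0#0 * y2#2 - y0#2 * y2#0)
    - lc y2 u * (y0#0 * y1#2 - y0#2 * y1#0)); last by rewrite h0 h1 h2; ring.
  by rewrite /lc /vdet; ring.
transitivity (lc y0 u * (y1#0 * y2#1 - y1#1 * y2#0) - lc y1 u * (y0#0 * y2#1 - y0#1 * y2#0)
    + lc y2 u * (y0#0 * y1#1 - y0#1 * y1#0)); last by rewrite h0 h1 h2; ring.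
by rewrite /lc /vdet; ring.
Qed.

(* The table of the three forms on the vectors [hodge (p a) (p b)]: it is forced,
   up to one scalar, by the linear identities [hodge1], [hodge2], [hodge3]. *)
Lemma conic_table (p : nat -> nat -> nat -> k) (v : nat -> nat -> k) c : c != 0 ->
  v = nth (fun=> 0) [:: hodge (p#1) (p#1); hodge (p#0) (p#1); hodge (p#1) (p#2);
    hodge (p#0) (p#2); hodge (p#2) (p#2)] ->
  (forall i, v#2 i = - c * hodge (p#0) (p#0) i) ->
  let G a j l := gen 5 (p a) (v j) (v l) in
  let A := G#1#2#3 in
  [/\ [/\ G#0#0#1 = 0, G#0#0#2 = 0, G#0#0#3 = 0 & G#0#0#4 = 4 * A],
       [/\ G#0#1#2 = 0, G#0#1#3 = A / (2 * c) & G#0#1#4 = 0] &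
       [/\ G#0#2#3 = 0, G#0#2#4 = 0 & G#0#3#4 = 0]] /\
  [/\ [/\ G#1#0#1 = 0, G#1#0#2 = 0, G#1#0#3 = 0 & G#1#0#4 = 0],
       [/\ G#1#1#2 = 0, G#1#1#3 = 0 & G#1#1#4 = - 2 * A] &
       [/\ G#1#2#4 = 0 & G#1#3#4 = 0]] /\
  [/\ [/\ G#2#0#1 = 0, G#2#0#2 = 0, G#2#0#3 = - 2 * A & G#2#0#4 = 0],
       [/\ G#2#1#2 = A, G#2#1#3 = 0 & G#2#1#4 = 0] &
       [/\ G#2#2#3 = 0, G#2#2#4 = 0 & G#2#3#4 = 0]].
Proof.
move=> c0 ev v00 G A.
have GC a j l : G a j l = - G a l j by apply: gen5C.
have Gjj a j : G a j j = 0 by rewrite /G gen5E /E; ring.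
(* [K1] to [K10] are [hodge1], [hodge2] and [hodge3] paired with an arbitrary [v l]; by [sc], the
   vector [v 2] also stands for the square of the form 0. *)
have K1 l : G#1#0 l = 0 by rewrite /G ev hodge1.
have K2 l : G#2#4 l = 0 by rewrite /G ev hodge1.
have sc a l : G a 2 l = - c * gen 5 (p a) (hodge (p#0) (p#0)) (v l).
  by rewrite /G !gen5E /E !v00; ring.
have K3 l : G#0#2 l = 0 by rewrite sc hodge1 mulr0.
have K4 l : G#0#0 l = - (2 * G#1#1 l) by rewrite /G ev hodge2.
have K5 l : G#0#4 l = - (2 * G#2#3 l) by rewrite /G ev hodge2.
have hC a a' b l : gen 5 (p b) (hodge (p a) (p a')) (v l) = gen 5 (p b) (hodge (p a') (p a)) (v l).
  by apply: gen5_ext => // i _; apply: hodgeC.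
have K6 l : G#1#2 l = 2 * c * G#0#1 l by rewrite sc hodge2 (hC 1%N 0%N 0%N l) /G ev /=; ring.
have K7 l : G#2#2 l = 2 * c * G#0#3 l by rewrite sc hodge2 (hC 2%N 0%N 0%N l) /G ev /=; ring.
have K8 l : G#2#0 l = - (2 * G#1#2 l).
  transitivity (gen 5 (p#2) (hodge (p#1) (p#1)) (v l)); first by rewrite /G ev.
  by rewrite hodge2 (hC 2%N 1%N 1%N l) /G ev.
have K9 l : G#1#4 l = - (2 * G#2#2 l) by rewrite /G ev hodge2.
have K10 l : G#1#3 l = - G#2#1 l.
  have := hodge3 (p#0) (p#1) (p#2) (v l); have := K3 l; rewrite /G ev /= => ->.
  by rewrite add0r => /eqP; rewrite addr_eq0 => /eqP.
have inj2 (a b : k) : a = - (2 * b) -> a = 0 -> b = 0.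
  by move=> -> /eqP; rewrite oppr_eq0 mulf_eq0 (negbTE two_neq0) => /eqP.
have G23z : G#2#2#3 = 0 by rewrite GC (inj2 _ _ (K5 2)) ?oppr0 // GC K3 oppr0.
have G12z : G#1#1#2 = 0 by apply: (inj2 _ _ (K4 2)); rewrite GC K3 oppr0.
have G2_02 : G#2#0#2 = 0 by rewrite K8 Gjj mulr0 oppr0.
have G0_03 : G#0#0#3 = 0.
  have := K7 0%N; rewrite GC G2_02 oppr0 => /esym/eqP; rewrite !mulf_eq0 (negbTE two_neq0) (negbTE c0) /=.
  by rewrite GC oppr_eq0 => /eqP.
have G1_13 : G#1#1#3 = 0 by apply: (inj2 _ _ (K4 3)).
have G1_24 : G#1#2#4 = 0 by rewrite GC K9 Gjj mulr0 oppr0 oppr0.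
have G1_34 : G#1#3#4 = 0 by rewrite GC K9 G23z mulr0 oppr0 oppr0.
have G2_12 : G#2#1#2 = A by rewrite -[LHS]opprK -K10 -GC.
have G1_14 : G#1#1#4 = - 2 * A by rewrite GC K9 GC G2_12; ring.
have half (a b : k) : a = 2 * c * b -> b = a / (2 * c).
  by move=> ->; field; rewrite two_neq0 c0.
split; last split; split; split=> //.
- by rewrite K4 Gjj mulr0 oppr0.
- by rewrite GC K3 oppr0.
- by rewrite K4 G1_14; ring.
- by rewrite GC K3 oppr0.
- exact: half (K6 3).
- by rewrite (half _ _ (K6 4)) G1_24 mul0r.
- by rewrite GC K5 Gjj mulr0 !oppr0.
- by rewrite K8 GC G12z oppr0 mulr0 oppr0.
- by rewrite K8 /A; ring.
- by rewrite GC K2 oppr0.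
- by rewrite -[LHS]opprK -K10 Gjj oppr0.
- by rewrite GC K2 oppr0.
- by rewrite GC K2 oppr0.
- by rewrite GC K2 oppr0.
Qed.

Lemma conic_std (x z : nat -> g -> k) c : c != 0 -> coframe 5 3 x z ->
  relation z c 0 0 1 0 0 -> std g 5 T53.
Proof.
move=> c0 cxz hr; have [p hp] := coframe_gen dg ts dD e53 cxz.
have pw i j l m h := @pf_wedge x z p i j l m cxz hp h.
pose v := nth (fun=> 0) [:: hodge (p#1) (p#1); hodge (p#0) (p#1); hodge (p#1) (p#2);
  hodge (p#0) (p#2); hodge (p#2) (p#2)].
have v00 i : v#2 i = - c * hodge (p#0) (p#0) i.
  have e a b l m : (a, b, l, m) \in [:: (0,1,2,3); (0,1,2,4); (0,1,3,4); (0,2,3,4); (1,2,3,4)]%N ->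
      pf (p#1) (p#2) a b l m = - c * pf (p#0) (p#0) a b l m.
    move=> h; have [u1 [u2 [u3 [u4 hu]]]] := pw a b l m h.
    rewrite !hu; apply/eqP; rewrite -subr_eq0 -[X in _ == X](hr u1 u2 u3 u4); apply/eqP; ring.
  by do 5?[case: i => [|i]]; rewrite /v /hodge /= ?e ?nth_nil //; ring.
(* Either the five products are dependent, which gives a second quadratic relation, or they are a
   basis of k^5. *)
pose A := \matrix_(j < 5, i < 5) v j i.
have [uA|] := boolP (A \in unitmx); last first.
  rewrite unitmxE unitfE negbK => /det0P [w w0 wA].
  pose l j := if insub j is Some j' then w 0 j' else 0 : k.
  have hl i : (i < 5)%N -> l#0 * v#0 i + l#1 * v#1 i + l#2 * v#2 i + l#3 * v#3 i + l#4 * v#4 i = 0.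
    move=> hi; have := congr1 (fun B : 'rV_5 => B 0 (Ordinal hi)) wA; rewrite !mxE => <-.
    rewrite !big_ord_recr big_ord0 /= !mxE add0r /=.
    by do !congr (_ + _); congr (_ * _); rewrite /l insubT; congr (w _ _); apply: val_inj.
  have hr' : relation z 0 (l#0) (l#4) (l#2) (l#3) (l#1).
    move=> u1 u2 u3 u4.
    have wz a b : wedge (zlie z a) (zlie z b) u1 u2 u3 u4 =
        wedge (gen 5 (p a)) (gen 5 (p b)) (x^~ u1) (x^~ u2) (x^~ u3) (x^~ u4).
      by rewrite /wedge /zlie !hp.
    rewrite !wz !wedge_gen5.
    have := hl 0%N isT; have := hl 1%N isT; have := hl 2 isT; have := hl 3 isT; have := hl 4 isT.
    rewrite /v /hodge /= => h4 h3 h2 h1 h0.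
    transitivity ((l#0 * pf (p#1) (p#1) 0 1 2 3 + l#1 * pf (p#0) (p#1) 0 1 2 3 +
      l#2 * pf (p#1) (p#2) 0 1 2 3 + l#3 * pf (p#0) (p#2) 0 1 2 3 + l#4 * pf (p#2) (p#2) 0 1 2 3)
       * wedge (E 0 1) (E 2 3) (x^~ u1) (x^~ u2) (x^~ u3) (x^~ u4) -
      (l#0 * - pf (p#1) (p#1) 0 1 2 4 + l#1 * - pf (p#0) (p#1) 0 1 2 4 +
      l#2 * - pf (p#1) (p#2) 0 1 2 4 + l#3 * - pf (p#0) (p#2) 0 1 2 4 + l#4 * - pf (p#2) (p#2) 0 1 2 4)
       * wedge (E 0 1) (E 2 4) (x^~ u1) (x^~ u2) (x^~ u3) (x^~ u4) +
      (l#0 * pf (p#1) (p#1) 0 1 3 4 + l#1 * pf (p#0) (p#1) 0 1 3 4 +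
      l#2 * pf (p#1) (p#2) 0 1 3 4 + l#3 * pf (p#0) (p#2) 0 1 3 4 + l#4 * pf (p#2) (p#2) 0 1 3 4)
       * wedge (E 0 1) (E 3 4) (x^~ u1) (x^~ u2) (x^~ u3) (x^~ u4) -
      (l#0 * - pf (p#1) (p#1) 0 2 3 4 + l#1 * - pf (p#0) (p#1) 0 2 3 4 +
      l#2 * - pf (p#1) (p#2) 0 2 3 4 + l#3 * - pf (p#0) (p#2) 0 2 3 4 + l#4 * - pf (p#2) (p#2) 0 2 3 4)
       * wedge (E 0 2) (E 3 4) (x^~ u1) (x^~ u2) (x^~ u3) (x^~ u4) +
      (l#0 * pf (p#1) (p#1) 1 2 3 4 + l#1 * pf (p#0) (p#1) 1 2 3 4 +
      l#2 * pf (p#1) (p#2) 1 2 3 4 + l#3 * pf (p#0) (p#2) 1 2 3 4 + l#4 * pf (p#2) (p#2) 1 2 3 4)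
       * wedge (E 1 2) (E 3 4) (x^~ u1) (x^~ u2) (x^~ u3) (x^~ u4)); first by ring.
    by rewrite h0 h1 h2 h3 h4; ring.
  (* The discriminant of the second relation plus [t] times the first is a cubic polynomial in [t]
     with leading coefficient [- c]; a root gives a degenerate relation. *)
  have [t ht] : exists t, disc3 (t * c) (l#0) (l#4) (l#2 + t) (l#3) (l#1) = 0.
    have [t ht] := @solve_monicpoly k 3 (nth 0 [::
      (l#2 * l#3 * l#1 - l#0 * l#3 ^+ 2 - l#4 * l#1 ^+ 2) / c;
      (4 * c * l#0 * l#4 + l#3 * l#1 - c * l#2 ^+ 2) / c; - 2 * l#2]) isT.
    exists t; rewrite !big_ord_recr big_ord0 /= add0r expr0 expr1 mulr1 in ht.
    have -> : disc3 (t * c) (l#0) (l#4) (l#2 + t) (l#3) (l#1) = - c * (t ^+ 3 -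
      ((l#2 * l#3 * l#1 - l#0 * l#3 ^+ 2 - l#4 * l#1 ^+ 2) / c +
       (4 * c * l#0 * l#4 + l#3 * l#1 - c * l#2 ^+ 2) / c * t + - 2 * l#2 * t ^+ 2)).
      by rewrite /disc3; field.
    by rewrite -ht subrr mulr0.
  apply: (rel_deg cxz _ ht).
    apply: contra w0 => /and5P[h0 h1 h4 h2 /andP[h3 h1']].
    rewrite mulf_eq0 (negbTE c0) orbF in h0; rewrite (eqP h0) addr0 in h2.
    apply/eqP/rowP => i; rewrite mxE.
    have <- : l i = w 0 i by rewrite /l valK.
    by case: i => -[|[|[|[|[|//]]]]] hi /=; apply/eqP.
  move=> u1 u2 u3 u4; rewrite -[RHS](hr' u1 u2 u3 u4).
  apply/eqP; rewrite -subr_eq0; apply/eqP; rewrite -[RHS](mulr0 t).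
  by rewrite -[in RHS](hr u1 u2 u3 u4); ring.
case: (cxz) => lx lz inj cl.
(* The [X j] are the coordinates of the vector [x] in the basis [v]. *)
pose X j u := if insub j is Some j' then \sum_(i < 5) x i u * invmx A i j' else 0 : k.
have xX i u : (i < 5)%N -> x i u = \sum_(j < 5) X j u * v j i.
  move=> hi; have := congr1 (fun B => ((\row_(l < 5) x l u) *m B) 0 (Ordinal hi)) (mulVmx uA).
  rewrite mulmx1 mulmxA !mxE => <-; apply: eq_bigr => j _; rewrite !mxE /X valK.
  by congr (_ * _); apply: eq_bigr => l _; rewrite mxE.
have cX : coframe 5 3 X z.
  split=> //.
  - move=> j a u w; rewrite /X; case: insub => [j'|]; last by rewrite mulr0 addr0.
    by rewrite mulr_sumr -big_split /=; apply: eq_bigr => i _; rewrite lx; ring.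
  - move=> u hx hz; apply: inj => // i hi; rewrite xX // big1 // => j _.
    by rewrite hx ?mul0r.
  - move=> j u w; rewrite /X; case: insub => [j'|//].
    by rewrite big1 // => i _; rewrite cl mul0r.
have [P hP] := coframe_gen dg ts dD e53 cX.
(* In the new coframe the coefficients of a form are its values on pairs of vectors of the basis
   [v]. *)
have T c' j l : (j < l < 5)%N -> P c' j l = gen 5 (p c') (v j) (v l).
  move=> /andP[jl l5]; have j5 := ltn_trans jl l5.
  have [u hu] := dual53 cX j; have [w hw] := dual53 cX l.
  have xv m (s : g) : (m < 5)%N -> (forall i, (i < 5)%N -> X i s = (i == m)%:R) ->
      forall i, (i < 5)%N -> x i s = v m i.
    move=> m5 hs i hi; rewrite xX // (bigD1 (Ordinal m5)) //= hs // eqxx mul1r big1 ?addr0 //.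
    by move=> j' hj; rewrite hs //; move: hj; rewrite -val_eqE /= => /negbTE ->; rewrite mul0r.
  have := hp c' u w; rewrite hP (gen5_ext _ (xv j u j5 hu) (xv l w l5 hw)) => <-.
  rewrite gen5E /E !hu ?hw //.
  by case: j jl j5 {hu} => [|[|[|[|[|j]]]]] //; case: l l5 {hw} => [|[|[|[|[|l]]]]] //= _ _ _; ring.
have [[[A1 A2 A3 A4] [A5 A6 A7] [A8 A9 A10]] [[[B1 B2 B3 B4] [B5 B6 B7] [B8 B9]]
  [[C1 C2 C3 C4] [C5 C6 C7] [C8 C9 C10]]]] := conic_table c0 (erefl v) v00.
set a := gen 5 (p 1%N) (v#2) (v#3) in A1 A2 A3 A4 A5 A6 A7 A8 A9 A10 B1 B2 B3 B4 B5 B6 B7 B8 B9 C1 C2 C3 C4 C5 C6 C7 C8 C9 C10.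
have [lX _ _ clX] := cX.
have H : admits g 5 [:: fun u w => a * (4 * E 0 4 u w + 1 / (2 * c) * E 1 3 u w);
    fun u w => a * (E 2 3 u w - 2 * E 1 4 u w); fun u w => a * (E 1 2 u w - 2 * E 0 3 u w)].
  exists X, (fun i => if (i < 3)%N then z i else fun=> 0); split.
    split=> //.
      by move=> i; case: ifP => _ // b u w; rewrite mulr0 addr0.
    by move=> u hx hz; apply: (let: And4 _ _ h _ := cX in h) => // i hi; have := hz i hi; rewrite hi.
  move=> [|[|[|i]]] u w /=; last (by rewrite nth_nil); rewrite hP gen5E !T //.
  - by rewrite A1 A2 A3 A4 A5 A6 A7 A8 A9 A10; field; rewrite two_neq0 c0.
  - by rewrite B1 B2 B3 B4 B5 B6 B7 B8 B9 -/a; ring.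
  - by rewrite C1 C2 C3 C4 C5 C6 C7 C8 C9 C10; ring.
have a0 : a != 0.
  apply/negP => /eqP e; suff : [&& (1 : k) == 0, (0 : k) == 0 & (0 : k) == 0] by rewrite oner_eq0.
  by apply: (indep53 dg dD H) => // u w; rewrite /= e; ring.
have f4 : (4 : k) != 0 by rewrite (_ : 4 = 2 * 2) ?mulf_neq0 //; ring.
by fin [:: [:: (0,3); (1,2)]; [:: (0,4); (1,3)]; [:: (1,4); (2,3)]]%N H
  (fun u => [:: - 4 * c * u#0; u#1; u#2; u#3 / (2 * c); - u#4 / c])
  (fun u => [:: - u#0 / (4 * c); u#1; u#2; 2 * c * u#3; - c * u#4])
  (fun u => [:: u#2 / a; u#0 / a; u#1 / (2 * c * a)])
  (fun u => [:: a * u#1; 2 * c * a * u#2; a * u#0]).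
Qed.

Lemma std53 : std g 5 T53.
Proof.
have [x [z [cxz _]]] := coframe_exists dg dD e53; have [p hp] := coframe_gen dg ts dD e53 cxz.
(* The six products, in the order of the coefficients [s0, s1, s2, m0, m1, m2]; row [r] of [M] holds
   the five Pfaffians of the product [r]. *)
pose ab r := nth (0, 0)%N [:: (0,0); (1,1); (2,2); (1,2); (0,2); (0,1)]%N r.
pose M r s := nth 0 [seq pf (p (ab r).1) (p (ab r).2) t.1.1.1 t.1.1.2 t.1.2 t.2 | t <-
  [:: (0,1,2,3); (0,1,2,4); (0,1,3,4); (0,2,3,4); (1,2,3,4)]%N] s.
have [n [i0 [hi ni hn]]] := lin_dep M (isT : (5 < 6)%N).
have hr : relation z (n#0) (n#1) (n#2) (n#3) (n#4) (n#5).
  move=> u1 u2 u3 u4.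
  have wz a b : wedge (zlie z a) (zlie z b) u1 u2 u3 u4 =
      wedge (gen 5 (p a)) (gen 5 (p b)) (x^~ u1) (x^~ u2) (x^~ u3) (x^~ u4).
    by rewrite /wedge /zlie !hp.
  rewrite !wz !wedge_gen5.
  have := hn 0%N isT; have := hn 1%N isT; have := hn 2 isT; have := hn 3 isT; have := hn 4 isT.
  rewrite !big_ord_recr !big_ord0 /M /ab /= => h4 h3 h2 h1 h0.
  have key x0 x1 x2 x3 x4 w0 w1 w2 w3 w4 : x0 = 0 -> x1 = 0 -> x2 = 0 -> x3 = 0 -> x4 = 0 ->
      x0 * w0 + x1 * w1 + x2 * w2 + x3 * w3 + x4 * w4 = 0 :> k.
    by move=> -> -> -> -> ->; ring.
  rewrite -[RHS](key _ _ _ _ _ (wedge (E 0 1) (E 2 3) (x^~ u1) (x^~ u2) (x^~ u3) (x^~ u4))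
    (wedge (E 0 1) (E 2 4) (x^~ u1) (x^~ u2) (x^~ u3) (x^~ u4))
    (wedge (E 0 1) (E 3 4) (x^~ u1) (x^~ u2) (x^~ u3) (x^~ u4))
    (wedge (E 0 2) (E 3 4) (x^~ u1) (x^~ u2) (x^~ u3) (x^~ u4))
    (wedge (E 1 2) (E 3 4) (x^~ u1) (x^~ u2) (x^~ u3) (x^~ u4)) h0 h1 h2 h3 h4); ring.
have nn : ~~ [&& n#0 == 0, n#1 == 0, n#2 == 0, n#3 == 0, n#4 == 0 & n#5 == 0].
  apply: contra ni => /and5P[h0 h1 h2 h3 /andP[h4 h5]].
  by case: i0 hi => [|[|[|[|[|[|]]]]]].
have [hd|hd] := eqVneq (disc3 (n#0) (n#1) (n#2) (n#3) (n#4) (n#5)) 0.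
  exact: rel_deg cxz nn hd hr.
have [c [y0 [y1 [y2 [c0 hy hc]]]]] := conic_nd two_neq0 hd.
have [z' [cz' hr']] := conic_basis cxz hy hc hr.
exact: conic_std c0 cz' hr'.
Qed.
End NoRank2.

(** * Derived algebra of dimension 2 *)

Definition T62 : seq (seq (seq (nat * nat))) := [::
  [:: [:: (0,1)]; [:: (0,2)]];
  [:: [:: (0,1)]; [:: (2,3)]];
  [:: [:: (0,1)]; [:: (0,2); (1,3)]];
  [:: [:: (0,1)]; [:: (2,3); (0,4)]];
  [:: [:: (0,1)]; [:: (2,3); (4,5)]];
  [:: [:: (0,1)]; [:: (2,3); (0,4); (1,5)]];
  [:: [:: (0,1); (2,3)]; [:: (4,5); (0,1)]];
  [:: [:: (0,1); (2,3)]; [:: (4,5); (0,2)]];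
  [:: [:: (0,1); (2,3)]; [:: (0,4); (1,2)]];
  [:: [:: (0,1); (2,3)]; [:: (0,4); (2,5); (1,3)]];
  [:: [:: (0,1); (2,3)]; [:: (0,4); (2,5)]]]%N.

Definition id2 (k : fieldType) (a : nat -> k) := [:: a#0; a#1].
Definition sw2 (k : fieldType) (a : nat -> k) := [:: a#1; a#0].
Definition id6 (k : fieldType) (a : nat -> k) := [:: a#0; a#1; a#2; a#3; a#4; a#5].

(** If [A] is invertible, an eigenvalue [r] of [B A^-1] makes [B - r A] singular. *)
Lemma pencil_singular (k : closedFieldType) n (A B : 'M[k]_n.+1) :
  exists s t (v : 'rV_n.+1), [/\ (s != 0) || (t != 0), v != 0 & v *m (s *: A + t *: B) = 0].
Proof.
have [uA|] := boolP (A \in unitmx); last first.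
  rewrite unitmxE unitfE negbK => /det0P [v v0 vA]; exists 1, 0, v.
  by rewrite oner_eq0 scale1r scale0r addr0.
have /closed_rootP [r] : size (char_poly (B *m invmx A)) != 1%N by rewrite size_char_poly.
rewrite -eigenvalue_root_char => /eigenvalueP [v hv v0]; exists (- r), 1, v.
rewrite oner_eq0 orbT v0 scale1r; split=> //.
rewrite mulmxDr -[B](mulmxKV uA) mulmxA [v *m (B *m _)]hv -scalemxAr -scalemxAl.
by rewrite scaleNr addNr.
Qed.

(** * A degenerate form in a pencil on k^6 *)

Section Pencils.
Variables (k : closedFieldType) (g : lieAlgType k).
Hypotheses (two_neq0 : (2 : k) != 0) (dg : \dim {:g} = 8%N) (ts : two_step_nilpotent g).
Hypothesis dD : \dim (derived_algebra g) = 2%N.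
Let e62 : (6 + 2 = 8)%N := erefl.

Lemma indep62 W : admits g 6 W -> size W = 2%N ->
  forall q0 q1, (forall a b, q0 * nth (@form0 k) W 0 a b + q1 * nth (@form0 k) W 1 a b = 0) ->
  (q0 == 0) && (q1 == 0).
Proof.
move=> H sz q0 q1 hq.
have h := admits_indep dg dD e62 (q := nth 0 [:: q0; q1]) H sz.
have {}h c : (c < 2)%N -> nth 0 [:: q0; q1] c = 0.
  by apply: h => a b; rewrite !big_ord_recr big_ord0 /= add0r hq.
by have /= -> := h 0%N isT; have /= -> := h 1%N isT; rewrite eqxx.
Qed.

Lemma pencil_lead : exists p, admits g 6 [:: E 0 1; gen 6 p] \/
  admits g 6 [:: fun a b => E 0 1 a b + E 2 3 a b; gen 6 p].
Proof.
have [x [z [cxz _]]] := coframe_exists dg dD e62; have [p hp] := coframe_gen dg ts dD e62 cxz.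
pose P c i j := if (i < j)%N then p c i j else if (j < i)%N then - p c j i else 0.
pose M c := \matrix_(i < 6, j < 6) P c i j.
have [s [t [v [hst v0 hv]]]] := pencil_singular (M 0%N) (M 1%N).
pose q := nth 0 [:: s; t].
have [c0 hc0 qc0] : exists2 c0, (c0 < 2)%N & q c0 != 0.
  by case/orP: hst => h; [exists 0%N|exists 1%N].
(* The vector [u] with coordinates [v] lies in the radical of the combination [q]. *)
have [u [hu hzu]] := coframe_surj dg e62 cxz
  (fun i => if insub i is Some i' then v 0 i' else 0) (fun=> 0).
have hM c w : z c (lie u w) = \sum_(j < 6) (v *m M c) 0 j * x j w.
  have -> : z c (lie u w) = gen 6 (P c) (x^~ u) (x^~ w).
    by rewrite hp; apply: eq_bigr => j _; apply: eq_bigr => i _; rewrite /P ltn_ord.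
  rewrite -gen_skew; last 2 first.
  - by move=> i; rewrite /P ltnn.
  - by move=> i j; rewrite /P; case: ltngtP; rewrite ?opprK ?oppr0.
  rewrite exchange_big; apply: eq_bigr => j _; rewrite mxE mulr_suml.
  by apply: eq_bigr => i _; rewrite mxE hu // valK; ring.
have hq w : comb 1 z q u w = 0.
  rewrite /comb !big_ord_recr big_ord0 /= !hM add0r !mulr_sumr -big_split big1 // => j _ /=.
  have := congr1 (fun B : 'rV_6 => B 0 j) hv.
  rewrite mulmxDr -!scalemxAr mxE [X in X + _]mxE [X in _ + X]mxE [RHS]mxE => e.
  by rewrite -[RHS](mul0r (x j w)) -e /q /=; ring.
have [X [r [r0 r6 cX hX]]] := darboux_comb dg ts dD e62 cxz hc0 qc0.
case: r r0 r6 hX => [//|[|[|[|r]]]] // _ _ hX.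
- have [|P' H] := admits_lead dg ts dD e62 (F := E 0 1) cX hc0 qc0.
    by move=> u' w; rewrite hX big_ord1.
  by exists (P' 1%N); left.
- have [|P' H] := admits_lead dg ts dD e62 (F := fun a b => E 0 1 a b + E 2 3 a b) cX hc0 qc0.
    by move=> u' w; rewrite hX !big_ord_recr big_ord0 /= add0r.
  by exists (P' 1%N); right.
(* Rank 6 is impossible: every 1-form of the Darboux basis would vanish on [u], whose coordinates
   [v] are not all zero. *)
have Xu i : (i < 6)%N -> X i u = 0.
  have dl j := coframe_surj dg e62 cX (fun i => (i == j)%:R) (fun=> 0).
  have [w0 [h0 _]] := dl 0%N; have [w1 [h1 _]] := dl 1%N; have [w2 [h2 _]] := dl 2.
  have [w3 [h3 _]] := dl 3; have [w4 [h4 _]] := dl 4; have [w5 [h5 _]] := dl 5.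
  have ev w := etrans (esym (hX u w)) (hq w).
  have := ev w0; have := ev w1; have := ev w2; have := ev w3; have := ev w4; have := ev w5.
  rewrite !big_ord_recr !big_ord0 /= /E !h0 ?h1 ?h2 ?h3 ?h4 ?h5 //=.
  rewrite !(mulr0, mulr1, oppr0, subr0, sub0r, add0r, addr0) => e4 e5 e2 e3 e0 e1.
  move/eqP: e1; move/eqP: e3; move/eqP: e5; rewrite !oppr_eq0 => /eqP e5 /eqP e3 /eqP e1.
  by case: i => [|[|[|[|[|[|]]]]]].
case/eqP: v0; apply/rowP => i; rewrite mxE.
case: cX => lX _ inj _; have u0 : u = 0 by apply: inj => // c hc; rewrite hzu.
have := hu i (ltn_ord i); rewrite valK => <-; rewrite u0.
by case: cxz => lx _ _ _; rewrite lin0.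
Qed.
End Pencils.

(** * Pencils on k^6 containing a decomposable form *)

Section Pencils1.
Variables (k : closedFieldType) (g : lieAlgType k).
Hypothesis indep : forall W, admits g 6 W -> size W = 2%N ->
  forall q0 q1, (forall a b, q0 * nth (@form0 k) W 0 a b + q1 * nth (@form0 k) W 1 a b = 0) ->
  (q0 == 0) && (q1 == 0).

Lemma pencil1_cross_a2 a2 a3 a4 a5 b2 b3 b4 b5 : a2 != 0 ->
  admits g 6 [:: E 0 1; cross8 a2 a3 a4 a5 b2 b3 b4 b5] -> std g 6 T62.
Proof.
move=> h H; pose l := b2 / a2.
have {}H : admits g 6 [:: E 0 1; cross8 1 0 0 0 0 (b3 - l * a3) (b4 - l * a4) (b5 - l * a5)].
  by rewrite /l; chg H (fun a => [:: a#0 + b2 / a2 * a#1; a#1;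
      a2 * a#2 + a3 * a#3 + a4 * a#4 + a5 * a#5; a#3; a#4; a#5])
    (fun a => [:: a#0 - b2 / a2 * a#1; a#1; (a#2 - a3 * a#3 - a4 * a#4 - a5 * a#5) / a2; a#3; a#4; a#5])
    (@id2 k) (@id2 k).
move: (b3 - l * a3) (b4 - l * a4) (b5 - l * a5) H => {h l a2 a3 a4 a5 b2 b3 b4 b5} b3 b4 b5.
wlog h : b3 b4 b5 / (b3 == 0) ==> ((b4 == 0) && (b5 == 0)) => [IH H|H].
  have [h|h] := boolP ((b3 == 0) ==> ((b4 == 0) && (b5 == 0))); first exact: IH h H.
  move: h; rewrite negb_imply negb_and => /andP[/eqP h3 /orP[h|h]].
    apply: (IH b4 b3 b5); first by rewrite (negbTE h).
    by chg H (fun a => [:: a#0; a#1; a#2; a#4; a#3; a#5])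
      (fun a => [:: a#0; a#1; a#2; a#4; a#3; a#5]) (@id2 k) (@id2 k).
  apply: (IH b5 b4 b3); first by rewrite (negbTE h).
  by chg H (fun a => [:: a#0; a#1; a#2; a#5; a#4; a#3])
      (fun a => [:: a#0; a#1; a#2; a#5; a#4; a#3]) (@id2 k) (@id2 k).
have [b30|b30] := eqVneq b3 0.
  move: h; rewrite b30 eqxx /= => /andP[/eqP b40 /eqP b50]; rewrite b30 b40 b50 in H.
  by fin [:: [:: (0,1)]; [:: (0,2)]]%N H (@id6 k) (@id6 k) (@id2 k) (@id2 k).
by fin [:: [:: (0,1)]; [:: (0,2); (1,3)]]%N H
  (fun a => [:: a#0; a#1; a#2; b3 * a#3 + b4 * a#4 + b5 * a#5; a#4; a#5])
  (fun a => [:: a#0; a#1; a#2; (a#3 - b4 * a#4 - b5 * a#5) / b3; a#4; a#5])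
  (@id2 k) (@id2 k).
Qed.

Lemma pencil1_cross a2 a3 a4 a5 b2 b3 b4 b5 :
  admits g 6 [:: E 0 1; cross8 a2 a3 a4 a5 b2 b3 b4 b5] -> std g 6 T62.
Proof.
have rowA c2 c3 c4 c5 d2 d3 d4 d5 : ~~ [&& c2 == 0, c3 == 0, c4 == 0 & c5 == 0] ->
    admits g 6 [:: E 0 1; cross8 c2 c3 c4 c5 d2 d3 d4 d5] -> std g 6 T62.
  rewrite !negb_and => /or4P[] h H; first exact: pencil1_cross_a2 h H.
  - apply: (pencil1_cross_a2 (a3 := c2) (a4 := c4) (a5 := c5) (b2 := d3) (b3 := d2) (b4 := d4) (b5 := d5) h).
    by chg H (fun a => [:: a#0; a#1; a#3; a#2; a#4; a#5])
      (fun a => [:: a#0; a#1; a#3; a#2; a#4; a#5]) (@id2 k) (@id2 k).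
  - apply: (pencil1_cross_a2 (a3 := c3) (a4 := c2) (a5 := c5) (b2 := d4) (b3 := d3) (b4 := d2) (b5 := d5) h).
    by chg H (fun a => [:: a#0; a#1; a#4; a#3; a#2; a#5])
      (fun a => [:: a#0; a#1; a#4; a#3; a#2; a#5]) (@id2 k) (@id2 k).
  - apply: (pencil1_cross_a2 (a3 := c3) (a4 := c4) (a5 := c2) (b2 := d5) (b3 := d3) (b4 := d4) (b5 := d2) h).
    by chg H (fun a => [:: a#0; a#1; a#5; a#3; a#4; a#2])
      (fun a => [:: a#0; a#1; a#5; a#3; a#4; a#2]) (@id2 k) (@id2 k).
have [/and4P[/eqP h2 /eqP h3 /eqP h4 /eqP h5]|h] :=
    boolP [&& a2 == 0, a3 == 0, a4 == 0 & a5 == 0]; last exact: rowA.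
have [/and4P[/eqP e2 /eqP e3 /eqP e4 /eqP e5]|h] :=
    boolP [&& b2 == 0, b3 == 0, b4 == 0 & b5 == 0] => H; last first.
  apply: (rowA b2 b3 b4 b5 a2 a3 a4 a5 h).
  by chg H (fun a => [:: a#1; a#0; a#2; a#3; a#4; a#5])
    (fun a => [:: a#1; a#0; a#2; a#3; a#4; a#5])
    (fun a => [:: - a#0; a#1]) (fun a => [:: - a#0; a#1]).
suff : ((0 : k) == 0) && ((1 : k) == 0) by rewrite oner_eq0 andbF.
by apply: (indep H) => // a b; rewrite /= h2 h3 h4 h5 e2 e3 e4 e5 /cross8; ring.
Qed.

Definition piv1 (r45 r04 r05 r14 r15 : k) : seq (form k) := [:: E 0 1;
  fun a b => E 2 3 a b + r45 * E 4 5 a b + (r04 * E 0 4 a b + r05 * E 0 5 a b)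
    + (r14 * E 1 4 a b + r15 * E 1 5 a b)].

(** The matrix [(r04, r05; r14, r15)] couples the plane [e_0, e_1] with the plane [e_4, e_5]; only
    its rank, 1 or 2, matters. *)
Lemma piv1_r04 r04 r05 r14 r15 : r04 != 0 -> admits g 6 (piv1 0 r04 r05 r14 r15) -> std g 6 T62.
Proof.
move=> h H; have [d0|d0] := eqVneq (r15 * r04 - r14 * r05) 0.
  have e : r15 = r14 * r05 / r04.
    by apply: (mulfI h); apply/eqP; rewrite -subr_eq0 -d0; apply/eqP; field.
  rewrite e in H.
  by fin [:: [:: (0,1)]; [:: (2,3); (0,4)]]%N H
    (fun a => [:: a#0 + r14 / r04 * a#1; a#1; a#2; a#3; r04 * a#4 + r05 * a#5; a#5])
    (fun a => [:: a#0 - r14 / r04 * a#1; a#1; a#2; a#3; (a#4 - r05 * a#5) / r04; a#5])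
    (@id2 k) (@id2 k).
by fin [:: [:: (0,1)]; [:: (2,3); (0,4); (1,5)]]%N H
  (fun a => [:: a#0; a#1; a#2; a#3; r04 * a#4 + r05 * a#5; r14 * a#4 + r15 * a#5])
  (fun a => [:: a#0; a#1; a#2; a#3; (r15 * a#4 - r05 * a#5) / (r15 * r04 - r14 * r05);
    (r04 * a#5 - r14 * a#4) / (r15 * r04 - r14 * r05)])
  (@id2 k) (@id2 k).
Qed.

(** A nonzero [r45] lets [e_4] and [e_5] absorb the coupling terms; otherwise a nonzero entry of the
    coupling matrix, if any, is moved to the position of [r04]. *)
Lemma piv1_std r45 r04 r05 r14 r15 : admits g 6 (piv1 r45 r04 r05 r14 r15) -> std g 6 T62.
Proof.
move=> H; have [h|h] := eqVneq r45 0; last first.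
  by fin [:: [:: (0,1)]; [:: (2,3); (4,5)]]%N H
    (fun a => [:: a#0; a#1; a#2; a#3; a#4 + r05 / r45 * a#0 + r15 / r45 * a#1;
       r45 * a#5 - r04 * a#0 - r14 * a#1])
    (fun a => [:: a#0; a#1; a#2; a#3; a#4 - r05 / r45 * a#0 - r15 / r45 * a#1;
       (a#5 + r04 * a#0 + r14 * a#1) / r45])
    (fun a => [:: a#0; a#1 + (- r05 / r45 * r14 + r15 / r45 * r04) * a#0])
    (fun a => [:: a#0; a#1 - (- r05 / r45 * r14 + r15 / r45 * r04) * a#0]).
rewrite h in H; have [h04|h04] := eqVneq r04 0; last exact: piv1_r04 h04 H.
have [h05|h05] := eqVneq r05 0; last first.
  apply: (piv1_r04 (r05 := r04) (r14 := r15) (r15 := r14) h05).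
  by chg H (fun a => [:: a#0; a#1; a#2; a#3; a#5; a#4])
    (fun a => [:: a#0; a#1; a#2; a#3; a#5; a#4]) (@id2 k) (@id2 k).
have [h14|h14] := eqVneq r14 0; last first.
  apply: (piv1_r04 (r05 := r15) (r14 := r04) (r15 := r05) h14).
  by chg H (fun a => [:: a#1; a#0; a#2; a#3; a#4; a#5])
    (fun a => [:: a#1; a#0; a#2; a#3; a#4; a#5])
    (fun a => [:: - a#0; a#1]) (fun a => [:: - a#0; a#1]).
have [h15|h15] := eqVneq r15 0; last first.
  apply: (piv1_r04 (r05 := r14) (r14 := r05) (r15 := r04) h15).
  by chg H (fun a => [:: a#1; a#0; a#2; a#3; a#5; a#4])
    (fun a => [:: a#1; a#0; a#2; a#3; a#5; a#4])
    (fun a => [:: - a#0; a#1]) (fun a => [:: - a#0; a#1]).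
rewrite h04 h05 h14 h15 in H.
by fin [:: [:: (0,1)]; [:: (2,3)]]%N H (@id6 k) (@id6 k) (@id2 k) (@id2 k).
Qed.

(** Pivoting on [p_23]: modulo [e_0 ^ e_1], the new [e_2] and [e_3] absorb all terms in which the
    old ones occur. *)
Lemma pencil1_p23 (p : nat -> nat -> k) : p#2#3 != 0 ->
  admits g 6 [:: E 0 1; gen 6 p] -> std g 6 T62.
Proof.
move=> h H; pose r i j := (p i j * p#2#3 + p i 2 * p#3 j - p i 3 * p#2 j) / p#2#3.
apply: (@piv1_std ((p#4#5 * p#2#3 - p#2#4 * p#3#5 + p#2#5 * p#3#4) / p#2#3) (r#0#4) (r#0#5) (r#1#4) (r#1#5)).
rewrite /r; by chg H (fun a => [:: a#0; a#1;
    a#2 + p#0#3 / p#2#3 * a#0 + p#1#3 / p#2#3 * a#1 - p#3#4 / p#2#3 * a#4 - p#3#5 / p#2#3 * a#5;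
    p#2#3 * a#3 + p#2#4 * a#4 + p#2#5 * a#5 - p#0#2 * a#0 - p#1#2 * a#1; a#4; a#5])
  (fun a => [:: a#0; a#1;
    a#2 - p#0#3 / p#2#3 * a#0 - p#1#3 / p#2#3 * a#1 + p#3#4 / p#2#3 * a#4 + p#3#5 / p#2#3 * a#5;
    (a#3 - p#2#4 * a#4 - p#2#5 * a#5 + p#0#2 * a#0 + p#1#2 * a#1) / p#2#3; a#4; a#5])
  (fun a => [:: a#0; a#1 - (p#0#1 * p#2#3 - p#0#2 * p#1#3 + p#0#3 * p#1#2) / p#2#3 * a#0])
  (fun a => [:: a#0; a#1 + (p#0#1 * p#2#3 - p#0#2 * p#1#3 + p#0#3 * p#1#2) / p#2#3 * a#0]).
Qed.

Lemma pencil1_std (p : nat -> nat -> k) : admits g 6 [:: E 0 1; gen 6 p] -> std g 6 T62.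
Proof.
move=> H; have [h23|] := eqVneq (p#2#3) 0; last by move=> h; apply: pencil1_p23 h H.
have sw24 q : admits g 6 [:: E 0 1; gen 6 q] -> admits g 6 [:: E 0 1; gen 6 (skew q (swap 2 4))].
  move=> {}H; by chg H (fun a => [:: a#0; a#1; a#4; a#3; a#2; a#5])
    (fun a => [:: a#0; a#1; a#4; a#3; a#2; a#5]) (@id2 k) (@id2 k);
    rewrite /skew /swap /=; ring.
have sw25 q : admits g 6 [:: E 0 1; gen 6 q] -> admits g 6 [:: E 0 1; gen 6 (skew q (swap 2 5))].
  move=> {}H; by chg H (fun a => [:: a#0; a#1; a#5; a#3; a#4; a#2])
    (fun a => [:: a#0; a#1; a#5; a#3; a#4; a#2]) (@id2 k) (@id2 k);
    rewrite /skew /swap /=; ring.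
have sw34 q : admits g 6 [:: E 0 1; gen 6 q] -> admits g 6 [:: E 0 1; gen 6 (skew q (swap 3 4))].
  move=> {}H; by chg H (fun a => [:: a#0; a#1; a#2; a#4; a#3; a#5])
    (fun a => [:: a#0; a#1; a#2; a#4; a#3; a#5]) (@id2 k) (@id2 k);
    rewrite /skew /swap /=; ring.
have sw35 q : admits g 6 [:: E 0 1; gen 6 q] -> admits g 6 [:: E 0 1; gen 6 (skew q (swap 3 5))].
  move=> {}H; by chg H (fun a => [:: a#0; a#1; a#2; a#5; a#4; a#3])
    (fun a => [:: a#0; a#1; a#2; a#5; a#4; a#3]) (@id2 k) (@id2 k);
    rewrite /skew /swap /=; ring.
have [h24|h] := eqVneq (p#2#4) 0; last exact: pencil1_p23 (sw34 _ H).
have [h25|h] := eqVneq (p#2#5) 0; last exact: pencil1_p23 (sw35 _ H).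
have [h34|h] := eqVneq (p#3#4) 0; last first.
  by apply: pencil1_p23 (sw24 _ H); rewrite /skew /= oppr_eq0.
have [h35|h] := eqVneq (p#3#5) 0; last first.
  by apply: pencil1_p23 (sw25 _ H); rewrite /skew /= oppr_eq0.
have [h45|h] := eqVneq (p#4#5) 0; last first.
  by apply: pencil1_p23 (sw35 _ (sw24 _ H)).
apply: (@pencil1_cross (p#0#2) (p#0#3) (p#0#4) (p#0#5) (p#1#2) (p#1#3) (p#1#4) (p#1#5)).
by chg H (@id6 k) (@id6 k) (fun a => [:: a#0; a#1 - p#0#1 * a#0])
  (fun a => [:: a#0; a#1 + p#0#1 * a#0]); rewrite h23 h24 h25 h34 h35 h45; ring.
Qed.
End Pencils1.

(** * Pencils on k^6 containing a form of rank 4 *)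

Section Pencils2.
Variables (k : closedFieldType) (g : lieAlgType k).
Hypothesis indep : forall W, admits g 6 W -> size W = 2%N ->
  forall q0 q1, (forall a b, q0 * nth (@form0 k) W 0 a b + q1 * nth (@form0 k) W 1 a b = 0) ->
  (q0 == 0) && (q1 == 0).

Definition bool01 (l : k) := (l == 0) || (l == 1).

Lemma eta_01 l h01 : bool01 l -> admits g 6 [:: sp4; eta6 l h01 0 0 0 0 0] -> std g 6 T62.
Proof.
case/orP=> /eqP -> H; have [h|h] := eqVneq h01 0.
- rewrite h in H; suff : ((0 : k) == 0) && ((1 : k) == 0) by rewrite oner_eq0 andbF.
  by apply: (indep H) => // a b; rewrite /= /sp4 /eta6; ring.
- by fin [:: [:: (0,1)]; [:: (2,3)]]%N H (@id6 k) (@id6 k)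
    (fun a => [:: a#1 / h01; a#0 - a#1 / h01])
    (fun a => [:: a#1 + a#0; h01 * a#0]).
- rewrite h in H.
  by fin [:: [:: (0,1)]; [:: (2,3); (4,5)]]%N H
    (fun a => [:: a#4; a#5; a#2; a#3; a#0; a#1])
    (fun a => [:: a#4; a#5; a#2; a#3; a#0; a#1]) (@sw2 k) (@sw2 k).
by fin [:: [:: (0,1); (2,3)]; [:: (4,5); (0,1)]]%N H
    (fun a => [:: a#0; a#1; a#2; a#3; a#4 / h01; a#5])
    (fun a => [:: a#0; a#1; a#2; a#3; h01 * a#4; a#5])
    (fun a => [:: a#0; a#1 / h01]) (fun a => [:: a#0; h01 * a#1]).
Qed.

(** The part on [e_0, ..., e_3] is decomposable, its Pfaffian being zero, and [h01 + h23] is its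
    product with [sp4]. If this is nonzero, that part is moved by a symplectic change to a multiple
    of [e_0 ^ e_1]; otherwise its plane is isotropic and it is moved to [e_0 ^ e_2]. *)
Lemma eta_h02 l h01 h02 h03 h12 h13 h23 : bool01 l -> h02 != 0 ->
  h01 * h23 - h02 * h13 + h03 * h12 = 0 ->
  admits g 6 [:: sp4; eta6 l h01 h02 h03 h12 h13 h23] -> std g 6 T62.
Proof.
move=> hl h hp H.
have e13 : h13 = (h01 * h23 + h03 * h12) / h02.
  apply: (mulfI h); apply/eqP; rewrite -subr_eq0 -oppr_eq0 -hp; apply/eqP; field; exact: h.
rewrite e13 {e13 hp} in H; have [t0|t0] := eqVneq (h01 + h23) 0; last first.
  pose t := h01 + h23.
  apply: (@eta_01 l t hl).
  rewrite /t; by chg H (fun a => [:: (a#0 + h12 / h02 * a#1 - h23 / h02 * a#3) / (h01 + h23);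
      h02 * a#2 + h01 * a#1 + h03 * a#3;
      - (h01 + h23) / h02 * (a#1 - (h02 * a#2 + h01 * a#1 + h03 * a#3) / (h01 + h23));
      a#3 + h02 / (h01 + h23) * (a#0 + h12 / h02 * a#1 - h23 / h02 * a#3); a#4; a#5])
   (fun a => let x1 := a#1 / (h01 + h23) - h02 / (h01 + h23) * a#2 in
      let x3 := a#3 - h02 * a#0 in
      [:: (h01 + h23) * a#0 - h12 / h02 * x1 + h23 / h02 * x3; x1;
          (a#1 - h01 * x1 - h03 * x3) / h02; x3; a#4; a#5]) (@id2 k) (@id2 k).
have e01 : h01 = - h23 by apply/eqP; rewrite -addr_eq0 t0.
rewrite e01 {t0 e01} in H.
have {}H : admits g 6 [:: sp4; eta6 l 0 1 0 0 0 0].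
  by chg H (fun a => [:: a#0 + h12 / h02 * a#1 - h23 / h02 * a#3; a#1;
      h02 * a#2 - h23 * a#1 + h03 * a#3; a#3 / h02; a#4; a#5])
    (fun a => [:: a#0 - h12 / h02 * a#1 + h23 * a#3; a#1;
      (a#2 + h23 * a#1 - h03 * h02 * a#3) / h02; h02 * a#3; a#4; a#5]) (@id2 k) (@id2 k).
case/orP: hl H => /eqP -> H.
  by fin [:: [:: (0,1)]; [:: (0,2); (1,3)]]%N H
    (fun a => [:: a#0; a#2; a#1; a#3; a#4; a#5])
    (fun a => [:: a#0; a#2; a#1; a#3; a#4; a#5]) (@sw2 k) (@sw2 k).
by fin [:: [:: (0,1); (2,3)]; [:: (4,5); (0,2)]]%N H (@id6 k) (@id6 k) (@id2 k) (@id2 k).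
Qed.

(* Symplectic rotations bring a non-zero cross coefficient to position (0, 2). *)
Lemma eta_std l h01 h02 h03 h12 h13 h23 : bool01 l ->
  admits g 6 [:: sp4; eta6 l h01 h02 h03 h12 h13 h23] -> std g 6 T62.
Proof.
move=> hl H.
(* Subtracting [s] times [sp4] makes the part on [e_0, ..., e_3] decomposable. *)
have [s hs] := @quad_root k 1 (- (h01 + h23)) (h01 * h23 - h02 * h13 + h03 * h12) (oner_neq0 _).
have {}H : admits g 6 [:: sp4; eta6 l (h01 - s) h02 h03 h12 h13 (h23 - s)].
  by chg H (@id6 k) (@id6 k) (fun a => [:: a#0; a#1 - s * a#0])
    (fun a => [:: a#0; a#1 + s * a#0]).
have {hs} : (h01 - s) * (h23 - s) - h02 * h13 + h03 * h12 = 0 by rewrite -hs; ring.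
move: (h01 - s) (h23 - s) H => {h01 h23} h01 h23 H hp.
have [h02z|h] := eqVneq h02 0; last exact: eta_h02 hl h hp H.
have [h03z|h] := eqVneq h03 0; last first.
  apply: (eta_h02 (h01 := h01) (h02 := h03) (h03 := - h02) (h12 := h13) (h13 := - h12) (h23 := h23) hl h).
    by rewrite -[RHS]hp; ring.
  by chg H (fun a => [:: a#0; a#1; a#3; - a#2; a#4; a#5])
    (fun a => [:: a#0; a#1; - a#3; a#2; a#4; a#5]) (@id2 k) (@id2 k).
have [h12z|h] := eqVneq h12 0; last first.
  apply: (eta_h02 (h01 := h01) (h02 := h12) (h03 := h13) (h12 := - h02) (h13 := - h03) (h23 := h23) hl h).
    by rewrite -[RHS]hp; ring.
  by chg H (fun a => [:: a#1; - a#0; a#2; a#3; a#4; a#5])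
    (fun a => [:: - a#1; a#0; a#2; a#3; a#4; a#5]) (@id2 k) (@id2 k).
have [h13z|h] := eqVneq h13 0; last first.
  apply: (eta_h02 (h01 := h01) (h02 := h13) (h03 := - h12) (h12 := - h03) (h13 := h02) (h23 := h23) hl h).
    by rewrite -[RHS]hp; ring.
  by chg H (fun a => [:: a#1; - a#0; a#3; - a#2; a#4; a#5])
    (fun a => [:: - a#1; a#0; - a#3; a#2; a#4; a#5]) (@id2 k) (@id2 k).
rewrite h02z h03z h12z h13z in hp H.
have : h01 * h23 = 0 by rewrite -hp; ring.
move/eqP; rewrite mulf_eq0 => /orP[]/eqP h; rewrite h in H; last exact: eta_01 hl H.
apply: (@eta_01 l h23 hl).
by chg H (fun a => [:: a#2; a#3; a#0; a#1; a#4; a#5])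
    (fun a => [:: a#2; a#3; a#0; a#1; a#4; a#5]) (@id2 k) (@id2 k).
Qed.

Lemma pencil2_p45 (p : nat -> nat -> k) : p#4#5 != 0 ->
  admits g 6 [:: sp4; gen 6 p] -> std g 6 T62.
Proof.
move=> h H; pose r i j := p i j - (p i 4 * p j 5 - p i 5 * p j 4) / p#4#5.
apply: (@eta_std 1 (r#0#1) (r#0#2) (r#0#3) (r#1#2) (r#1#3) (r#2#3)); first by rewrite /bool01 eqxx orbT.
rewrite /r; by chg H (fun a => [:: a#0; a#1; a#2; a#3;
    a#4 + (p#0#5 * a#0 + p#1#5 * a#1 + p#2#5 * a#2 + p#3#5 * a#3) / p#4#5;
    p#4#5 * a#5 - p#0#4 * a#0 - p#1#4 * a#1 - p#2#4 * a#2 - p#3#4 * a#3])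
  (fun a => [:: a#0; a#1; a#2; a#3;
    a#4 - (p#0#5 * a#0 + p#1#5 * a#1 + p#2#5 * a#2 + p#3#5 * a#3) / p#4#5;
    (a#5 + p#0#4 * a#0 + p#1#4 * a#1 + p#2#4 * a#2 + p#3#4 * a#3) / p#4#5])
  (@id2 k) (@id2 k).
Qed.

Lemma arm_b1 b1 b2 b3 h12 h13 h23 : b1 != 0 ->
  admits g 6 [:: sp4; arm 1 0 0 0 0 b1 b2 b3 0 0 0 h12 h13 h23] -> std g 6 T62.
Proof.
move=> h H.
by fin [:: [:: (0,1); (2,3)]; [:: (4,5); (0,2)]]%N H
  (fun a => [:: a#0 / b1; b1 * (a#4 - (h23 + (b3 * h12 - b2 * h13) / b1) * a#1);
     b1 * a#1 + b2 * a#2 + b3 * a#3; a#5 + (h12 * a#2 + h13 * a#3) / b1;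
     a#2 - b3 / b1 * a#0; a#3 + b2 / b1 * a#0])
  (fun a => let x1 := (a#2 - b2 * a#4 - b3 * a#5) / b1 in
     let x2 := a#4 + b3 * a#0 in let x3 := a#5 - b2 * a#0 in
     [:: b1 * a#0; x1; x2; x3; a#1 / b1 + (h23 + (b3 * h12 - b2 * h13) / b1) * x1;
         a#3 - (h12 * x2 + h13 * x3) / b1])
  (fun a => [:: a#1 - (h23 + (b3 * h12 - b2 * h13) / b1) * a#0; a#0])
  (fun a => [:: a#1; a#0 + (h23 + (b3 * h12 - b2 * h13) / b1) * a#1]).
Qed.

Lemma arm_e2 h12 h13 h23 :
  admits g 6 [:: sp4; arm 1 0 0 0 0 0 1 0 0 0 0 h12 h13 h23] -> std g 6 T62.
Proof.
move=> H; have [h|h] := eqVneq h13 0.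
  rewrite h in H; by fin [:: [:: (0,1); (2,3)]; [:: (0,4); (2,5)]]%N H
    (fun a => [:: a#0; a#1; a#2; a#3; a#4; a#5 - h12 * a#1 + h23 * a#3])
    (fun a => [:: a#0; a#1; a#2; a#3; a#4; a#5 + h12 * a#1 - h23 * a#3])
    (@id2 k) (@id2 k).
by fin [:: [:: (0,1); (2,3)]; [:: (0,4); (2,5); (1,3)]]%N H
    (fun a => [:: a#0 / h13; h13 * a#1; a#2; a#3; h13 * a#4; a#5 - h12 * a#1 + h23 * a#3])
    (fun a => [:: h13 * a#0; a#1 / h13; a#2; a#3; a#4 / h13; a#5 + h12 * (a#1 / h13) - h23 * a#3])
    (@id2 k) (@id2 k).
Qed.

Lemma arm_b23 b2 b3 h12 h13 h23 : (b2 != 0) || (b3 != 0) ->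
  admits g 6 [:: sp4; arm 1 0 0 0 0 0 b2 b3 0 0 0 h12 h13 h23] -> std g 6 T62.
Proof.
have [b20|b20] := eqVneq b2 0 => /= [b30|_] H.
  rewrite b20 in H; apply: (@arm_e2 (h13 / b3) (- h12 * b3) h23).
  by chg H (fun a => [:: a#0; a#1; b3 * a#3; - a#2 / b3; a#4; a#5])
    (fun a => [:: a#0; a#1; - b3 * a#3; a#2 / b3; a#4; a#5]) (@id2 k) (@id2 k).
apply: (@arm_e2 (h12 / b2) (b2 * h13 - b3 * h12) h23).
by chg H (fun a => [:: a#0; a#1; b2 * a#2 + b3 * a#3; a#3 / b2; a#4; a#5])
    (fun a => [:: a#0; a#1; a#2 / b2 - b3 * a#3; b2 * a#3; a#4; a#5]) (@id2 k) (@id2 k).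
Qed.

Lemma arm_h12 h23 :
  admits g 6 [:: sp4; arm 1 0 0 0 0 0 0 0 0 0 0 1 0 h23] -> std g 6 T62.
Proof.
move=> H.
by fin [:: [:: (0,1); (2,3)]; [:: (0,4); (1,2)]]%N H
  (fun a => [:: a#0; a#1 - h23 * a#3; a#2 + h23 * a#0; a#3; a#4 + h23 * (a#1 - h23 * a#3); a#5])
  (fun a => [:: a#0; a#1 + h23 * a#3; a#2 - h23 * a#0; a#3; a#4 - h23 * a#1; a#5])
  (@id2 k) (@id2 k).
Qed.

Lemma arm_b0 h12 h13 h23 :
  admits g 6 [:: sp4; arm 1 0 0 0 0 0 0 0 0 0 0 h12 h13 h23] -> std g 6 T62.
Proof.
have [h0|h] := eqVneq h12 0 => H; last first.
  apply: (@arm_h12 h23).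
  by chg H (fun a => [:: a#0; a#1; h12 * a#2 + h13 * a#3; a#3 / h12; a#4; a#5])
    (fun a => [:: a#0; a#1; a#2 / h12 - h13 * a#3; h12 * a#3; a#4; a#5]) (@id2 k) (@id2 k).
rewrite h0 in H; have [h1|h] := eqVneq h13 0; last first.
  apply: (@arm_h12 h23).
  by chg H (fun a => [:: a#0; a#1; h13 * a#3; - a#2 / h13; a#4; a#5])
    (fun a => [:: a#0; a#1; - h13 * a#3; a#2 / h13; a#4; a#5]) (@id2 k) (@id2 k).
rewrite h1 in H.
by fin [:: [:: (0,1)]; [:: (2,3); (0,4)]]%N H
  (fun a => [:: a#0; a#4 - h23 * a#1; a#2; a#3; a#1; a#5])
  (fun a => [:: a#0; a#4; a#2; a#3; a#1 + h23 * a#4; a#5])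
  (fun a => [:: a#1 - h23 * a#0; a#0]) (fun a => [:: a#1; a#0 + h23 * a#1]).
Qed.

(** A symplectic change of [e_0, ..., e_3] turns the covector [a] into [e_0], and [e_4] absorbs the
    other terms in [e_0]. Then [c1], the symplectic product of [a] and [b], separates the cases:
    [arm_b1] if it is nonzero, [arm_b23] if it is zero and [b] is independent of [a], [arm_b0] if
    [b] is a multiple of [a]. *)
Lemma arm_a0 a0 a1 a2 a3 b0 b1 b2 b3 h01 h02 h03 h12 h13 h23 : a0 != 0 ->
  admits g 6 [:: sp4; arm a0 a1 a2 a3 b0 b1 b2 b3 h01 h02 h03 h12 h13 h23] -> std g 6 T62.
Proof.
move=> h H.
have [c1 [c2 [c3 [l12 [l13 [l23 {}H]]]]]] : exists c1 c2 c3 l12 l13 l23,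
    admits g 6 [:: sp4; arm 1 0 0 0 0 c1 c2 c3 0 0 0 l12 l13 l23].
  (* The vectors dual to the new 1-forms; [L] collects the values on them of the form on
     [e_0, ..., e_3]. *)
  pose M j := nth 0 (nth [::] [:: [:: 1 / a0; 0; 0; 0]; [:: - a1; a0; - a3; a2];
     [:: - a2 / a0; 0; 1; 0]; [:: - a3 / a0; 0; 0; 1]] j).
  pose L i j := eta6 0 h01 h02 h03 h12 h13 h23 (M i) (M j).
  exists (a0 * b1 - a1 * b0 - b2 * a3 + b3 * a2), (b2 - b0 * a2 / a0), (b3 - b0 * a3 / a0),
    (L#1#2), (L#1#3), (L#2#3).
  rewrite /L /M /eta6 /E /=; chg H
    (fun a => [:: a0 * a#0 + a1 * a#1 + a2 * a#2 + a3 * a#3; a#1 / a0;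
      a#2 + a3 / a0 * a#1; a#3 - a2 / a0 * a#1;
      a#4 + b0 / a0 * a#5 + L#0#1 * (a#1 / a0) + L#0#2 * (a#2 + a3 / a0 * a#1) + L#0#3 * (a#3 - a2 / a0 * a#1); a#5])
    (fun a => [:: (a#0 - a0 * a1 * a#1 - a2 * a#2 - a3 * a#3) / a0; a0 * a#1;
      a#2 - a3 * a#1; a#3 + a2 * a#1;
      a#4 - b0 / a0 * a#5 - L#0#1 * a#1 - L#0#2 * a#2 - L#0#3 * a#3; a#5])
    (@id2 k) (@id2 k).
  rewrite /L /M /eta6 /E /=; fld.
have [c10|c10] := eqVneq c1 0; last exact: arm_b1 c10 H.
rewrite c10 in H; have [hc|] := boolP ((c2 != 0) || (c3 != 0)); first exact: arm_b23 hc H.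
rewrite negb_or !negbK => /andP[/eqP c20 /eqP c30]; rewrite c20 c30 in H.
exact: arm_b0 H.
Qed.

Lemma arm_a a0 a1 a2 a3 b0 b1 b2 b3 h01 h02 h03 h12 h13 h23 :
  ~~ [&& a0 == 0, a1 == 0, a2 == 0 & a3 == 0] ->
  admits g 6 [:: sp4; arm a0 a1 a2 a3 b0 b1 b2 b3 h01 h02 h03 h12 h13 h23] -> std g 6 T62.
Proof.
have rot c0 c1 c2 c3 d0 d1 d2 d3 l01 l02 l03 l12 l13 l23 : c1 != 0 ->
    admits g 6 [:: sp4; arm c0 c1 c2 c3 d0 d1 d2 d3 l01 l02 l03 l12 l13 l23] -> std g 6 T62.
  move=> h H; apply: (@arm_a0 c1 (- c0) c2 c3 d1 (- d0) d2 d3 l01 l12 l13 (- l02) (- l03) l23 h).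
  by chg H (fun a => [:: a#1; - a#0; a#2; a#3; a#4; a#5])
    (fun a => [:: - a#1; a#0; a#2; a#3; a#4; a#5]) (@id2 k) (@id2 k).
rewrite !negb_and => /or4P[] h H; [exact: arm_a0 h H|exact: rot h H| |].
- apply: (@arm_a0 a2 a3 a0 a1 b2 b3 b0 b1 h23 (- h02) (- h12) (- h03) (- h13) h01 h).
  by chg H (fun a => [:: a#2; a#3; a#0; a#1; a#4; a#5])
    (fun a => [:: a#2; a#3; a#0; a#1; a#4; a#5]) (@id2 k) (@id2 k).
apply: (@rot a2 a3 a0 a1 b2 b3 b0 b1 h23 (- h02) (- h12) (- h03) (- h13) h01 h).
by chg H (fun a => [:: a#2; a#3; a#0; a#1; a#4; a#5])
  (fun a => [:: a#2; a#3; a#0; a#1; a#4; a#5]) (@id2 k) (@id2 k).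
Qed.

Lemma arm_std a0 a1 a2 a3 b0 b1 b2 b3 h01 h02 h03 h12 h13 h23 :
  admits g 6 [:: sp4; arm a0 a1 a2 a3 b0 b1 b2 b3 h01 h02 h03 h12 h13 h23] -> std g 6 T62.
Proof.
move=> H; have [/and4P[/eqP e0 /eqP e1 /eqP e2 /eqP e3]|h] :=
  boolP [&& a0 == 0, a1 == 0, a2 == 0 & a3 == 0]; last exact: arm_a h H.
have [/and4P[/eqP f0 /eqP f1 /eqP f2 /eqP f3]|h] :=
  boolP [&& b0 == 0, b1 == 0, b2 == 0 & b3 == 0]; last first.
  apply: (@arm_a b0 b1 b2 b3 a0 a1 a2 a3 h01 h02 h03 h12 h13 h23 h).
  by chg H (fun a => [:: a#0; a#1; a#2; a#3; a#5; a#4])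
    (fun a => [:: a#0; a#1; a#2; a#3; a#5; a#4]) (@id2 k) (@id2 k).
rewrite e0 e1 e2 e3 f0 f1 f2 f3 in H.
apply: (@eta_std 0 h01 h02 h03 h12 h13 h23); first by rewrite /bool01 eqxx.
by chg H (@id6 k) (@id6 k) (@id2 k) (@id2 k).
Qed.

Lemma pencil2_std (p : nat -> nat -> k) : admits g 6 [:: sp4; gen 6 p] -> std g 6 T62.
Proof.
move=> H; have [h|h] := eqVneq (p#4#5) 0; last exact: pencil2_p45 h H.
apply: (@arm_std (p#0#4) (p#1#4) (p#2#4) (p#3#4) (p#0#5) (p#1#5) (p#2#5) (p#3#5)
  (p#0#1) (p#0#2) (p#0#3) (p#1#2) (p#1#3) (p#2#3)).
by chg H (@id6 k) (@id6 k) (@id2 k) (@id2 k); rewrite h; ring.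
Qed.
End Pencils2.

Theorem std62 (k : closedFieldType) (g : lieAlgType k) : \dim {:g} = 8%N ->
  two_step_nilpotent g -> \dim (derived_algebra g) = 2%N -> std g 6 T62.
Proof.
move=> dg ts dD; have [p [H|H]] := pencil_lead dg ts dD.
  exact: (pencil1_std (indep62 dg dD) H).
exact: (pencil2_std (indep62 dg dD) H).
Qed.

(** * Derived algebra of dimension 1 or 4 *)

Definition T44 : seq (seq (seq (nat * nat))) := [::
  [:: [:: (0,1)]; [:: (2,3)]; [:: (0,2)]; [:: (1,3)]];
  [:: [:: (0,1)]; [:: (2,3)]; [:: (0,2)]; [:: (0,3); (1,2)]];
  [:: [:: (0,1)]; [:: (2,3)]; [:: (0,2)]; [:: (0,3)]]]%N.

Definition T71 : seq (seq (seq (nat * nat))) := [::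
  [:: [:: (0,1)]]; [:: [:: (0,1); (2,3)]]; [:: [:: (0,1); (2,3); (4,5)]]]%N.

Definition id4 (k : fieldType) (a : nat -> k) := [:: a#0; a#1; a#2; a#3].

Theorem std71 (k : closedFieldType) (g : lieAlgType k) : \dim {:g} = 8%N ->
  two_step_nilpotent g -> \dim (derived_algebra g) = 1%N -> std g 7 T71.
Proof.
move=> dg ts dD; have e71 : (7 + 1 = 8)%N by [].
have [x [z [cxz z0]]] := coframe_exists dg dD e71.
have [X [r [r0 r7 cX hX]]] := @darboux_comb k g 7 0 dg ts dD e71 x z (fun=> 1) 0 cxz isT (oner_neq0 k).
exists (nth [::] T71 r.-1); first by case: r r0 r7 {hX} => [//|[|[|[|r]]]].
exists X, z; split; first by case: r r0 r7 {hX} => [//|[|[|[|r]]]].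
move=> [|c] u v; last first.
  by rewrite z0 // nth_default //; case: r r0 r7 {hX} => [//|[|[|[|r]]]].
have := hX u v; rewrite /comb big_ord1 mul1r => ->.
by case: r r0 r7 {hX} => [//|[|[|[|r]]]] // _ _; rewrite !big_ord_recr big_ord0 /form_of /=; ring.
Qed.

(** * Spaces of four forms on k^4 *)

Section Dim44.
Variables (k : closedFieldType) (g : lieAlgType k).
Hypotheses (two_neq0 : (2 : k) != 0) (dg : \dim {:g} = 8%N) (ts : two_step_nilpotent g).
Hypothesis dD : \dim (derived_algebra g) = 4%N.
Let e44 : (4 + 4 = 8)%N := erefl.

Lemma indep44 W : admits g 4 W -> size W = 4%N ->
  forall q : seq k, (forall a b, q`_0 * nth (@form0 k) W 0 a b + q`_1 * nth (@form0 k) W 1 a b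
    + q`_2 * nth (@form0 k) W 2 a b + q`_3 * nth (@form0 k) W 3 a b = 0) ->
  [&& q`_0 == 0, q`_1 == 0, q`_2 == 0 & q`_3 == 0].
Proof.
move=> H sz q hq.
have h := admits_indep dg dD e44 (q := nth 0 q) H sz.
have {}h c : (c < 4)%N -> nth 0 q c = 0.
  by apply: h => a b; rewrite !big_ord_recr big_ord0 /= add0r hq.
by rewrite (h 0%N isT) (h 1%N isT) (h 2%N isT) (h 3%N isT) eqxx.
Qed.

(** If the first form has rank 4, the Pfaffian of the second form plus [s] times the first is
    quadratic in [s], and a root yields a form of rank 2. *)
Lemma lead44 : exists p q r, admits g 4 [:: E 0 1; gen 4 p; gen 4 q; gen 4 r].
Proof.
have [x [z [cxz _]]] := coframe_exists dg dD e44.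
have dl X (cX : coframe 4 4 X z) j := coframe_surj dg e44 cX (fun i => (i == j)%:R) (fun=> 0).
have fin1 X q c : coframe 4 4 X z -> (c < 4)%N -> q c != 0 ->
    (forall u v, comb 3 z q u v = E 0 1 (X^~ u) (X^~ v)) ->
    exists p q r, admits g 4 [:: E 0 1; gen 4 p; gen 4 q; gen 4 r].
  move=> cX hc qc hX; have [p H] := admits_lead dg ts dD e44 (F := E 0 1) cX hc qc hX.
  by exists (p 1%N), (p 2), (p 3).
pose q (c : nat) := (c == 0%N)%:R : k.
have [X [r [r0 r4 cX hX]]] := darboux_comb dg ts dD e44 (q := q) cxz (isT : (0 < 4)%N) (oner_neq0 k).
case: r r0 r4 hX => [//|[|[|r]]] // _ _ hX.
  by apply: (fin1 X q 0%N cX) => //; [apply: oner_neq0|move=> u v; rewrite hX big_ord1].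
have {}hX u v : comb 3 z q u v = E 0 1 (X^~ u) (X^~ v) + E 2 3 (X^~ u) (X^~ v).
  by rewrite hX !big_ord_recr big_ord0 /= add0r.
have [p hp] := coframe_gen dg ts dD e44 cX; pose P := p 1%N.
have [s hs] := @quad_root k 1 (P#0#1 + P#2#3) (P#0#1 * P#2#3 - P#0#2 * P#1#3 + P#0#3 * P#1#2) (oner_neq0 _).
pose q2 (c : nat) := (c == 1%N)%:R + s * q c.
have hq2 u v : comb 3 z q2 u v = gen 4 P (X^~ u) (X^~ v) +
    s * (E 0 1 (X^~ u) (X^~ v) + E 2 3 (X^~ u) (X^~ v)).
  by rewrite -hX -hp /comb !big_ord_recr !big_ord0 /= /q2 /q /=; ring.
have q21 : q2 1%N != 0 by rewrite /q2 /q /= mulr0 addr0 oner_neq0.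
have hw : wedge0 (comb 3 z q2) (comb 3 z q2).
  move=> v0 v1 v2 v3; rewrite /wedge !hq2 !gen4E.
  transitivity (2 * (1 * s ^+ 2 + (P#0#1 + P#2#3) * s + (P#0#1 * P#2#3 - P#0#2 * P#1#3 + P#0#3 * P#1#2))
    * wedge (E 0 1) (E 2 3) (X^~ v0) (X^~ v1) (X^~ v2) (X^~ v3)); last by rewrite hs mulr0 mul0r.
  by rewrite /wedge /E; ring.
have [Y [r [r0 r4 cY hY]]] := darboux_comb dg ts dD e44 cX (isT : (1 < 4)%N) q21.
case: r r0 r4 hY => [//|[|[|r]]] // _ _ hY.
  by apply: (fin1 Y q2 1%N cY) => // u v; rewrite hY big_ord1.
have [u0 [h0 _]] := dl Y cY 0%N; have [u1 [h1 _]] := dl Y cY 1%N.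
have [u2 [h2 _]] := dl Y cY 2; have [u3 [h3 _]] := dl Y cY 3.
have := hw u0 u1 u2 u3; rewrite /wedge !hY !big_ord_recr !big_ord0 /= /E ?h0 ?h1 ?h2 ?h3 //= => /eqP.
by rewrite !(mulr0, mul0r, mulr1, subr0, sub0r, addr0, add0r, oppr0) (negbTE two_neq0).
Qed.

Lemma cr23_e02 n03 n12 n13 :
  admits g 4 [:: E 0 1; E 2 3; E 0 2; cross4 0 n03 n12 n13] -> std g 4 T44.
Proof.
move=> H; have [n130|n130] := eqVneq n13 0; last first.
  by fin [:: [:: (0,1)]; [:: (2,3)]; [:: (0,2)]; [:: (1,3)]]%N H
    (fun a => [:: a#0; a#1 + n03 / n13 * a#0; a#2; n13 * a#3 + n12 * a#2])
    (fun a => [:: a#0; a#1 - n03 / n13 * a#0; a#2; (a#3 - n12 * a#2) / n13])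
    (fun a => [:: a#0; n13 * a#1; a#2; a#3 + n03 * n12 / n13 * a#2])
    (fun a => [:: a#0; a#1 / n13; a#2; a#3 - n03 * n12 / n13 * a#2]).
rewrite n130 in H; have [n030|n030] := eqVneq n03 0; have [n120|n120] := eqVneq n12 0.
- rewrite n030 n120 in H.
  suff : [&& (0 : k) == 0, (0 : k) == 0, (0 : k) == 0 & (1 : k) == 0] by rewrite oner_eq0 !andbF.
  by apply: (indep44 H erefl (q := [:: 0; 0; 0; 1])) => // a b; rewrite /= /cross4; ring.
- rewrite n030 in H.
  by fin [:: [:: (0,1)]; [:: (2,3)]; [:: (0,2)]; [:: (0,3)]]%N H
    (fun a => [:: a#2; a#3; a#0; a#1]) (fun a => [:: a#2; a#3; a#0; a#1])
    (fun a => [:: a#1; a#0; - a#2; - a#3 / n12])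
    (fun a => [:: a#1; a#0; - a#2; - n12 * a#3]).
- rewrite n120 in H.
  by fin [:: [:: (0,1)]; [:: (2,3)]; [:: (0,2)]; [:: (0,3)]]%N H (@id4 k) (@id4 k)
    (fun a => [:: a#0; a#1; a#2; a#3 / n03])
    (fun a => [:: a#0; a#1; a#2; n03 * a#3]).
by fin [:: [:: (0,1)]; [:: (2,3)]; [:: (0,2)]; [:: (0,3); (1,2)]]%N H
    (fun a => [:: a#0; n12 * a#1; a#2; n03 * a#3])
    (fun a => [:: a#0; a#1 / n12; a#2; a#3 / n03])
    (fun a => [:: n12 * a#0; n03 * a#1; a#2; a#3])
    (fun a => [:: a#0 / n12; a#1 / n03; a#2; a#3]).
Qed.

Lemma cr_e02_13 n03 n12 :
  admits g 4 [:: E 0 1; E 0 2; E 1 3; cross4 0 n03 n12 0] -> std g 4 T44.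
Proof.
move=> H; have [n030|n030] := eqVneq n03 0; have [n120|n120] := eqVneq n12 0.
- rewrite n030 n120 in H.
  suff : [&& (0 : k) == 0, (0 : k) == 0, (0 : k) == 0 & (1 : k) == 0] by rewrite oner_eq0 !andbF.
  by apply: (indep44 H erefl (q := [:: 0; 0; 0; 1])) => // a b; rewrite /= /cross4; ring.
- rewrite n030 in H.
  by fin [:: [:: (0,1)]; [:: (2,3)]; [:: (0,2)]; [:: (0,3)]]%N H
    (fun a => [:: a#1; a#3; a#0; a#2]) (fun a => [:: a#2; a#0; a#3; a#1])
    (fun a => [:: a#2; a#1; - a#0; a#3 / n12])
    (fun a => [:: - a#2; a#1; a#0; n12 * a#3]).
- rewrite n120 in H.
  by fin [:: [:: (0,1)]; [:: (2,3)]; [:: (0,2)]; [:: (0,3)]]%N H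
    (fun a => [:: a#0; a#2; a#1; a#3]) (fun a => [:: a#0; a#2; a#1; a#3])
    (fun a => [:: a#1; a#2; a#0; a#3 / n03])
    (fun a => [:: a#2; a#0; a#1; n03 * a#3]).
by fin [:: [:: (0,1)]; [:: (2,3)]; [:: (0,2)]; [:: (0,3); (1,2)]]%N H
    (fun a => [:: a#0; a#2; a#1; - n03 / n12 * a#3])
    (fun a => [:: a#0; a#2; a#1; - n12 / n03 * a#3])
    (fun a => [:: a#1; - n03 / n12 * a#2; a#0; - a#3 / n12])
    (fun a => [:: a#2; a#0; - n12 / n03 * a#1; - n12 * a#3]).
Qed.

Lemma cr_e02_n13 n03 n12 n13 m03 m12 m13 : n13 != 0 ->
  admits g 4 [:: E 0 1; E 0 2; cross4 0 n03 n12 n13; cross4 0 m03 m12 m13] -> std g 4 T44.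
Proof.
move=> h H; apply: (@cr_e02_13 ((m03 - m13 / n13 * n03) / n13) (m12 - m13 / n13 * n12)).
by chg H (fun a => [:: a#0; a#1 + n03 / n13 * a#0; a#2; n13 * a#3 + n12 * a#2])
    (fun a => [:: a#0; a#1 - n03 / n13 * a#0; a#2; (a#3 - n12 * a#2) / n13])
    (fun a => [:: a#0; a#1; a#2 + n03 * n12 / n13 * a#1;
       a#3 - m13 / n13 * a#2 + ((m03 - m13 / n13 * n03) * n12 / n13 + (m12 - m13 / n13 * n12) * n03 / n13) * a#1])
    (fun a => [:: a#0; a#1; a#2 - n03 * n12 / n13 * a#1;
       a#3 + m13 / n13 * (a#2 - n03 * n12 / n13 * a#1) - ((m03 - m13 / n13 * n03) * n12 / n13 + (m12 - m13 / n13 * n12) * n03 / n13) * a#1]).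
Qed.

Lemma cr_e02 n03 n12 n13 m03 m12 m13 :
  admits g 4 [:: E 0 1; E 0 2; cross4 0 n03 n12 n13; cross4 0 m03 m12 m13] -> std g 4 T44.
Proof.
move=> H; have [h|h] := eqVneq n13 0; last exact: cr_e02_n13 h H.
have [h'|h'] := eqVneq m13 0; last first.
  apply: (cr_e02_n13 (n03 := m03) (n12 := m12) (m03 := n03) (m12 := n12) (m13 := n13) h').
  by chg H (@id4 k) (@id4 k) (fun a => [:: a#0; a#1; a#3; a#2])
    (fun a => [:: a#0; a#1; a#3; a#2]).
rewrite h h' in H; have [d0|d0] := eqVneq (n03 * m12 - n12 * m03) 0.
  have [n030|n030] := eqVneq n03 0; last first.
    suff : [&& (0 : k) == 0, (0 : k) == 0, - m03 == 0 & n03 == 0] by rewrite (negbTE n030) !andbF.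
    apply: (indep44 H erefl (q := [:: 0; 0; - m03; n03])) => // a b; rewrite /= /cross4.
    transitivity ((n03 * m12 - n12 * m03) * E 1 2 a b); last by rewrite d0 mul0r.
    by ring.
  have [n120|n120] := eqVneq n12 0.
    rewrite n030 n120 in H.
    suff : [&& (0 : k) == 0, (0 : k) == 0, (1 : k) == 0 & (0 : k) == 0] by rewrite oner_eq0 !andbF.
    by apply: (indep44 H erefl (q := [:: 0; 0; 1; 0])) => // a b; rewrite /= /cross4; ring.
  suff : [&& (0 : k) == 0, (0 : k) == 0, m12 == 0 & - n12 == 0] by rewrite oppr_eq0 (negbTE n120) !andbF.
  apply: (indep44 H erefl (q := [:: 0; 0; m12; - n12])) => // a b; rewrite /= /cross4.
  transitivity ((n03 * m12 - n12 * m03) * E 0 3 a b); last by rewrite d0 mul0r.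
  by ring.
by fin [:: [:: (0,1)]; [:: (2,3)]; [:: (0,2)]; [:: (0,3)]]%N H
    (fun a => [:: a#0; a#3; a#1; a#2]) (fun a => [:: a#0; a#2; a#3; a#1])
    (fun a => [:: (m12 * a#2 - n12 * a#3) / (n03 * m12 - n12 * m03);
       (n03 * a#3 - m03 * a#2) / (n03 * m12 - n12 * m03); a#0; a#1])
    (fun a => [:: a#2; a#3; n03 * a#0 + n12 * a#1; m03 * a#0 + m12 * a#1]).
Qed.

(** Only the second form may keep a term [e_2 ^ e_3]; each of the last two is a 2 by 2 matrix whose
    determinant is, up to sign, the Pfaffian. *)
Definition pencil44 (l f02 f03 f12 f13 n02 n03 n12 n13 m02 m03 m12 m13 : k) : seq (form k) :=
  [:: E 0 1; fun a b => l * E 2 3 a b + cross4 f02 f03 f12 f13 a b;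
      cross4 n02 n03 n12 n13; cross4 m02 m03 m12 m13].

Lemma decomp_m02 l f02 f03 f12 f13 n02 n03 n12 n13 m02 m03 m12 m13 : m02 != 0 ->
  m02 * m13 - m03 * m12 = 0 ->
  admits g 4 (pencil44 l f02 f03 f12 f13 n02 n03 n12 n13 m02 m03 m12 m13) ->
  exists l' g02 g03 g12 g13 r02 r03 r12 r13, (l != 0 -> l' != 0) /\ (l = 0 -> l' = 0) /\
    admits g 4 (pencil44 l' g02 g03 g12 g13 r02 r03 r12 r13 1 0 0 0).
Proof.
move=> h hd H; have e : m13 = m03 * m12 / m02.
  by apply: (mulfI h); apply/eqP; rewrite -subr_eq0 -hd; apply/eqP; field.
rewrite e {e hd} in H; pose u := m03 / m02; pose v := m12 / m02.
exists (l / m02), (f02 / m02), (f03 - f02 * u), (f12 / m02 - v * (f02 / m02)),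
  (f13 - f12 * u - v * (f03 - f02 * u)), (n02 / m02), (n03 - n02 * u),
  (n12 / m02 - v * (n02 / m02)), (n13 - n12 * u - v * (n03 - n02 * u)).
split; first by move=> l0; rewrite mulf_neq0 ?invr_neq0.
split; first by move=> ->; rewrite mul0r.
rewrite /u /v; by chg H (fun a => [:: a#0 + m12 / m02 * a#1; a#1; m02 * a#2 + m03 * a#3; a#3])
  (fun a => [:: a#0 - m12 / m02 * a#1; a#1; (a#2 - m03 * a#3) / m02; a#3])
  (@id4 k) (@id4 k).
Qed.

Lemma decomp44 l f02 f03 f12 f13 n02 n03 n12 n13 m02 m03 m12 m13 :
  m02 * m13 - m03 * m12 = 0 ->
  admits g 4 (pencil44 l f02 f03 f12 f13 n02 n03 n12 n13 m02 m03 m12 m13) ->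
  exists l' g02 g03 g12 g13 r02 r03 r12 r13, (l != 0 -> l' != 0) /\ (l = 0 -> l' = 0) /\
    admits g 4 (pencil44 l' g02 g03 g12 g13 r02 r03 r12 r13 1 0 0 0).
Proof.
move=> hd H; have [h|h] := eqVneq m02 0; last exact: decomp_m02 h hd H.
have sl (l' : k) (P : k -> Prop) : (- l != 0 -> l' != 0) /\ (- l = 0 -> l' = 0) /\ P l' ->
   (l != 0 -> l' != 0) /\ (l = 0 -> l' = 0) /\ P l'.
  by rewrite oppr_eq0 => -[h1 [h2 h3]]; split=> //; split=> // l0; apply: h2; rewrite l0 oppr0.
have [h3|h3] := eqVneq m03 0; last first.
  have [||l' [g0 [g1 [g2 [g3 [r0 [r1 [r2 [r3]]]]]]]]] :=
    @decomp_m02 (- l) f03 f02 f13 f12 n03 n02 n13 n12 m03 m02 m13 m12 h3.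
  - by rewrite -[RHS]oppr0 -hd; ring.
  - by chg H (fun a => [:: a#0; a#1; a#3; a#2])
      (fun a => [:: a#0; a#1; a#3; a#2]) (@id4 k) (@id4 k).
  move=> /(sl l' (fun l' => admits g 4 (pencil44 l' g0 g1 g2 g3 r0 r1 r2 r3 1 0 0 0))) H'.
  by exists l', g0, g1, g2, g3, r0, r1, r2, r3.
have [h12|h12] := eqVneq m12 0; last first.
  apply: (@decomp_m02 l f12 f13 f02 f03 n12 n13 n02 n03 m12 m13 m02 m03 h12).
    by rewrite -[RHS]oppr0 -hd; ring.
  by chg H (fun a => [:: a#1; a#0; a#2; a#3])
      (fun a => [:: a#1; a#0; a#2; a#3])
      (fun a => [:: - a#0; a#1; a#2; a#3]) (fun a => [:: - a#0; a#1; a#2; a#3]).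
have [h13|h13] := eqVneq m13 0; last first.
  have [||l' [g0 [g1 [g2 [g3 [r0 [r1 [r2 [r3]]]]]]]]] :=
    @decomp_m02 (- l) f13 f12 f03 f02 n13 n12 n03 n02 m13 m12 m03 m02 h13.
  - by rewrite -[RHS]hd; ring.
  - by chg H (fun a => [:: a#1; a#0; a#3; a#2])
      (fun a => [:: a#1; a#0; a#3; a#2])
      (fun a => [:: - a#0; a#1; a#2; a#3]) (fun a => [:: - a#0; a#1; a#2; a#3]).
  move=> /(sl l' (fun l' => admits g 4 (pencil44 l' g0 g1 g2 g3 r0 r1 r2 r3 1 0 0 0))) H'.
  by exists l', g0, g1, g2, g3, r0, r1, r2, r3.
rewrite h h3 h12 h13 in H.
suff : [&& (0 : k) == 0, (0 : k) == 0, (0 : k) == 0 & (1 : k) == 0] by rewrite oner_eq0 !andbF.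
by apply: (indep44 H erefl (q := [:: 0; 0; 0; 1])) => // a b; rewrite /= /cross4; ring.
Qed.

(** The determinant is quadratic on the span of the last two forms, so one of their combinations is
    decomposable. Whether [l] is zero must be preserved, since the two cases have different normal
    forms. *)
Lemma singular44 l f02 f03 f12 f13 n02 n03 n12 n13 m02 m03 m12 m13 :
  admits g 4 (pencil44 l f02 f03 f12 f13 n02 n03 n12 n13 m02 m03 m12 m13) ->
  exists l' g02 g03 g12 g13 r02 r03 r12 r13, (l != 0 -> l' != 0) /\ (l = 0 -> l' = 0) /\
    admits g 4 (pencil44 l' g02 g03 g12 g13 r02 r03 r12 r13 1 0 0 0).
Proof.
move=> H; have [d0|d0] := eqVneq (n02 * n13 - n03 * n12) 0.
  apply: (decomp44 (f02 := f02) (f03 := f03) (f12 := f12) (f13 := f13)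
    (n02 := m02) (n03 := m03) (n12 := m12) (n13 := m13) d0).
  by chg H (@id4 k) (@id4 k) (fun a => [:: a#0; a#1; a#3; a#2])
    (fun a => [:: a#0; a#1; a#3; a#2]).
have [s hs] := quad_root (n02 * m13 + m02 * n13 - n03 * m12 - m03 * n12) (m02 * m13 - m03 * m12) d0.
apply: (@decomp44 l f02 f03 f12 f13 n02 n03 n12 n13 (m02 + s * n02) (m03 + s * n03)
  (m12 + s * n12) (m13 + s * n13)); first by rewrite -hs; ring.
by chg H (@id4 k) (@id4 k) (fun a => [:: a#0; a#1; a#2; a#3 + s * a#2])
  (fun a => [:: a#0; a#1; a#2; a#3 - s * a#2]).
Qed.

Lemma pencil44_std l f02 f03 f12 f13 n02 n03 n12 n13 m02 m03 m12 m13 :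
  admits g 4 (pencil44 l f02 f03 f12 f13 n02 n03 n12 n13 m02 m03 m12 m13) -> std g 4 T44.
Proof.
move=> /singular44 [l' [g0 [g1 [g2 [g3 [r0 [r1 [r2 [r3 [hl [hl0 H]]]]]]]]]]].
have [l0|l0] := eqVneq l 0.
  rewrite (hl0 l0) in H; apply: (@cr_e02 g1 g2 g3 r1 r2 r3).
  by chg H (@id4 k) (@id4 k)
    (fun a => [:: a#0; a#3; a#1 - g0 * a#3; a#2 - r0 * a#3])
    (fun a => [:: a#0; a#2 + g0 * a#1; a#3 + r0 * a#1; a#1]).
(* Since [l'] is nonzero, [e_2] and [e_3] absorb the cross terms of the second form, which becomes
   [e_2 ^ e_3]. *)
move: (hl l0) => {}hl; apply: (@cr23_e02 (r1 / l') r2 (r3 / l')).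
by chg H (fun a => [:: a#0; a#1; a#2 + g1 / l' * a#0 + g3 / l' * a#1;
      l' * a#3 - g0 * a#0 - g2 * a#1])
    (fun a => [:: a#0; a#1; a#2 - g1 / l' * a#0 - g3 / l' * a#1;
      (a#3 + g0 * a#0 + g2 * a#1) / l'])
    (fun a => [:: a#0; a#1 - (g1 * g2 - g3 * g0) / l' * a#0; a#3 + g3 / l' * a#0;
       a#2 - r0 * a#3 - (r1 * g2 + r2 * g1 - r3 * g0) / l' * a#0])
    (fun a => [:: a#0; a#1 + (g1 * g2 - g3 * g0) / l' * a#0;
       a#3 + r0 * (a#2 - g3 / l' * a#0) + (r1 * g2 + r2 * g1 - r3 * g0) / l' * a#0;
       a#2 - g3 / l' * a#0]).
Qed.

(** The first hypothesis makes [q_23] and [r_23] multiples of [p_23], so that subtracting multiples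
    of the second form clears them. *)
Lemma lead44_std (p q r : nat -> nat -> k) : p#2#3 != 0 \/ q#2#3 = 0 /\ r#2#3 = 0 ->
  admits g 4 [:: E 0 1; gen 4 p; gen 4 q; gen 4 r] -> std g 4 T44.
Proof.
move=> hp H.
have [a [b [ha hb]]] : exists a b, q#2#3 = a * p#2#3 /\ r#2#3 = b * p#2#3.
  case: hp => [h|[-> ->]]; last by exists 0, 0; rewrite mul0r.
  by exists (q#2#3 / p#2#3), (r#2#3 / p#2#3); rewrite !divfK.
apply: (@pencil44_std (p#2#3) (p#0#2) (p#0#3) (p#1#2) (p#1#3)
  (q#0#2 - a * p#0#2) (q#0#3 - a * p#0#3) (q#1#2 - a * p#1#2) (q#1#3 - a * p#1#3)
  (r#0#2 - b * p#0#2) (r#0#3 - b * p#0#3) (r#1#2 - b * p#1#2) (r#1#3 - b * p#1#3)).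
by chg H (@id4 k) (@id4 k)
  (fun f => [:: f#0; f#1 - p#0#1 * f#0; f#2 - a * f#1 - (q#0#1 - a * p#0#1) * f#0;
    f#3 - b * f#1 - (r#0#1 - b * p#0#1) * f#0])
  (fun f => [:: f#0; f#1 + p#0#1 * f#0;
    f#2 + a * (f#1 + p#0#1 * f#0) + (q#0#1 - a * p#0#1) * f#0;
    f#3 + b * (f#1 + p#0#1 * f#0) + (r#0#1 - b * p#0#1) * f#0]);
  rewrite ?ha ?hb; ring.
Qed.

Theorem std44 : std g 4 T44.
Proof.
have [p [q [r H]]] := lead44.
have [hq|hq] := eqVneq (q#2#3) 0; last first.
  apply: (lead44_std (p := q) (q := p) (r := r)); first by left.
  by chg H (@id4 k) (@id4 k) (fun a => [:: a#0; a#2; a#1; a#3])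
    (fun a => [:: a#0; a#2; a#1; a#3]).
have [hr|hr] := eqVneq (r#2#3) 0; first by apply: lead44_std H; right.
apply: (lead44_std (p := r) (q := q) (r := p)); first by left.
by chg H (@id4 k) (@id4 k) (fun a => [:: a#0; a#3; a#2; a#1])
    (fun a => [:: a#0; a#3; a#2; a#1]).
Qed.
End Dim44.

(** * Invariants *)

Section Isomorphism.
Variable k : fieldType.

Lemma lie_iso_sym (g h : lieAlgType k) : lie_isomorphic g h -> lie_isomorphic h g.
Proof.
move=> [f [[f' fK f'K] hf]].
have lf' : linear f' by move=> c u v; apply: (can_inj fK); rewrite f'K linearP !f'K.
pose F : {linear h -> g} := HB.pack f' (GRing.isLinear.Build _ _ _ _ f' lf').
exists F; split; first by exists f.
by move=> u v /=; apply: (can_inj fK); rewrite f'K hf !f'K.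
Qed.

Lemma lie_iso_dims (g h : lieAlgType k) : lie_isomorphic g h ->
  \dim (derived_algebra g) = \dim (derived_algebra h) /\
  \dim (lie_center g) = \dim (lie_center h).
Proof.
suff H (g1 h1 : lieAlgType k) : lie_isomorphic g1 h1 ->
    (\dim (derived_algebra h1) <= \dim (derived_algebra g1))%N /\
    (\dim (lie_center h1) <= \dim (lie_center g1))%N.
  move=> iso; have [a b] := H _ _ iso; have [c d] := H _ _ (lie_iso_sym iso).
  by split; apply/eqP; rewrite eqn_leq ?a ?b ?c ?d.
move=> [f [[f' fK f'K] hf]]; split.
  have s : (derived_algebra h1 <= linfun f @: derived_algebra g1)%VS.
    apply/derived_algebra_subP => u v; rewrite -[u]f'K -[v]f'K -hf.
    have -> : f (lie (f' u) (f' v)) = linfun f (lie (f' u) (f' v)) by rewrite lfunE.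
    exact/memv_img/lie_derived.
  by apply: leq_trans (dimvS s) _; rewrite -[leqRHS](limg_ker_dim (linfun f)) leq_addl.
have s : (lie_center h1 <= linfun f @: lie_center g1)%VS.
  apply/subvP => u /lie_centerP hu; rewrite -[u]f'K.
  have -> : f (f' u) = linfun f (f' u) by rewrite lfunE.
  apply/memv_img/lie_centerP => v; apply: (can_inj fK); rewrite hf f'K hu.
  by rewrite linear0.
by apply: leq_trans (dimvS s) _; rewrite -[leqRHS](limg_ker_dim (linfun f)) leq_addl.
Qed.

End Isomorphism.

Section Invariants.
Variable k : fieldType.

Section One.
Variable g : lieAlgType k.
Implicit Types (B : nat -> g -> g -> k) (C : g -> g -> k).

(** The elements of [W], described without a coframe so that isomorphisms carry them over. *)
Definition lie_form C := exists2 phi : g -> k, lin phi & forall u v, C u v = phi (lie u v).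

Definition free_forms m B := (forall i, (i < m)%N -> lie_form (B i)) /\
  forall s : nat -> k, (forall u v, \sum_(i < m) s i * B i u v = 0) ->
    forall i, (i < m)%N -> s i = 0.

Definition inv_rel m (R : seq (nat * nat)) := exists2 B, free_forms m B &
  forall ij, ij \in R -> wedge0 (B ij.1) (B ij.2).

Definition inv_rad m := exists2 B, free_forms m B &
  forall i C, (i < m)%N -> lie_form C -> wedge0 (B i) C.

(** A nondegenerate quadratic relation between three independent forms of [W]. *)
Definition inv_square := exists2 B, free_forms 3 B &
  forall u1 u2 u3 u4, wedge (B 1%N) (B 1%N) u1 u2 u3 u4 = 2 * wedge (B 0%N) (B 2) u1 u2 u3 u4.

(** Asks for a plane of [W] with all products zero whose common radical is not totally isotropic for
    [W]. *)
Definition inv_kernel := exists2 B, free_forms 2 B &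
  [/\ wedge0 (B 0%N) (B 0%N), wedge0 (B 1%N) (B 1%N), wedge0 (B 0%N) (B 1%N) &
    exists C u v, [/\ lie_form C, forall i w, (i < 2)%N -> B i u w = 0,
      forall i w, (i < 2)%N -> B i v w = 0 & C u v != 0]].

(** Every form of [W] vanishes on the center, so a vector of the radical counts only if it is not
    central. *)
Definition degenerate C := exists u, (forall v, C u v = 0) /\ exists v, lie u v != 0.

(** [inv_deg2], [inv_deg3] and [inv_degall] count the degenerate members of a pencil up to scalars:
    at least two, at least three, all. *)
Definition inv_deg2 := exists2 B, free_forms 2 B & forall i, (i < 2)%N -> degenerate (B i).

Definition inv_deg3 := exists C0 C1 C2, [/\ degenerate C0, degenerate C1, degenerate C2 &
  [/\ free_forms 2 (nth C0 [:: C0; C1]), free_forms 2 (nth C0 [:: C0; C2]) &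
      free_forms 2 (nth C0 [:: C1; C2])]].

Definition inv_degall := forall C, lie_form C -> degenerate C.

Definition invariant (c : nat) : Prop := nth False [::
  inv_rel 1 [:: (0, 0)]; inv_rel 2 [:: (0, 0); (1, 1)]; inv_rel 2 [:: (0, 0); (1, 1); (0, 1)];
  inv_rel 3 [:: (0, 0); (1, 1); (2, 2)]; inv_rel 2 [:: (0, 0); (0, 1)];
  inv_rad 1; inv_rad 2; inv_rad 3; inv_square; inv_kernel; inv_deg2; inv_deg3; inv_degall]%N c.

End One.

Lemma invariant_iso (g h : lieAlgType k) c : lie_isomorphic g h ->
  invariant h c -> invariant g c.
Proof.
move=> [f [[f' fK f'K] hf]].
have lf : linear f by apply: linearP.
have lf' : linear f' by move=> a u v; apply: (can_inj fK); rewrite f'K linearP !f'K.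
have hf' u v : f' (lie u v) = lie (f' u) (f' v).
  by apply: (can_inj fK); rewrite f'K hf !f'K.
have LF C : lie_form C -> lie_form (fun u v => C (f u) (f v)).
  move=> [phi lphi hC]; exists (phi \o f); last by move=> u v /=; rewrite hC hf.
  by move=> a u v /=; rewrite lf lphi.
have LF' C : lie_form C -> lie_form (fun u v => C (f' u) (f' v)).
  move=> [phi lphi hC]; exists (phi \o f'); last by move=> u v /=; rewrite hC hf'.
  by move=> a u v /=; rewrite lf' lphi.
have FF m (B : nat -> h -> h -> k) : free_forms m B -> free_forms m (fun i u v => B i (f u) (f v)).
  move=> [h1 h2]; split=> [i hi|s hs]; first exact/LF/h1.
  by apply: h2 => u v; rewrite -[u]f'K -[v]f'K hs.
have DG (C : h -> h -> k) : degenerate C -> degenerate (fun u v : g => C (f u) (f v)).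
  move=> [u [hu [v hv]]]; exists (f' u); split=> [w|]; first by rewrite f'K hu.
  exists (f' v); rewrite -hf'; apply: contraNneq hv => e; rewrite -[lie u v]f'K e.
  by apply/eqP; apply: linear0.
rewrite /invariant; do 13?[case: c => [|c]] => /=; last by rewrite nth_nil.
1-5: by move=> [B hB hR]; exists (fun i u v => B i (f u) (f v));
  [exact: FF|move=> ij hij u1 u2 u3 u4; apply: hR].
1-3: by move=> [B hB hR]; exists (fun i u v => B i (f u) (f v)); [exact: FF|];
  move=> i C hi /LF' hC u1 u2 u3 u4; have := hR i _ hi hC (f u1) (f u2) (f u3) (f u4);
  rewrite /wedge !fK.
- by move=> [B hB hR]; exists (fun i u v => B i (f u) (f v)); [exact: FF|] => u1 u2 u3 u4; apply: hR.
- move=> [B hB [h1 h2 h3 [C [u [v [hC hu hv huv]]]]]]; exists (fun i u v => B i (f u) (f v)); first exact: FF.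
  split; [by move=> *; apply: h1|by move=> *; apply: h2|by move=> *; apply: h3|].
  exists (fun u v => C (f u) (f v)), (f' u), (f' v); split; first exact: LF.
  + by move=> i w hi; rewrite f'K hu.
  + by move=> i w hi; rewrite f'K hv.
  by rewrite !f'K.
- by move=> [B hB hR]; exists (fun i u v => B i (f u) (f v)); [exact: FF|] => i /hR /DG.
- move=> [B0 [B1 [B2 [d0 d1 d2 [f01 f02 f12]]]]].
  exists (fun u v => B0 (f u) (f v)), (fun u v => B1 (f u) (f v)), (fun u v => B2 (f u) (f v)).
  have nE (X Y : h -> h -> k) : free_forms 2 (nth B0 [:: X; Y]) ->
      free_forms 2 (nth (fun u v => B0 (f u) (f v)) [:: (fun u v => X (f u) (f v)); (fun u v => Y (f u) (f v))]).
    move=> /FF [h1 h2]; split.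
      by move=> [|[|//]] hi /=; [have := h1 0%N isT|have := h1 1%N isT].
    move=> s hs; apply: h2 => u v; rewrite -[RHS](hs u v) !big_ord_recr !big_ord0 //.
  by split; [exact: DG|exact: DG|exact: DG|split; exact: nE].
move=> hD C /LF' /hD [u [hu [v hv]]]; exists (f' u); split.
  by move=> w; have := hu (f w); rewrite fK.
exists (f' v); rewrite -hf'; apply: contraNneq hv => e; rewrite -[lie u v]f'K e.
by apply/eqP; apply: linear0.
Qed.
End Invariants.

Definition touches (j : nat) (ij : nat * nat) := (ij.1 == j) || (ij.2 == j).
Definition same_pair (ab ij : nat * nat) := (ij == ab) || (ij == (ab.2, ab.1)).

Definition table_ok (t : nat * seq (seq (nat * nat))) :=
  (t.1 + size t.2 == 8)%N && all (all (fun ij => [&& ij.1 < t.1, ij.2 < t.1 & ij.1 != ij.2])%N) t.2.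

Definition private_pair (L : seq (seq (nat * nat))) c ab :=
  (filter (same_pair ab) (nth [::] L c) == [:: ab]) &&
  all (fun c' => (c' == c) || ~~ has (same_pair ab) (nth [::] L c')) (iota 0 (size L)).

(* Implies that the forms of the table are linearly independent. *)
Definition has_private L := all (fun c => has (private_pair L c) (nth [::] L c)) (iota 0 (size L)).

Definition used (L : seq (seq (nat * nat))) i := has (has (touches i)) L.

(* For some [j], a coordinate of [[e_j, x]] is the [i]-th coordinate of [x], up to sign;
   this coordinate vanishes if [x] is central. *)
Definition isolated (L : seq (seq (nat * nat))) i :=
  has (fun l => has (fun j => (i != j) && ((filter (touches j) l == [:: (i, j)]) ||
    (filter (touches j) l == [:: (j, i)]))) (iota 0 8)) L.

Definition dlt (k : fieldType) (a : nat) : nat -> k := fun l => (l == a)%:R.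

Lemma form_dlt (k : fieldType) l (x : nat -> k) j :
  form_of l x (dlt k j) = form_of (filter (touches j) l) x (dlt k j).
Proof.
elim: l => //= ij l IH; case: ifP => /= [_|]; first by rewrite -IH.
by rewrite /touches /E /dlt => /norP [/negbTE -> /negbTE ->]; rewrite IH !mulr0 subr0 add0r.
Qed.

Lemma form_dlt2 (k : fieldType) l a b :
  form_of l (dlt k a) (dlt k b) = form_of (filter (same_pair (a, b)) l) (dlt k a) (dlt k b).
Proof.
elim: l => //= -[i j] l IH; case: ifP => /= [_|]; first by rewrite -IH.
rewrite /same_pair /= /E /dlt !xpair_eqE IH -!natrM !mulnb /=.
by rewrite [(j == a) && _]andbC => /norP [/negbTE -> /negbTE ->]; rewrite subr0 add0r.
Qed.

(** * Dimensions of the derived algebra and of the center of a model *)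

Section CoordinateSpaces.
Variable k : fieldType.
Implicit Type P : pred 'I_8.

Definition coord_space P : {vspace 'rV[k]_8} := (\sum_(i | P i) <[delta_mx 0%R i : 'rV[k]_8]>)%VS.

Lemma coord_spaceP P (x : 'rV[k]_8) :
  reflect (forall i, ~~ P i -> x 0 i = 0) (x \in coord_space P).
Proof.
apply: (iffP idP) => [/memv_sumP [v hv ->] i hi|hx].
  rewrite summxE big1 // => j hj; have /vlineP [c ->] := hv j hj.
  by rewrite !mxE eqxx /=; case: eqP => [e|]; rewrite ?mulr0 //; move: hi; rewrite e hj.
rewrite [x]row_sum_delta; apply: memv_suml => i _; have [hi|hi] := boolP (P i).
  by apply/memvZ/(subvP (sumv_sup i hi (subvv _)))/memv_line.
by rewrite hx // scale0r mem0v.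
Qed.

Lemma dim_coord_space (p : pred nat) :
  \dim (coord_space (fun i => p i)) = count p (iota 0 8).
Proof.
have cnt (q : pred nat) : #|[pred i : 'I_8 | q i]| = count q (iota 0 8).
  by rewrite cardE size_filter -enumT -[iota 0 8]val_enum_ord count_map.
have le (q : pred nat) : (\dim (coord_space (fun i => q i)) <= count q (iota 0 8))%N.
  rewrite -cnt -sum1_card; apply: (leq_trans (dimv_leq_sum _ _ _)).
  by apply: leq_sum => i _; rewrite dim_vline leq_b1.
apply/eqP; rewrite eqn_leq le /=.
(* The bounds [le] for [p] and for its complement add up to 8, and the two spaces span everything,
   so both bounds are equalities. *)
have full : (fullv <= coord_space (fun i => p i) + coord_space (fun i => ~~ p i))%VS.
  apply/subvP => x _; rewrite [x]row_sum_delta; apply: memv_suml => i _; apply: memvZ.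
  have [hi|hi] := boolP (p i); [apply: (subvP (addvSl _ _))|apply: (subvP (addvSr _ _))];
  by apply: (subvP (sumv_sup i hi (subvv _))); apply: memv_line.
have := dimvS full; rewrite dimvf /= => h8.
have h : (8 <= \dim (coord_space (fun i => p i)) + \dim (coord_space (fun i => ~~ p i)))%N.
  exact: leq_trans h8 (dimv_add_leqif _ _).
have := le (predC p); have := count_predC p (iota 0 8); rewrite size_iota => e h'.
by rewrite -(leq_add2r (count (predC p) (iota 0 8))) e (leq_trans h) // leq_add2l.
Qed.
End CoordinateSpaces.

Section ModelDims.
Variables (k : fieldType) (n : nat) (L : seq (seq (nat * nat))).
Hypothesis ok : table_ok (n, L).
Local Notation M := (modelType k (n, L)).

Lemma n_size : (n + size L = 8)%N.
Proof. by case/andP: ok => /eqP. Qed.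

Lemma n_le8 : (n <= 8)%N.
Proof. by rewrite -n_size leq_addr. Qed.

Definition vec (a : nat -> k) : M := \row_(i < 8) a i.

Lemma low_vec a l : low (vec a) l = if (l < n)%N then a l else 0.
Proof.
rewrite /low /crd; case: ifP => // hl.
by rewrite (leq_trans hl n_le8) mxE inordK // (leq_trans hl n_le8).
Qed.

Lemma form_low l (x y : M) a b : l \in L -> (forall i, (i < n)%N -> low x i = a i) ->
  (forall i, (i < n)%N -> low y i = b i) -> form_of l (low x) (low y) = form_of l a b.
Proof.
move=> hl ha hb; apply: (form_of_ext (n := n)) => //.
case/andP: ok => _ /allP /(_ l hl) /allP h; apply/allP => ij /h.
by case/and3P => -> ->.
Qed.

Lemma lie_coord (x y : M) (i : 'I_8) : (n <= i)%N ->
  (lie x y : 'rV_8) 0 i = form_of (nth [::] L (i - n)) (low x) (low y).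
Proof.
move=> hi; rewrite mxE /= ltnNge hi /= /model_form (nth_map [::]) //.
by rewrite ltn_subLR // n_size.
Qed.

Lemma low_dlt a l : (a < n)%N -> low (vec (dlt k a)) l = dlt k a l.
Proof.
move=> ha; rewrite low_vec; case: ifP => // hl.
by rewrite /dlt; case: eqP => // e; rewrite e ha in hl.
Qed.

Lemma dim_derived_model : has_private L ->
  \dim (derived_algebra M) = count (leq n) (iota 0 8).
Proof.
move=> hp; rewrite -(dim_coord_space k (leq n)); congr (\dim _); apply/eqP.
rewrite eqEsubv; apply/andP; split.
  apply/derived_algebra_subP => x y; apply/coord_spaceP => i.
  by rewrite -ltnNge => hi; rewrite mxE /= hi.
apply/subv_sumP => i hi; rewrite -memvE.
have hc : (i - n < size L)%N by rewrite ltn_subLR // n_size.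
have /hasP [[a b] hab /andP [/eqP h1 /allP h2]] : has (private_pair L (i - n)) (nth [::] L (i - n)).
  by move/allP: hp; apply; rewrite mem_iota.
have hl : nth [::] L (i - n) \in L by apply: mem_nth.
have [ha hb hne] : [/\ (a < n)%N, (b < n)%N & a != b].
  by case/andP: ok => _ /allP /(_ _ hl) /allP /(_ _ hab) /and3P [].
suff <- : lie (vec (dlt k a)) (vec (dlt k b)) = delta_mx 0 i :> 'rV_8 by apply: lie_derived.
apply/rowP => j; have [hj|hj] := ltnP j n.
  by rewrite !mxE /= hj; case: eqP hi hj => // ->; rewrite leqNgt => /negbTE ->.
have hl' : nth [::] L (j - n) \in L by apply: mem_nth; rewrite ltn_subLR // n_size.
rewrite lie_coord // (form_low hl' (a := dlt k a) (b := dlt k b)); try by move=> *; apply: low_dlt.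
rewrite form_dlt2 mxE eqxx /=; have [e|e] := eqVneq j i.
  by rewrite e h1 /= /E /dlt !eqxx [b == a]eq_sym (negbTE hne) !(mulr0, mulr1, subr0, addr0).
have := h2 (j - n)%N; rewrite mem_iota /= add0n ltn_subLR // n_size ltn_ord => /(_ isT) /orP [/eqP e'|].
  by case/eqP: e; apply: val_inj; rewrite /= -(subnKC hj) e' subnKC.
by rewrite has_filter negbK => /eqP ->.
Qed.

(** An isolated coordinate of a central vector is zero, while a coordinate that occurs in no form
    does not enter the bracket. *)
Lemma dim_center_model : all (fun i => used L i ==> isolated L i) (iota 0 8) ->
  \dim (lie_center M) = count (predC (used L)) (iota 0 8).
Proof.
move=> hu; rewrite -(dim_coord_space k (predC (used L))); congr (\dim _); apply/eqP.
have usedn i : used L i -> (i < n)%N.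
  case/hasP => l hl /hasP [ij hij] /orP [] /eqP <-;
  by case/andP: ok => _ /allP /(_ _ hl) /allP /(_ _ hij) /and3P [].
rewrite eqEsubv; apply/andP; split; apply/subvP => x; last first.
  move=> /coord_spaceP hx; apply/lie_centerP => y; apply/rowP => i.
  have [hi|hi] := ltnP i n; first by rewrite !mxE /= hi.
  rewrite lie_coord // mxE.
  have hl : nth [::] L (i - n) \in L by apply: mem_nth; rewrite ltn_subLR // n_size.
  have low0 j : used L j -> low x j = 0.
    move=> hj; have hn := usedn _ hj; have h8 := leq_trans hn n_le8.
    by rewrite /low /crd hn h8 hx //= inordK // negbK.
  have : all (fun ij => used L ij.1 && used L ij.2) (nth [::] L (i - n)).
    apply/allP => ij hij; apply/andP; split; apply/hasP; exists (nth [::] L (i - n)) => //;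
    by apply/hasP; exists ij; rewrite // /touches eqxx ?orbT.
  elim: (nth _ _ _) => //= ij l IH /andP [/andP [h1 h2] /IH ->].
  by rewrite /E !low0 // !mul0r subr0 addr0.
move=> /lie_centerP hx; apply/coord_spaceP => i; rewrite negbK => ui.
have : isolated L i by move/allP: hu => /(_ i); rewrite mem_iota ltn_ord => /(_ isT) /implyP; apply.
case/hasP => l hl /hasP [j _ /andP [ij hf]].
have lowi : low x i = x 0 i.
  by rewrite /low /crd (usedn _ ui) ltn_ord inord_val.
have hn : (j < n)%N.
  apply: usedn; apply/hasP; exists l => //; rewrite has_filter.
  by case/orP: hf => /eqP ->.
set c := index l L; have hc : (c < size L)%N by rewrite index_mem.
have h8 : (n + c < 8)%N by rewrite -n_size ltn_add2l.
have := hx (vec (dlt k j)) => /(congr1 (fun y : M => y 0 (Ordinal h8))).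
rewrite lie_coord /= ?leq_addr // addKn nth_index // mxE.
rewrite (form_low hl (a := low x) (b := dlt k j)) //; last by move=> *; apply: low_dlt.
rewrite form_dlt; case/orP: hf => /eqP -> /=; rewrite /E /dlt eqxx (negbTE ij) lowi.
  by rewrite mulr1 mulr0 subr0 addr0.
by rewrite mulr1 mulr0 sub0r addr0 => /eqP; rewrite oppr_eq0 => /eqP.
Qed.

End ModelDims.

(** * Forms of a model as rows of coefficients *)

Section ModelForms.
Variables (k : fieldType) (n : nat) (L : seq (seq (nat * nat))).
Hypothesis ok : table_ok (n, L).
Local Notation M := (modelType k (n, L)).

Definition comb_form (q : nat -> k) : form k :=
  fun a b => \sum_(c < size L) q c * form_of (nth [::] L c) a b.

Lemma comb_form_ext q a b a' b' : (forall i, (i < n)%N -> a i = a' i) ->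
  (forall i, (i < n)%N -> b i = b' i) -> comb_form q a b = comb_form q a' b'.
Proof.
move=> ha hb; apply: eq_bigr => c _; congr (_ * _); apply: (form_of_ext (n := n)) => //.
case/andP: ok => _ /allP /(_ _ (mem_nth [::] (ltn_ord c))) /allP h; apply/allP => ij /h.
by case/and3P => -> ->.
Qed.

Lemma comb_form_low q a b :
  comb_form q (low (vec n L a)) (low (vec n L b)) = comb_form q a b.
Proof. by apply: comb_form_ext => i hi; rewrite low_vec // hi. Qed.

Lemma lie_form_comb (C : M -> M -> k) : lie_form C ->
  exists q, forall u v, C u v = comb_form q (low u) (low v).
Proof.
move=> [phi lphi hC]; pose q c := phi (delta_mx 0 (inord (n + c)) : 'rV[k]_8).
exists q => u v; rewrite hC.
have -> : lie u v = \sum_(i < 8) (lie u v : 'rV_8) 0 i *: (delta_mx 0 i : M) by apply: row_sum_delta.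
rewrite lin_sum //; under eq_bigr do rewrite linZ //.
pose G i := (if (n <= i)%N then form_of (nth [::] L (i - n)) (low u) (low v) else 0) *
  phi (delta_mx 0 (inord i) : 'rV[k]_8).
rewrite (eq_bigr (fun i : 'I_8 => G i)) => [|i _]; last first.
  rewrite /G inord_val; case: leqP => hi; first by rewrite -(lie_coord ok).
  by rewrite mxE /= hi.
rewrite -(big_mkord xpredT G) (big_cat_nat (n := n)) ?(n_le8 ok) //= big_nat_cond big1 ?add0r; last first.
  by move=> i /andP[/andP[_ hi] _]; rewrite /G leqNgt hi mul0r.
rewrite -[X in index_iota X _]add0n big_addn -(n_size ok) addKn big_mkord.
by apply: eq_bigr => c _; rewrite /G leq_addl addnK addnC /q mulrC addnC.
Qed.

Lemma comb_lie_form (q : nat -> k) : lie_form (fun u v : M => comb_form q (low u) (low v)).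
Proof.
exists (fun x : M => \sum_(c < size L) q c * (x : 'rV_8) 0 (inord (n + c))).
  by move=> a u v; rewrite mulr_sumr -big_split; apply: eq_bigr => c _ /=; rewrite !mxE; ring.
move=> u v; apply: eq_bigr => c _; congr (_ * _).
have h8 : (n + c < 8)%N by rewrite -(n_size ok) ltn_add2l.
by rewrite lie_coord // inordK // ?leq_addr // addKn.
Qed.

Definition basis_form c : M -> M -> k := fun u v => form_of (nth [::] L c) (low u) (low v).

Lemma basis_formE c : (c < size L)%N ->
  forall a b, comb_form (dlt k c) a b = form_of (nth [::] L c) a b.
Proof.
move=> hc a b; rewrite /comb_form (bigD1 (Ordinal hc)) //= /dlt eqxx mul1r big1 ?addr0 // => c' hc'.
by move: hc'; rewrite -val_eqE /= => /negbTE ->; rewrite mul0r.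
Qed.

Lemma basis_lie_form c : (c < size L)%N -> lie_form (basis_form c).
Proof.
move=> hc; have [phi lphi h] := comb_lie_form (dlt k c); exists phi => // u v.
by rewrite -h basis_formE.
Qed.

Lemma basis_free (cs : seq nat) : has_private L -> uniq cs -> all (fun c => c < size L)%N cs ->
  free_forms (size cs) (fun i => basis_form (nth 0%N cs i)).
Proof.
move=> hp ucs /all_nthP hcs; split=> [i hi|s hs i hi].
  by apply: basis_lie_form; apply: hcs.
have hc := hcs 0%N i hi; set c := nth 0%N cs i in hc.
have /hasP [[a b] hab /andP [/eqP h1 /allP h2]] : has (private_pair L c) (nth [::] L c).
  by move/allP: hp; apply; rewrite mem_iota.
have hl : nth [::] L c \in L by apply: mem_nth.
have [ha hb hne] : [/\ (a < n)%N, (b < n)%N & a != b].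
  by case/andP: ok => _ /allP /(_ _ hl) /allP /(_ _ hab) /and3P [].
have := hs (vec n L (dlt k a)) (vec n L (dlt k b)).
have ev c' : (c' < size L)%N -> basis_form c' (vec n L (dlt k a)) (vec n L (dlt k b)) = (c' == c)%:R.
  move=> hc'; rewrite /basis_form (form_low ok (mem_nth _ hc') (a := dlt k a) (b := dlt k b));
    try by move=> *; apply: low_dlt.
  rewrite form_dlt2; have [->|ne] := eqVneq c' c.
    by rewrite h1 /= /E /dlt !eqxx [b == a]eq_sym (negbTE hne) !(mulr0, mulr1, subr0, addr0).
  have := h2 c'; rewrite mem_iota /= add0n hc' (negbTE ne) => /(_ isT) /=.
  by rewrite has_filter negbK => /eqP ->.
rewrite (bigD1 (Ordinal hi)) //= ev // eqxx mulr1 big1 ?addr0 // => j hj.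
rewrite ev ?hcs // nth_uniq //; move: hj; rewrite -val_eqE /= => /negbTE ->.
by rewrite mulr0.
Qed.

Definition free_rows m (Q : nat -> nat -> k) := forall s : nat -> k,
  (forall c, (c < size L)%N -> \sum_(i < m) s i * Q i c = 0) -> forall i, (i < m)%N -> s i = 0.

Lemma free_forms_rows m (B : nat -> M -> M -> k) : free_forms m B ->
  exists2 Q, free_rows m Q & forall i, (i < m)%N -> forall u v, B i u v = comb_form (Q i) (low u) (low v).
Proof.
move=> [h1 h2].
have /fin_all_exists [Q hQ] : forall i : 'I_m, exists q, forall u v, B i u v = comb_form q (low u) (low v).
  by move=> i; apply/lie_form_comb/h1.
pose Q' i := if insub i is Some j then Q j else fun=> 0.
have BE i : (i < m)%N -> forall u v, B i u v = comb_form (Q' i) (low u) (low v).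
  by move=> hi u v; rewrite /Q' insubT (hQ (Ordinal hi)).
exists Q' => // s hs; apply: h2 => u v.
rewrite (eq_bigr (fun i : 'I_m => \sum_(c < size L) s i * (Q' i c * form_of (nth [::] L c) (low u) (low v)))).
  rewrite exchange_big big1 // => c _ /=.
  transitivity ((\sum_(i < m) s i * Q' i c) * form_of (nth [::] L c) (low u) (low v)).
    by rewrite mulr_suml; apply: eq_bigr => i _; rewrite mulrA.
  by rewrite hs ?mul0r.
by move=> i _; rewrite BE // mulr_sumr.
Qed.

(** Rows vanishing off [S] live in a space of dimension at most [size S], and there are more of
    them. *)
Lemma free_rows_supp m Q (S : seq nat) : free_rows m Q -> (size S < m)%N ->
  ~ (forall i c, (i < m)%N -> (c < size L)%N -> c \notin S -> Q i c = 0).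
Proof.
move=> hf hS h0; have [s [i [hi si hs]]] := lin_dep (fun i j => Q i (nth 0%N S j)) hS.
case/eqP: si; apply: hf hi => c hc; have [cS|cS] := boolP (c \in S).
  by have := hs (index c S); rewrite index_mem cS nth_index // => /(_ isT).
by rewrite big1 // => j _; rewrite h0 // mulr0.
Qed.

Lemma wedge0_comb (B C : M -> M -> k) q q' :
  (forall u v, B u v = comb_form q (low u) (low v)) ->
  (forall u v, C u v = comb_form q' (low u) (low v)) ->
  wedge0 B C -> wedge0 (comb_form q) (comb_form q').
Proof.
move=> hB hC h a1 a2 a3 a4.
have := h (vec n L a1) (vec n L a2) (vec n L a3) (vec n L a4).
by rewrite /wedge !hB !hC !comb_form_low.
Qed.

Lemma rel_rows m R : inv_rel M m R -> (all (fun ij => (ij.1 < m) && (ij.2 < m))%N R) ->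
  exists2 Q, free_rows m Q & forall i j, (i, j) \in R -> wedge0 (comb_form (Q i)) (comb_form (Q j)).
Proof.
move=> [B hB hR] /allP hm; have [Q fQ hQ] := free_forms_rows hB; exists Q => // i j hij.
have /andP [hi hj] := hm _ hij.
by apply: wedge0_comb (hQ i hi) (hQ j hj) (hR _ hij).
Qed.

Lemma diag_rows m R : inv_rel M m R -> all (fun ij => (ij.1 < m) && (ij.2 < m))%N R ->
  all (fun i => (i, i) \in R) (iota 0 m) ->
  exists2 Q, free_rows m Q & forall i, (i < m)%N -> wedge0 (comb_form (Q i)) (comb_form (Q i)).
Proof.
move=> /rel_rows h /h [Q fQ hQ] /allP hR; exists Q => // i hi.
by apply/hQ/hR; rewrite mem_iota.
Qed.

Lemma rad_rows m : inv_rad M m ->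
  exists2 Q, free_rows m Q & forall i c, (i < m)%N -> (c < size L)%N ->
    wedge0 (comb_form (Q i)) (form_of (nth [::] L c)).
Proof.
move=> [B hB hR]; have [Q fQ hQ] := free_forms_rows hB; exists Q => // i c hi hc.
have := wedge0_comb (hQ i hi) (q' := dlt k c) _ (hR i _ hi (basis_lie_form hc)).
rewrite /basis_form => /(_ (fun u v => esym (basis_formE hc _ _))) h a1 a2 a3 a4.
by rewrite -[RHS](h a1 a2 a3 a4) /wedge !basis_formE.
Qed.

Lemma degenerate_comb (C : M -> M -> k) q : (forall u v, C u v = comb_form q (low u) (low v)) ->
  degenerate C -> exists a : nat -> k, (forall b, comb_form q a b = 0) /\
    ~ (forall i, used L i -> a i = 0).
Proof.
move=> hC [u [hu [v hv]]]; exists (low u); split.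
  move=> b; rewrite -[RHS](hu (vec n L b)) hC; apply: comb_form_ext => // i hi.
  by rewrite low_vec // hi.
move=> a0; case/eqP: hv; apply/rowP => i; rewrite [RHS]mxE.
have [hi|hi] := ltnP i n; first by rewrite !mxE /= hi.
rewrite lie_coord //.
have hl : nth [::] L (i - n) \in L by apply: mem_nth; rewrite ltn_subLR // (n_size ok).
have : all (fun ij => used L ij.1 && used L ij.2) (nth [::] L (i - n)).
  apply/allP => ij hij; apply/andP; split; apply/hasP; exists (nth [::] L (i - n)) => //;
  by apply/hasP; exists ij; rewrite // /touches eqxx ?orbT.
elim: (nth _ _ _) => //= ij l IH /andP [/andP [h1 h2] /IH ->].
by rewrite /E !a0 // !mul0r subr0 addr0.
Qed.

(** The [foldr] simplifies on a concrete table to an expression that [ring] accepts. *)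
Lemma comb_formE q a b : comb_form q a b =
  foldr (fun c s => q c * form_of (nth [::] L c) a b + s) 0 (iota 0 (size L)).
Proof.
by rewrite /comb_form -(big_mkord xpredT (fun c => q c * form_of (nth [::] L c) a b)) unlock /index_iota subn0.
Qed.

Lemma comb_degenerate q a b c : (c < size L)%N -> (forall b, comb_form q a b = 0) ->
  form_of (nth [::] L c) a b != 0 -> degenerate (fun u v : M => comb_form q (low u) (low v)).
Proof.
move=> hc h0 h1; exists (vec n L a); split=> [v|].
  by rewrite -[RHS](h0 (low v)); apply: comb_form_ext => // l hl; rewrite low_vec // hl.
exists (vec n L b); have h8 : (n + c < 8)%N by rewrite -(n_size ok) ltn_add2l.
apply: contraNneq h1 => /(congr1 (fun y : M => (y : 'rV_8) 0 (Ordinal h8))).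
rewrite lie_coord //= ?leq_addr // addKn mxE => e; apply/eqP; rewrite -[RHS]e; apply/esym.
by rewrite (form_low ok (mem_nth _ hc) (a := a) (b := b)) // => l hl; rewrite low_vec // hl.
Qed.

Lemma comb_nondegenerate q : (forall a, (forall b, comb_form q a b = 0) -> forall i, used L i -> a i = 0) ->
  ~ degenerate (fun u v : M => comb_form q (low u) (low v)).
Proof. by move=> h /(degenerate_comb (fun u v => erefl)) [a [/h]]. Qed.

Lemma free_comb m Q : has_private L -> free_rows m Q ->
  free_forms m (fun i (u v : M) => comb_form (Q i) (low u) (low v)).
Proof.
move=> hp fQ; split=> [i _|s hs]; first exact: comb_lie_form.
have [|_ h] := basis_free hp (iota_uniq 0 (size L)).
  by apply/allP => c; rewrite mem_iota.
rewrite size_iota in h; apply: fQ => c hc; apply: (h (fun c => \sum_(i < m) s i * Q i c)) hc => u v.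
rewrite -[RHS](hs u v); under [RHS]eq_bigr do rewrite mulr_sumr.
rewrite exchange_big; apply: eq_bigr => c' _; rewrite mulr_suml nth_iota // add0n.
by apply: eq_bigr => i _; rewrite mulrA.
Qed.

(** If [Q 0 c] is nonzero, [Q 1 c] and [- Q 0 c] are the coefficients of a relation between the two
    rows; otherwise row 0 is zero. *)
Lemma free_minors Q : free_rows 2 Q ->
  ~ (forall c c', (c < size L)%N -> (c' < size L)%N -> Q 0%N c * Q 1%N c' = Q 0%N c' * Q 1%N c).
Proof.
move=> fQ h; have [[c Qc]|h0] := altP (@existsP 'I_(size L) (fun c => Q 0%N c != 0)).
  have := fQ (nth 0 [:: Q 1%N c; - Q 0%N c]); move=> /(_ _ 1%N isT) /= H.
  case/eqP: Qc; apply/eqP; rewrite -oppr_eq0 H // => c' hc'.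
  by rewrite !big_ord_recr big_ord0 /= mulrC h //; ring.
have := fQ (nth 0 [:: 1; 0]); move=> /(_ _ 0%N isT) /= H.
case/negP: (oner_neq0 k); apply/eqP/H => c hc.
rewrite !big_ord_recr big_ord0 /= mul0r addr0 add0r mul1r.
by move: h0; rewrite negb_exists => /forallP /(_ (Ordinal hc)); rewrite negbK => /eqP.
Qed.

Lemma basis_rel cs R : has_private L -> uniq cs -> all (fun c => c < size L)%N cs ->
  (forall ij, ij \in R -> wedge0 (form_of (k := k) (nth [::] L (nth 0%N cs ij.1)))
    (form_of (nth [::] L (nth 0%N cs ij.2)))) -> inv_rel M (size cs) R.
Proof.
move=> hp ucs hcs hR; exists (fun i => basis_form (nth 0%N cs i)); first exact: basis_free.
by move=> ij hij u1 u2 u3 u4; apply: (hR ij hij).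
Qed.

Lemma basis_rad cs : has_private L -> uniq cs -> all (fun c => c < size L)%N cs ->
  (forall i c, (i < size cs)%N -> (c < size L)%N -> wedge0 (form_of (k := k) (nth [::] L (nth 0%N cs i)))
    (form_of (nth [::] L c))) -> inv_rad M (size cs).
Proof.
move=> hp ucs hcs hR; exists (fun i => basis_form (nth 0%N cs i)); first exact: basis_free.
move=> i C hi /lie_form_comb [q hq] u1 u2 u3 u4; rewrite /wedge !hq /comb_form.
set B := basis_form _; transitivity (\sum_(c < size L) q c * wedge B (basis_form c) u1 u2 u3 u4).
  rewrite /wedge !(mulr_sumr, mulr_suml) -!big_split -sumrN -!big_split /=; apply: eq_bigr => c _.
  by rewrite /basis_form; ring.
rewrite big1 // => c _; apply/eqP; rewrite mulf_eq0; apply/orP; right; apply/eqP.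
exact: (hR i c hi (ltn_ord c)).
Qed.

End ModelForms.

(** * The 35 algebras *)

(** Derived algebras of dimension 0, 1, 2, 3, 4 contribute 1, 3, 11, 17 and 3 algebras. *)
Definition tables : seq (nat * seq (seq (nat * nat))) :=
  (8, [::])%N :: map (pair 7%N) T71 ++ map (pair 6%N) T62 ++ map (pair 5%N) T53 ++ map (pair 4%N) T44.

Definition table i := nth (8, [::])%N tables i.

Ltac start :=
  match goal with |- context [table ?i] =>
    let t := eval vm_compute in (table i) in change (table i) with t
  end; cbv [invariant nth].

Ltac holds_rel cs :=
  start;   apply: (@basis_rel _ _ _ _ cs); [by []|by []|by []|by []|];
  let ij := fresh "ij" in let h := fresh "h" in
  move=> ij; rewrite !inE => h; repeat (case/orP: h => h);
  move/eqP: h => -> u1 u2 u3 u4; rewrite /wedge /= /E; ring.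

Ltac holds_rad cs :=
  start;  apply: (@basis_rad _ _ _ _ cs); [by []|by []|by []|by []|];
  let i := fresh "i" in let c := fresh "c" in
  move=> i c; do 4?[case: i => [|i] //=]; move=> _; do 4?[case: c => [|c] //=];
  move=> _ u1 u2 u3 u4; rewrite /wedge /= /E; ring.

(* Compares a coefficient with the value of the 4-form [h] on four basis vectors. *)
Ltac expand h t :=
  lazymatch t with (?a, ?b, ?c, ?d) =>
    rewrite -[RHS](h (dlt _ a) (dlt _ b) (dlt _ c) (dlt _ d)) /wedge ?comb_formE /= /E /dlt /=; ring
  end.

Lemma half (k : fieldType) (x : k) : (2 : k) != 0 -> 2 * x = 0 -> x = 0.
Proof. by move=> /negbTE h /eqP; rewrite mulf_eq0 h => /eqP. Qed.

Lemma sq0 (k : fieldType) (x : k) : x * x = 0 -> x = 0.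
Proof. by move=> /eqP; rewrite mulf_eq0 orbb => /eqP. Qed.

(** Meant for two rows that are isotropic and orthogonal for the product of two coordinates: their 2
    by 2 minor in these columns vanishes. *)
Lemma cross_zero (k : fieldType) (a b a' b' : k) :
  a * b = 0 -> a' * b' = 0 -> a * b' + b * a' = 0 -> a * b' = 0 /\ b * a' = 0.
Proof.
move=> /eqP; rewrite mulf_eq0 => /orP [] /eqP ->; first by rewrite !mul0r add0r.
by rewrite !mul0r addr0.
Qed.

Ltac ev h t := apply: half; [assumption|]; expand h t.

Ltac rows Q fQ hQ := start; move=> /rel_rows - /(_ isT isT) [Q fQ hQ].
Ltac diag_rows Q fQ hQ := start; move=> /diag_rows - /(_ isT isT isT) [Q fQ hQ].
Ltac rad_rows Q fQ hQ := start; move=> /rad_rows - /(_ isT) [Q fQ hQ].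

(* Refutes [free_rows] for rows vanishing off the columns [S]. *)
Ltac support fQ S :=
  apply: (free_rows_supp fQ (S := S)) => //;
  let i := fresh "i" in let c := fresh "c" in
  move=> i c hi; do 5?[case: c => [|c] //=]; move=> _ _.

Ltac squares Q m hQ l :=
  lazymatch l with
  | [::] => idtac
  | (?c, ?t) :: ?l' =>
      have ? : forall i, (i < m)%N -> Q i c = 0;
        [let h := fresh "h" in move=> ? /hQ h; apply: sq0; ev h t|squares Q m hQ l']
  end.

Ltac products Q m hQ l :=
  lazymatch l with
  | [::] => idtac
  | (?c, ?w, ?t) :: ?l' =>
      have ? : forall i, (i < m)%N -> Q i c = 0;
        [let i := fresh "i" in let h := fresh "h" in let hi := fresh "hi" in
         move=> i hi; have h := hQ i w hi isT; first [expand h t|ev h t]|products Q m hQ l']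
  end.

(* In [l], [(c, t)] stands for: the value on the quadruple [t] of the square of a form
   is twice the square of its [c]-th coefficient. *)
Ltac fails_rel m l S :=
  let Q := fresh "Q" in let fQ := fresh "fQ" in let hQ := fresh "hQ" in
  diag_rows Q fQ hQ; squares Q m%N hQ l; support fQ S; auto.

(* In [l], [(c, w, t)] stands for: the value on the quadruple [t] of the product of a form
   with the [w]-th form of the table is a multiple of its [c]-th coefficient. *)
Ltac fails_rad m l S :=
  let Q := fresh "Q" in let fQ := fresh "fQ" in let hQ := fresh "hQ" in
  rad_rows Q fQ hQ; products Q m%N hQ l; support fQ S; auto.

Ltac by_minors fQ :=
  let c := fresh "c" in let c' := fresh "c'" in
  apply: (free_minors fQ) => c c'; do 5?[case: c => [|c] //=]; do 5?[case: c' => [|c'] //=]; move=> _ _.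

(** * Degenerate members of a pencil *)

Section Pairs.
Variable k : fieldType.
Variables (n : nat) (L : seq (seq (nat * nat))).
Hypotheses (ok : table_ok (n, L)) (hp : has_private L) (L2 : (1 < size L)%N).
Local Notation cf q := (fun u v : modelType k (n, L) => comb_form L q (low u) (low v)).

Lemma free_pair D q q' : q#0 * q'#1 - q#1 * q'#0 != 0 ->
  free_forms 2 (nth D [:: cf q; cf q']).
Proof.
move=> det; have fQ : free_rows L 2 (nth q [:: q; q']).
  move=> s hs; have := hs 0%N (ltnW L2); have := hs 1%N L2.
  rewrite !big_ord_recr !big_ord0 /= !add0r => h1 h0.
  move=> [|[|//]] _; apply: (mulfI det); rewrite mulr0.
    transitivity (q'#1 * (s#0 * q#0 + s#1 * q'#0) - q'#0 * (s#0 * q#1 + s#1 * q'#1)); first ring.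
    by rewrite h0 h1; ring.
  transitivity (q#0 * (s#0 * q#1 + s#1 * q'#1) - q#1 * (s#0 * q#0 + s#1 * q'#0)); first ring.
  by rewrite h0 h1; ring.
have [h1 h2] := free_comb ok hp fQ; split.
  by move=> [|[|//]] hi /=; [apply: (h1 0%N)|apply: (h1 1%N)].
move=> s hs; apply: h2 => u v; rewrite -[RHS](hs u v) !big_ord_recr !big_ord0 //.
Qed.

Lemma deg2_pair q q' : q#0 * q'#1 - q#1 * q'#0 != 0 ->
  degenerate (cf q) -> degenerate (cf q') -> inv_deg2 (modelType k (n, L)).
Proof.
move=> det d d'; exists (nth (cf q) [:: cf q; cf q']); first exact: free_pair.
by move=> [|[|]].
Qed.

Lemma deg3_triple q0 q1 q2 : q0#0 * q1#1 - q0#1 * q1#0 != 0 ->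
  q0#0 * q2#1 - q0#1 * q2#0 != 0 -> q1#0 * q2#1 - q1#1 * q2#0 != 0 ->
  degenerate (cf q0) -> degenerate (cf q1) -> degenerate (cf q2) -> inv_deg3 (modelType k (n, L)).
Proof.
by move=> *; exists (cf q0), (cf q1), (cf q2); split=> //; split; apply: free_pair.
Qed.
End Pairs.

Ltac simp01 := rewrite /dlt /= ?(mulr0, mul0r, addr0, subr0, mulr1, mulrN, add0r, sub0r, oppr_eq0) ?oner_neq0 //.

Ltac is_degenerate a b c :=
  apply: (@comb_degenerate _ _ _ _ _ a (dlt _ b) c); [by []|by []| |rewrite /= /E; simp01];
  let h := fresh "h" in move=> h; rewrite comb_formE /= /E /dlt /=; ring.

Ltac coordinate e h b A :=
  apply: (mulfI e); rewrite mulr0;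
  first [ rewrite -[RHS](h (dlt _ b)) comb_formE /= /E /dlt /= ?A; ring
        | rewrite -[RHS]oppr0 -[in RHS](h (dlt _ b)) comb_formE /= /E /dlt /= ?A; ring ].

Section Nonsingular.
Variable k : fieldType.
Implicit Types (q a : nat -> k).

(** Up to sign, the Pfaffian of the combination [q] is [q1^3] for tables 9 and 13, [q0^2 q1] for
    table 11, and [q0 q1 (q0 + q1)] for table 10. The basis vectors are taken in an order for which
    the equations of the radical are triangular. *)
Lemma nonsingular_9 q a : q#1 != 0 ->
  (forall b, comb_form (table 9).2 q a b = 0) -> forall i, used (table 9).2 i -> a i = 0.
Proof.
cbv [table nth tables cat map T71 T62 snd] => e0 h.
have a0 : a#0 = 0 by coordinate e0 h 4%N addr0.
have a1 : a#1 = 0 by coordinate e0 h 5%N (a0).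
have a2 : a#2 = 0 by coordinate e0 h 3%N (a0,a1).
have a3 : a#3 = 0 by coordinate e0 h 2%N (a0,a1,a2).
have a4 : a#4 = 0 by coordinate e0 h 0%N (a0,a1,a2,a3).
have a5 : a#5 = 0 by coordinate e0 h 1%N (a0,a1,a2,a3,a4).
by move=> i; do 6?[case: i => [|i] //=].
Qed.

Lemma nonsingular_13 q a : q#1 != 0 ->
  (forall b, comb_form (table 13).2 q a b = 0) -> forall i, used (table 13).2 i -> a i = 0.
Proof.
cbv [table nth tables cat map T71 T62 snd] => e0 h.
have a0 : a#0 = 0 by coordinate e0 h 4%N addr0.
have a2 : a#2 = 0 by coordinate e0 h 5%N (a0).
have a1 : a#1 = 0 by coordinate e0 h 3%N (a0,a2).
have a3 : a#3 = 0 by coordinate e0 h 1%N (a0,a2,a1).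
have a4 : a#4 = 0 by coordinate e0 h 0%N (a0,a2,a1,a3).
have a5 : a#5 = 0 by coordinate e0 h 2%N (a0,a2,a1,a3,a4).
by move=> i; do 6?[case: i => [|i] //=].
Qed.

Lemma nonsingular_11 q a : q#0 != 0 -> q#1 != 0 ->
  (forall b, comb_form (table 11).2 q a b = 0) -> forall i, used (table 11).2 i -> a i = 0.
Proof.
cbv [table nth tables cat map T71 T62 snd] => e0 e1 h.
have a4 : a#4 = 0 by coordinate e1 h 5%N addr0.
have a5 : a#5 = 0 by coordinate e1 h 4%N (a4).
have a0 : a#0 = 0 by coordinate e0 h 1%N (a4,a5).
have a2 : a#2 = 0 by coordinate e0 h 3%N (a4,a5,a0).
have a1 : a#1 = 0 by coordinate e0 h 0%N (a4,a5,a0,a2).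
have a3 : a#3 = 0 by coordinate e0 h 2%N (a4,a5,a0,a2,a1).
by move=> i; do 6?[case: i => [|i] //=].
Qed.

Lemma nonsingular_10 q a : q#0 != 0 -> q#1 != 0 -> q#0 + q#1 != 0 ->
  (forall b, comb_form (table 10).2 q a b = 0) -> forall i, used (table 10).2 i -> a i = 0.
Proof.
cbv [table nth tables cat map T71 T62 snd] => e0 e1 e2 h.
have a4 : a#4 = 0 by coordinate e1 h 5%N addr0.
have a5 : a#5 = 0 by coordinate e1 h 4%N (a4).
have a2 : a#2 = 0 by coordinate e0 h 3%N (a4,a5).
have a3 : a#3 = 0 by coordinate e0 h 2%N (a4,a5,a2).
have a0 : a#0 = 0 by coordinate e2 h 1%N (a4,a5,a2,a3).
have a1 : a#1 = 0 by coordinate e2 h 0%N (a4,a5,a2,a3,a0).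
by move=> i; do 6?[case: i => [|i] //=].
Qed.

End Nonsingular.

(** * Values of the invariants on the models *)

Section Values.
Variable k : fieldType.
Hypothesis two_neq0 : (2 : k) != 0.
Local Notation M i := (modelType k (table i)).

Lemma fails_0_31 : ~ invariant (M 31) 0.
Proof.
diag_rows Q fQ hQ; have {}hQ := hQ 0%N isT.
have e0 : Q#0#0 = 0 by apply: sq0; ev hQ (0, 1, 2, 3)%N.
have e2 : Q#0#2 = 0 by apply: sq0; ev hQ (1, 2, 3, 4)%N.
have e1 : Q#0#1 * Q#0#1 - Q#0#0 * Q#0#2 = 0 by ev hQ (0, 1, 3, 4)%N.
rewrite e0 mul0r subr0 in e1; have {}e1 := sq0 e1.
support fQ ([::] : seq nat); case: i hi => //.
Qed.

Lemma fails_0_10 : ~ invariant (M 10) 0.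
Proof.
diag_rows Q fQ hQ; have {}hQ := hQ 0%N isT.
have h1 : Q#0#0 * Q#0#1 = 0 by ev hQ (2, 3, 4, 5)%N.
have e0 : Q#0#0 * Q#0#0 + Q#0#0 * Q#0#1 = 0 by ev hQ (0, 1, 2, 3)%N.
have e1 : Q#0#1 * Q#0#1 + Q#0#0 * Q#0#1 = 0 by ev hQ (0, 1, 4, 5)%N.
rewrite h1 addr0 in e0; rewrite h1 addr0 in e1; have {}e0 := sq0 e0; have {}e1 := sq0 e1.
support fQ ([::] : seq nat); case: i hi => //.
Qed.

Lemma fails_1_25 : ~ invariant (M 25) 1.
Proof.
diag_rows Q fQ hQ.
have e2 i : (i < 2)%N -> Q i 2 = 0 by move=> /hQ {}hQ; apply: sq0; ev hQ (0, 4, 2, 3)%N.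
have e1 i : (i < 2)%N -> Q i 1 = 0.
  move=> hi; apply: sq0; transitivity (Q i 0 * Q i 2 + Q i 1 * Q i 1); first by rewrite e2 // mulr0 add0r.
  by move: hi => /hQ {}hQ; ev hQ (0, 1, 2, 3)%N.
support fQ [:: 0%N]; auto.
Qed.

(** The squares kill the coefficient on the second form of the table, and [cross_zero] kills the
    minor in the two other columns. *)
Lemma fails_2_21 : ~ invariant (M 21) 2.
Proof.
rows Q fQ hQ; have h00 := hQ 0%N 0%N isT; have h11 := hQ 1%N 1%N isT; have h01 := hQ 0%N 1%N isT.
have e1 : Q#0#1 = 0 by apply: sq0; ev h00 (0, 4, 1, 2)%N.
have f1 : Q#1#1 = 0 by apply: sq0; ev h11 (0, 4, 1, 2)%N.
have d02 : Q#0#0 * Q#0#2 = 0 by ev h00 (0, 1, 2, 3)%N.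
have d'02 : Q#1#0 * Q#1#2 = 0 by ev h11 (0, 1, 2, 3)%N.
have [m02 n02] : Q#0#0 * Q#1#2 = 0 /\ Q#0#2 * Q#1#0 = 0.
  by apply: cross_zero d02 d'02 _; expand h01 (0, 1, 2, 3)%N.
by_minors fQ; rewrite ?e1 ?f1; try ring; by rewrite ?m02 ?n02.
Qed.

Lemma fails_2_23 : ~ invariant (M 23) 2.
Proof.
rows Q fQ hQ; have h00 := hQ 0%N 0%N isT; have h11 := hQ 1%N 1%N isT; have h01 := hQ 0%N 1%N isT.
have e1 : Q#0#1 = 0 by apply: sq0; ev h00 (0, 4, 1, 3)%N.
have f1 : Q#1#1 = 0 by apply: sq0; ev h11 (0, 4, 1, 3)%N.
have d02 : Q#0#0 * Q#0#2 = 0 by ev h00 (0, 1, 2, 4)%N.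
have d'02 : Q#1#0 * Q#1#2 = 0 by ev h11 (0, 1, 2, 4)%N.
have [m02 n02] : Q#0#0 * Q#1#2 = 0 /\ Q#0#2 * Q#1#0 = 0.
  by apply: cross_zero d02 d'02 _; expand h01 (0, 1, 2, 4)%N.
by_minors fQ; rewrite ?e1 ?f1; try ring; by rewrite ?m02 ?n02.
Qed.

Lemma fails_2_22 : ~ invariant (M 22) 2.
Proof.
rows Q fQ hQ; have h00 := hQ 0%N 0%N isT; have h11 := hQ 1%N 1%N isT; have h01 := hQ 0%N 1%N isT.
have d01 : Q#0#0 * Q#0#1 = 0 by ev h00 (0, 1, 2, 3)%N.
have d'01 : Q#1#0 * Q#1#1 = 0 by ev h11 (0, 1, 2, 3)%N.
have [m01 n01] : Q#0#0 * Q#1#1 = 0 /\ Q#0#1 * Q#1#0 = 0.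
  by apply: cross_zero d01 d'01 _; expand h01 (0, 1, 2, 3)%N.
have d02 : Q#0#0 * Q#0#2 = 0 by ev h00 (0, 1, 2, 4)%N.
have d'02 : Q#1#0 * Q#1#2 = 0 by ev h11 (0, 1, 2, 4)%N.
have [m02 n02] : Q#0#0 * Q#1#2 = 0 /\ Q#0#2 * Q#1#0 = 0.
  by apply: cross_zero d02 d'02 _; expand h01 (0, 1, 2, 4)%N.
have d12 : Q#0#1 * Q#0#2 = 0 by ev h00 (2, 3, 0, 4)%N.
have d'12 : Q#1#1 * Q#1#2 = 0 by ev h11 (2, 3, 0, 4)%N.
have [m12 n12] : Q#0#1 * Q#1#2 = 0 /\ Q#0#2 * Q#1#1 = 0.
  by apply: cross_zero d12 d'12 _; expand h01 (2, 3, 0, 4)%N.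
by_minors fQ; rewrite ?e1 ?f1; try ring; by rewrite ?m02 ?n02 ?m01 ?n01 ?m12 ?n12.
Qed.

Lemma fails_4_23 : ~ invariant (M 23) 4.
Proof.
rows Q fQ hQ; have h00 := hQ 0%N 0%N isT; have h01 := hQ 0%N 1%N isT.
have e1 : Q#0#1 = 0 by apply: sq0; ev h00 (0, 4, 1, 3)%N.
have d02 : Q#0#0 * Q#0#2 = 0 by ev h00 (0, 1, 2, 4)%N.
have m01 : Q#0#0 * Q#1#1 + Q#0#1 * Q#1#0 = 0 by expand h01 (0, 1, 2, 3)%N.
have m12 : Q#0#1 * Q#1#2 + Q#0#2 * Q#1#1 = 0 by expand h01 (1, 3, 2, 4)%N.
have m02 : Q#0#0 * Q#1#2 + Q#0#2 * Q#1#0 = 0 by expand h01 (0, 1, 2, 4)%N.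
rewrite e1 !mul0r ?addr0 ?add0r in m01 m12.
have [n02 p02] : Q#0#0 * Q#1#2 = 0 /\ Q#0#2 * Q#1#0 = 0.
  move/eqP: d02; rewrite mulf_eq0 => /orP [] /eqP e; move: m02; rewrite e !mul0r ?add0r ?addr0; by split.
by_minors fQ; rewrite ?e1 ?mul0r ?n02 ?p02 ?m01 ?m12 //.
Qed.

Lemma fails_4_24 : ~ invariant (M 24) 4.
Proof.
rows Q fQ hQ; have h00 := hQ 0%N 0%N isT; have h01 := hQ 0%N 1%N isT.
have e1 : Q#0#1 = 0 by apply: sq0; ev h00 (0, 4, 2, 3)%N.
have e2 : Q#0#2 = 0 by apply: sq0; ev h00 (1, 3, 2, 4)%N.
have m01 : Q#0#0 * Q#1#1 + Q#0#1 * Q#1#0 = 0 by expand h01 (0, 1, 2, 3)%N.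
have m02 : Q#0#0 * Q#1#2 + Q#0#2 * Q#1#0 = 0 by expand h01 (0, 1, 2, 4)%N.
rewrite e1 e2 !mul0r ?addr0 in m01 m02.
by_minors fQ; rewrite ?e1 ?e2 ?mul0r ?m01 ?m02 //.
Qed.

Lemma holds_8_25 : invariant (M 25) 8.
Proof.
start; exists (fun i => basis_form (nth 0%N [:: 0%N; 1%N; 2%N] i)).
  exact: (@basis_free _ _ _ _ [:: 0%N; 1%N; 2%N]).
by move=> u1 u2 u3 u4; rewrite /wedge /basis_form /= /E; ring.
Qed.

(** Modulo the first form of the table, the three rows are linear forms [b0, b1, b2] in two
    variables, and the equations found say that [b1^2 = 2 b0 b2] as polynomials. By unique
    factorization the three are proportional, so the rows have rank at most 2. *)
Lemma fails_8_28 : ~ invariant (M 28) 8.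
Proof.
start; move=> [B hB hS]; move: hB => /free_forms_rows - /(_ isT) [Q fQ hQ]; set L := (X in free_rows X _ _) in fQ hQ.
have {hS} h a b c d : wedge (comb_form L (Q 1%N)) (comb_form L (Q 1%N)) a b c d =
    2 * wedge (comb_form L (Q 0%N)) (comb_form L (Q 2%N)) a b c d.
  have := hS (vec 5 L a) (vec 5 L b) (vec 5 L c) (vec 5 L d).
  by rewrite /wedge !hQ // !(@comb_form_low k 5 L isT).
have ev a b c d x : 2 * x = wedge (comb_form L (Q 1%N)) (comb_form L (Q 1%N)) a b c d -
    2 * wedge (comb_form L (Q 0%N)) (comb_form L (Q 2%N)) a b c d -> x = 0.
  by rewrite h subrr; apply: half.
have h11 : Q#1#1 * Q#1#1 - 2 * (Q#0#1 * Q#2#1) = 0.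
  by apply: (ev (dlt k 0) (dlt k 2) (dlt k 1) (dlt k 4)); rewrite /wedge ?comb_formE /= /E /dlt /=; ring.
have h22 : Q#1#2 * Q#1#2 - 2 * (Q#0#2 * Q#2#2) = 0.
  by apply: (ev (dlt k 0) (dlt k 4) (dlt k 2) (dlt k 3)); rewrite /wedge ?comb_formE /= /E /dlt /=; ring.
have h12 : Q#1#1 * Q#1#2 - (Q#0#1 * Q#2#2 + Q#0#2 * Q#2#1) = 0.
  by apply: (ev (dlt k 1) (dlt k 4) (dlt k 2) (dlt k 3)); rewrite /wedge ?comb_formE /= /E /dlt /=; ring.
clear ev.
have par i j : (i < 3)%N -> (j < 3)%N -> Q i 1%N * Q j 2 = Q j 1%N * Q i 2.
  (* The discriminant of [b0 b2] vanishes because [2 b0 b2] is a square. *)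
  have m02 : Q#0#1 * Q#2#2 - Q#0#2 * Q#2#1 = 0.
    apply: sq0; transitivity ((Q#1#1 * Q#1#2 - (Q#1#1 * Q#1#2 - (Q#0#1 * Q#2#2 + Q#0#2 * Q#2#1))) ^+ 2 -
     (Q#1#1 * Q#1#1 - (Q#1#1 * Q#1#1 - 2 * (Q#0#1 * Q#2#1))) * (Q#1#2 * Q#1#2 - (Q#1#2 * Q#1#2 - 2 * (Q#0#2 * Q#2#2)))); first ring.
    rewrite h11 h22 h12; ring.
  have m (a : nat -> nat -> k) : a#1#1 * a#1#1 - 2 * (a#0#1 * a#2#1) = 0 ->
     a#1#2 * a#1#2 - 2 * (a#0#2 * a#2#2) = 0 -> a#1#1 * a#1#2 - (a#0#1 * a#2#2 + a#0#2 * a#2#1) = 0 ->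
     a#0#1 * a#2#2 - a#0#2 * a#2#1 = 0 -> a#0#1 * a#1#2 = a#1#1 * a#0#2.
    move=> e11 e22 e12 e02; apply/eqP; rewrite -subr_eq0; apply/eqP/sq0.
    transitivity (a#0#1 ^+ 2 * (a#1#2 * a#1#2 - 2 * (a#0#2 * a#2#2)) + a#0#2 ^+ 2 * (a#1#1 * a#1#1 - 2 * (a#0#1 * a#2#1)) -
      2 * a#0#1 * a#0#2 * (a#1#1 * a#1#2 - (a#0#1 * a#2#2 + a#0#2 * a#2#1))); first ring.
    by rewrite e11 e22 e12; ring.
  have m01 := m Q h11 h22 h12 m02.
  have m21 : Q#2#1 * Q#1#2 = Q#1#1 * Q#2#2.
    apply: (m (fun i => Q (2 - i)%N)) => /=; [rewrite -[RHS]h11|rewrite -[RHS]h22|rewrite -[RHS]h12|];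
      try ring.
    by rewrite -[RHS]oppr0 -[in RHS]m02; ring.
  have {}m02 : Q#0#1 * Q#2#2 = Q#2#1 * Q#0#2.
    by apply/eqP; rewrite -subr_eq0 [_ * Q#0#2]mulrC m02.
  case: i => [|[|[|//]]]; case: j => [|[|[|//]]] // _ _; rewrite ?m01 ?m21 ?m02 //; ring.
have [[j hj]|h0] := altP (@existsP 'I_3 (fun j => Q j 1%N != 0)); last first.
  support fQ [:: 0; 2]%N; apply/eqP; move: h0; rewrite negb_exists => /forallP /(_ (Ordinal hi)).
  by rewrite negbK.
(* A relation between the rows on columns 0 and 1 extends to column 2, which is a multiple of column
   1. *)
have [s [i0 [hi0 si0 hs]]] := lin_dep (fun i j => Q i j) (isT : 2 < 3)%N.
case/eqP: si0; apply: (fQ) hi0 => c; rewrite /L /=; case: c => [|[|[|//]]] _; try exact: hs.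
apply: (mulfI hj); rewrite mulr0 mulr_sumr -[RHS](mul0r (Q j 2)) -[in RHS](hs 1%N isT) mulr_suml.
by apply: eq_bigr => i _; rewrite mulrCA par // mulrA.
Qed.

Lemma holds_9_27 : invariant (M 27) 9.
Proof.
start; exists (fun i => basis_form (nth 0%N [:: 0%N; 1%N] i)).
  exact: (@basis_free _ _ _ _ [:: 0%N; 1%N]).
split; try by move=> u1 u2 u3 u4; rewrite /wedge /basis_form /= /E; ring.
exists (basis_form 2), (vec 5 _ (dlt k 2)), (vec 5 _ (dlt k 3)); split.
- exact: basis_lie_form.
- by move=> [|[|//]] w _; rewrite /basis_form /= /E !low_vec //= /dlt /=; ring.
- by move=> [|[|//]] w _; rewrite /basis_form /= /E !low_vec //= /dlt /=; ring.
rewrite /basis_form /= /E !low_vec //= /dlt /=.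
by rewrite !(mulr0, mul0r, addr0, subr0, mulr1) oner_neq0.
Qed.

(** The plane must be spanned by [e_0 ^ e_1] and [e_1 ^ e_2]; on their common radical
    [e_0 = e_1 = e_2 = 0] the third form [e_2 ^ e_3 + e_0 ^ e_4] vanishes as well. *)
Lemma fails_9_26 : ~ invariant (M 26) 9.
Proof.
start; move=> [B hB [h0 h1 _ [C [u [v [hC hu hv]]]]]]; move: hB => /free_forms_rows - /(_ isT) [Q fQ hQ].
set L := (X in free_rows X _ _) in fQ hQ.
have h i : (i < 2)%N -> wedge0 (comb_form L (Q i)) (comb_form L (Q i)).
  by move=> hi; apply: (wedge0_comb _ (hQ i hi) (hQ i hi)) => //; move: i hi => [|[|]].
have e2 i : (i < 2)%N -> Q i 2 = 0.
  by move=> /h {}h; apply: sq0; ev h (0, 4, 2, 3)%N.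
have det : Q#0#0 * Q#1#1 - Q#0#1 * Q#1#0 != 0.
  apply/eqP => /eqP; rewrite subr_eq0 => /eqP e.
  by by_minors fQ; rewrite ?e2 // ?mulr0 ?mul0r ?e // mulrC.
have ker w : (forall i w', (i < 2)%N -> B i w w' = 0) -> [/\ low w 0 = 0, low w 1 = 0 & low w 2 = 0].
  move=> hw; have r i a : (i < 2)%N -> comb_form L (Q i) (low w) a = 0.
    by move=> hi; rewrite -[RHS](hw i (vec 5 L a) hi) hQ //; apply: (@comb_form_ext k 5 L isT) => // l hl; rewrite low_vec // ?hl.
  have r0 i : (i < 2)%N -> Q i 0%N * low w 1 = 0 /\ Q i 1%N * low w 1 = 0 /\ Q i 0%N * low w 0 = Q i 1%N * low w 2.
    move=> hi; split; [|split].
    + by rewrite -[RHS]oppr0 -[in RHS](r i (dlt k 0) hi) comb_formE /= /E /dlt /= e2 //; ring.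
    + by rewrite -(r i (dlt k 2) hi) comb_formE /= /E /dlt /= e2 //; ring.
    apply/eqP; rewrite -subr_eq0; apply/eqP.
    by rewrite -(r i (dlt k 1) hi) comb_formE /= /E /dlt /= e2 //; ring.
  have [a0 [b0 c0]] := r0 0%N isT; have [a1 [b1 c1]] := r0 1%N isT.
  split; apply: (mulfI det); rewrite mulr0.
  + transitivity (Q#1#1 * (Q#0#0 * low w 0) - Q#0#1 * (Q#1#0 * low w 0)); first ring.
    by rewrite c0 c1; ring.
  + transitivity (Q#1#1 * (Q#0#0 * low w 1) - Q#0#1 * (Q#1#0 * low w 1)); first ring.
    by rewrite a0 a1; ring.
  transitivity (Q#0#0 * (Q#1#1 * low w 2) - Q#1#0 * (Q#0#1 * low w 2)); first ring.
  by rewrite -c0 -c1; ring.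
have [u0 u1 u2] := ker u hu; have [v0 v1 v2] := ker v hv.
have [q ->] := @lie_form_comb k 5 L isT C hC.
by rewrite comb_formE /= /E u0 u1 u2 v0 v1 v2 !(mulr0, mul0r, subr0, addr0) eqxx.
Qed.

Lemma holds_10_8 : invariant (M 8) 10.
Proof.
start; apply: (deg2_pair _ _ _ (q := dlt k 0) (q' := dlt k 1)) => //; first simp01.
- is_degenerate (dlt k 2) 3%N 1%N.
- is_degenerate (dlt k 0) 1%N 0%N.
Qed.

Lemma holds_10_10 : invariant (M 10) 10.
Proof.
start; apply: (deg2_pair _ _ _ (q := dlt k 0) (q' := dlt k 1)) => //; first simp01.
- is_degenerate (dlt k 4) 5%N 1%N.
- is_degenerate (dlt k 2) 3%N 0%N.
Qed.

Lemma holds_10_11 : invariant (M 11) 10.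
Proof.
start; apply: (deg2_pair _ _ _ (q := dlt k 0) (q' := dlt k 1)) => //; first simp01.
- is_degenerate (dlt k 4) 5%N 1%N.
- is_degenerate (dlt k 1) 0%N 0%N.
Qed.

Lemma holds_11_10 : invariant (M 10) 11.
Proof.
(* The third degenerate member is the difference of the two forms, in which [e_0 ^ e_1] cancels. *)
start; apply: (deg3_triple _ _ _ (q0 := dlt k 0) (q1 := dlt k 1) (q2 := fun c => dlt k 0 c - dlt k 1 c)) => //;
  match goal with |- is_true _ => simp01 | _ => idtac end.
- is_degenerate (dlt k 4) 5%N 1%N.
- is_degenerate (dlt k 2) 3%N 0%N.
- is_degenerate (dlt k 0) 1%N 0%N.
Qed.

Lemma holds_12_14 : invariant (M 14) 12.
Proof.
start; move=> C /lie_form_comb - /(_ isT) [q hq].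
have [[h0 h1]|h] : q#0 = 0 /\ q#1 = 0 \/ (q#0 != 0) || (q#1 != 0).
- have [h0|?] := eqVneq (q#0) 0; last by right.
  by have [h1|?] := eqVneq (q#1) 0; [left|right].
- suff [u [hu hv]] : degenerate (fun u v : modelType k (6, [:: [:: (0, 1); (2, 3)]; [:: (0, 4); (2, 5)]])%N =>
    comb_form [:: [:: (0, 1); (2, 3)]; [:: (0, 4); (2, 5)]]%N q (low u) (low v)).
    by exists u; split=> // v; rewrite hq.
  apply: (@comb_degenerate _ _ _ _ _ (dlt k 0) (dlt k 1) 0); [by []|by []| |rewrite /= /E; simp01].
  by move=> b; rewrite comb_formE /= h0 h1; ring.
suff [u [hu hv]] : degenerate (fun u v : modelType k (6, [:: [:: (0, 1); (2, 3)]; [:: (0, 4); (2, 5)]])%N =>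
    comb_form [:: [:: (0, 1); (2, 3)]; [:: (0, 4); (2, 5)]]%N q (low u) (low v)).
  by exists u; split=> // v; rewrite hq.
case/orP: h => h.
(* This vector contracts the two terms of the combination to opposite multiples of [e_0]. *)
- is_degenerate (fun i => q#1 * dlt k 1 i - q#0 * dlt k 4 i) 0%N 1%N.
is_degenerate (fun i => q#1 * dlt k 1 i - q#0 * dlt k 4 i) 0%N 0%N.
Qed.

(** By [nonsingular_9], a degenerate form is a multiple of the first form of the table. *)
Lemma fails_10_9 : ~ invariant (M 9) 10.
Proof.
move=> [B hB hd]; have [Q fQ hQ] := @free_forms_rows k 6 (table 9).2 isT 2 B hB.
support fQ [:: 0%N]; have [//|nz] := eqVneq (Q i 1%N) 0.
have [a [ha nu]] := @degenerate_comb k 6 (table 9).2 isT _ (Q i) (hQ i hi) (hd i hi).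
by case: nu; apply: nonsingular_9 nz ha.
Qed.

Lemma fails_10_13 : ~ invariant (M 13) 10.
Proof.
move=> [B hB hd]; have [Q fQ hQ] := @free_forms_rows k 6 (table 13).2 isT 2 B hB.
support fQ [:: 0%N]; have [//|nz] := eqVneq (Q i 1%N) 0.
have [a [ha nu]] := @degenerate_comb k 6 (table 13).2 isT _ (Q i) (hQ i hi) (hd i hi).
by case: nu; apply: nonsingular_13 nz ha.
Qed.

(** By [nonsingular_11], a degenerate form has a zero coefficient on one of the two forms of the
    table; among three such forms, two share the same zero and are dependent. *)
Lemma fails_11_11 : ~ invariant (M 11) 11.
Proof.
move=> [C0 [C1 [C2 [d0 d1 d2 [f01 f02 f12]]]]].
pose C i := nth C0 [:: C0; C1; C2] i.
have dC i : (i < 3)%N -> degenerate (C i) by move: i => [|[|[|]]].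
have lC i : (i < 3)%N -> lie_form (C i).
  by move: i => [|[|[|//]]] _; [case: f01 => f _; apply: (f 0%N)|case: f01 => f _; apply: (f 1%N)|
    case: f02 => f _; apply: (f 1%N)].
have fC i j : (i < j)%N -> (j < 3)%N -> free_forms 2 (nth C0 [:: C i; C j]).
  by move: i j => [|[|i]] [|[|[|j]]].
have zero i : (i < 3)%N -> exists q, (forall u v, C i u v = comb_form (table 11).2 q (low u) (low v)) /\
    (q#0 = 0 \/ q#1 = 0).
  move=> hi; have [q hq] := @lie_form_comb k 6 (table 11).2 isT _ (lC i hi); exists q; split=> //.
  have [|n0] := eqVneq (q#0) 0; [by left|have [|n1] := eqVneq (q#1) 0; [by right|]].
  have [a [ha nu]] := @degenerate_comb k 6 (table 11).2 isT _ q hq (dC i hi).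
  by case: nu; apply: nonsingular_11 n0 n1 ha.
have clash i j q q' c : (i < j)%N -> (j < 3)%N -> (forall u v, C i u v = comb_form (table 11).2 q (low u) (low v)) ->
    (forall u v, C j u v = comb_form (table 11).2 q' (low u) (low v)) -> (c < 2)%N -> q c = 0 -> q' c = 0 -> False.
  move=> ij j3 hq hq' c2 qc q'c.
  have [_ hf] := fC i j ij j3; pose c' := (1 - c)%N.
  have sub s : s#0 * q c' + s#1 * q' c' = 0 -> s#0 = 0 /\ s#1 = 0.
    move=> hs; suff h l : (l < 2)%N -> s l = 0 by split; apply: h.
    apply: hf => u v; rewrite !big_ord_recr big_ord0 /= add0r hq hq' !comb_formE.
    transitivity ((s#0 * q c' + s#1 * q' c') * form_of (nth [::] (table 11).2 c') (low u) (low v)); last by rewrite hs mul0r.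
    by move: c c2 @c' qc q'c {hs} => [|[|//]] _ /= -> ->; ring.
  have [z1 z2] := sub (nth 0 [:: q' c'; - q c']) ltac:(by rewrite /=; ring).
  have [/= e _] := sub (nth 0 [:: 1; 0]) ltac:(by move: z2 => /= /eqP; rewrite oppr_eq0 => /eqP ->; ring).
  by move/eqP: e; rewrite oner_eq0.
have [q0 [h0 z0]] := zero 0%N isT; have [q1 [h1 z1]] := zero 1%N isT; have [q2 [h2 z2]] := zero 2%N isT.
by case: z0 => z0; case: z1 => z1; case: z2 => z2;
  first [exact: (clash 0%N 1%N q0 q1 0%N)|exact: (clash 0%N 1%N q0 q1 1%N)|
    exact: (clash 0%N 2%N q0 q2 0%N)|exact: (clash 0%N 2%N q0 q2 1%N)|
    exact: (clash 1%N 2%N q1 q2 0%N)|exact: (clash 1%N 2%N q1 q2 1%N)].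
Qed.

(** The sum of the two forms is nondegenerate: its Pfaffian is 2 up to sign. *)
Lemma fails_12_10 : ~ invariant (M 10) 12.
Proof.
move=> h; apply: (@comb_nondegenerate k 6 (table 10).2 isT (fun=> 1)); last exact/h/comb_lie_form.
move=> a; apply: nonsingular_10; [exact: (oner_neq0 k)|exact: (oner_neq0 k)|exact: (two_neq0)].
Qed.

Lemma fails_12_11 : ~ invariant (M 11) 12.
Proof.
move=> h; apply: (@comb_nondegenerate k 6 (table 11).2 isT (fun=> 1)); last exact/h/comb_lie_form.
move=> a; apply: nonsingular_11; [exact: (oner_neq0 k)|exact: (oner_neq0 k)].
Qed.

Lemma fails_12_13 : ~ invariant (M 13) 12.
Proof.
move=> h; apply: (@comb_nondegenerate k 6 (table 13).2 isT (fun=> 1)); last exact/h/comb_lie_form.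
move=> a; apply: nonsingular_13; [exact: (oner_neq0 k)].
Qed.

End Values.

(* The [i]-th entry records which of the invariants hold for the [i]-th algebra of the list. *)
Definition known : seq (seq (nat * bool)) := [::
  [::];
  [::];
  [::];
  [::];
  [::];
  [:: (1, true)];
  [:: (1, false)];
  [:: (0, true)];
  [:: (0, true); (10, true)];
  [:: (0, true); (10, false)];
  [:: (0, false); (10, true); (11, true); (12, false)];
  [:: (0, false); (10, true); (11, false); (12, false)];
  [:: (0, false)];
  [:: (0, false); (10, false); (12, false)];
  [:: (0, false); (12, true)];
  [::];
  [:: (5, true); (6, true); (7, true)];
  [:: (5, true); (6, true); (7, false)];
  [:: (5, true); (6, false)];
  [:: (5, false)];
  [:: (0, true); (1, true); (2, true); (3, true)];
  [:: (0, true); (1, true); (2, false); (3, false); (4, true)];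
  [:: (0, true); (1, true); (2, false); (3, true)];
  [:: (0, true); (1, true); (2, false); (3, false); (4, false)];
  [:: (0, true); (1, false); (4, false)];
  [:: (0, true); (1, false); (4, true); (5, false); (8, true)];
  [:: (0, true); (1, true); (2, true); (3, false); (5, false); (9, false)];
  [:: (0, true); (1, true); (2, true); (3, false); (5, false); (9, true)];
  [:: (0, true); (1, false); (4, true); (5, false); (8, false)];
  [:: (0, true); (1, false); (4, true); (5, true)];
  [:: (0, true); (1, true); (2, true); (3, false); (5, true)];
  [:: (0, false)];
  [:: (5, false)];
  [:: (5, true); (6, false)];
  [:: (5, true); (6, true)]]%N.

(** * The models are pairwise non-isomorphic *)

Section Distinct.
Variable k : fieldType.
Hypothesis two_neq0 : (2 : k) != 0.
Local Notation M i := (modelType k (table i)).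

Lemma known_sound i : (i < 35)%N ->
  foldr (fun cb P => (if cb.2 then invariant (M i) cb.1 else ~ invariant (M i) cb.1) /\ P) True
    (nth [::] known i).
Proof.
do 35?[case: i => [|i]]; last by []; move=> _; cbv [known nth foldr fst snd].
- by [].
- by [].
- by [].
- by [].
- by [].
- by split; [holds_rel [:: 0%N; 1%N]|].
- by split; [fails_rel 2%N [:: (1, (0, 2, 1, 3))]%N [:: 0]%N|].
- by split; [holds_rel [:: 0%N]|].
- by split; [holds_rel [:: 0%N]|];
  split; [exact: holds_10_8|].
- by split; [holds_rel [:: 0%N]|];
  split; [exact: fails_10_9|].
- by split; [exact: fails_0_10|];
  split; [exact: holds_10_10|];
  split; [exact: holds_11_10|];
  split; [exact: fails_12_10|].
- by split; [fails_rel 1%N [:: (0, (0, 1, 2, 3)); (1, (0, 2, 4, 5))]%N (@nil nat)|];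
  split; [exact: holds_10_11|];
  split; [exact: fails_11_11|];
  split; [exact: fails_12_11|].
- by split; [fails_rel 1%N [:: (0, (0, 1, 2, 3)); (1, (0, 4, 1, 2))]%N (@nil nat)|].
- by split; [fails_rel 1%N [:: (0, (0, 1, 2, 3)); (1, (0, 4, 2, 5))]%N (@nil nat)|];
  split; [exact: fails_10_13|];
  split; [exact: fails_12_13|].
- by split; [fails_rel 1%N [:: (0, (0, 1, 2, 3)); (1, (0, 4, 2, 5))]%N (@nil nat)|];
  split; [exact: holds_12_14|].
- by [].
- by split; [holds_rad [:: 0%N]|];
  split; [holds_rad [:: 0%N; 1%N]|];
  split; [holds_rad [:: 0%N; 1%N; 2%N]|].
- by split; [holds_rad [:: 0%N]|];
  split; [holds_rad [:: 0%N; 1%N]|];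
  split; [fails_rad 3%N [:: (2, 2, (0, 3, 1, 2))]%N [:: 0; 1]%N|].
- by split; [holds_rad [:: 0%N]|];
  split; [fails_rad 2%N [:: (2, 1, (0, 2, 1, 3)); (1, 2, (0, 2, 1, 3))]%N [:: 0]%N|].
- by split; [fails_rad 1%N [:: (2, 0, (0, 1, 2, 3)); (0, 2, (0, 1, 2, 3)); (1, 1, (0, 2, 1, 3))]%N (@nil nat)|].
- by split; [holds_rel [:: 0%N]|];
  split; [holds_rel [:: 0%N; 1%N]|];
  split; [holds_rel [:: 0%N; 1%N]|];
  split; [holds_rel [:: 0%N; 1%N; 2%N]|].
- by split; [holds_rel [:: 0%N]|];
  split; [holds_rel [:: 0%N; 2%N]|];
  split; [exact: fails_2_21|];
  split; [fails_rel 3%N [:: (1, (0, 4, 1, 2))]%N [:: 0; 2]%N|];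
  split; [holds_rel [:: 0%N; 1%N]|].
- by split; [holds_rel [:: 0%N]|];
  split; [holds_rel [:: 0%N; 1%N]|];
  split; [exact: fails_2_22|];
  split; [holds_rel [:: 0%N; 1%N; 2%N]|].
- by split; [holds_rel [:: 0%N]|];
  split; [holds_rel [:: 0%N; 2%N]|];
  split; [exact: fails_2_23|];
  split; [fails_rel 3%N [:: (1, (0, 4, 1, 3))]%N [:: 0; 2]%N|];
  split; [exact: fails_4_23|].
- by split; [holds_rel [:: 0%N]|];
  split; [fails_rel 2%N [:: (1, (0, 4, 2, 3)); (2, (1, 3, 2, 4))]%N [:: 0]%N|];
  split; [exact: fails_4_24|].
- by split; [holds_rel [:: 0%N]|];
  split; [exact: fails_1_25|];
  split; [holds_rel [:: 0%N; 1%N]|];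
  split; [fails_rad 1%N [:: (2, 0, (0, 1, 2, 3)); (0, 2, (0, 1, 2, 3)); (1, 2, (0, 4, 1, 2))]%N (@nil nat)|];
  split; [exact: holds_8_25|].
- by split; [holds_rel [:: 0%N]|];
  split; [holds_rel [:: 0%N; 1%N]|];
  split; [holds_rel [:: 0%N; 1%N]|];
  split; [fails_rel 3%N [:: (2, (0, 4, 2, 3))]%N [:: 0; 1]%N|];
  split; [fails_rad 1%N [:: (2, 0, (0, 1, 2, 3)); (0, 2, (0, 1, 2, 3)); (1, 2, (1, 2, 0, 4))]%N (@nil nat)|];
  split; [exact: fails_9_26|].
- by split; [holds_rel [:: 0%N]|];
  split; [holds_rel [:: 0%N; 1%N]|];
  split; [holds_rel [:: 0%N; 1%N]|];
  split; [fails_rel 3%N [:: (2, (0, 4, 2, 3))]%N [:: 0; 1]%N|];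
  split; [fails_rad 1%N [:: (2, 0, (0, 1, 2, 3)); (0, 2, (0, 1, 2, 3)); (1, 2, (1, 4, 2, 3))]%N (@nil nat)|];
  split; [exact: holds_9_27|].
- by split; [holds_rel [:: 0%N]|];
  split; [fails_rel 2%N [:: (2, (0, 4, 2, 3)); (1, (0, 2, 1, 4))]%N [:: 0]%N|];
  split; [holds_rel [:: 0%N; 1%N]|];
  split; [fails_rad 1%N [:: (2, 0, (0, 1, 2, 3)); (0, 2, (0, 1, 2, 3)); (1, 2, (1, 4, 2, 3))]%N (@nil nat)|];
  split; [exact: fails_8_28|].
- by split; [holds_rel [:: 0%N]|];
  split; [fails_rel 2%N [:: (1, (0, 2, 1, 3)); (2, (0, 3, 1, 4))]%N [:: 0]%N|];
  split; [holds_rel [:: 0%N; 1%N]|];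
  split; [holds_rad [:: 0%N]|].
- by split; [holds_rel [:: 0%N]|];
  split; [holds_rel [:: 0%N; 1%N]|];
  split; [holds_rel [:: 0%N; 1%N]|];
  split; [fails_rel 3%N [:: (2, (0, 4, 2, 3))]%N [:: 0; 1]%N|];
  split; [holds_rad [:: 1%N]|].
- by split; [exact: fails_0_31|].
- by split; [fails_rad 1%N [:: (1, 0, (0, 1, 2, 3)); (0, 1, (0, 1, 2, 3)); (3, 2, (0, 2, 1, 3)); (2, 3, (0, 2, 1, 3))]%N (@nil nat)|].
- by split; [holds_rad [:: 2%N]|];
  split; [fails_rad 2%N [:: (1, 0, (0, 1, 2, 3)); (0, 1, (0, 1, 2, 3)); (3, 3, (0, 3, 1, 2))]%N [:: 2]%N|].
- by split; [holds_rad [:: 2%N]|];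
  split; [holds_rad [:: 2%N; 3%N]|].
Qed.

Lemma knownP i c b : (i < 35)%N -> (c, b) \in nth [::] known i ->
  if b then invariant (M i) c else ~ invariant (M i) c.
Proof.
move=> /known_sound; elim: (nth _ _ _) => //= cb l IH [h /IH {}IH].
by rewrite inE => /predU1P [e|//]; move: h; rewrite -e.
Qed.

Definition signature i := (count (leq (table i).1) (iota 0 8), count (predC (used (table i).2)) (iota 0 8)).

Definition separated i j := (signature i != signature j) ||
  has (fun cb => (cb.1, ~~ cb.2) \in nth [::] known j) (nth [::] known i).

Lemma tables_ok i : (i < 35)%N -> [/\ table_ok (table i), has_private (table i).2 &
  all (fun l => used (table i).2 l ==> isolated (table i).2 l) (iota 0 8)].
Proof.
have /allP h : all (fun i => [&& table_ok (table i), has_private (table i).2 &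
  all (fun l => used (table i).2 l ==> isolated (table i).2 l) (iota 0 8)]) (iota 0 35) by vm_compute.
by move=> hi; apply/and3P/h; rewrite mem_iota.
Qed.

Lemma model_dims i : (i < 35)%N ->
  (\dim (derived_algebra (M i)), \dim (lie_center (M i))) = signature i.
Proof.
move=> /tables_ok []; rewrite /signature; case: (table i) => n L ok hp hu.
by rewrite (dim_derived_model _ ok hp) (dim_center_model _ ok hu).
Qed.

Lemma models_distinct i j : (i < 35)%N -> (j < 35)%N -> lie_isomorphic (M i) (M j) -> i = j.
Proof.
have /allP h : all (fun i => all (fun j => (i == j) || separated i j) (iota 0 35)) (iota 0 35) by vm_compute.
move=> hi hj iso; have /h /allP /(_ j) : i \in iota 0 35 by rewrite mem_iota.
rewrite mem_iota => /(_ hj) /predU1P [//|] /orP [|/hasP [[c b] /= h1 h2]].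
  by have [e1 e2] := lie_iso_dims iso; rewrite -!model_dims // e1 e2 eqxx.
have := knownP hi h1; have := knownP hj h2; case: b {h1 h2} => /= nj ni.
  by case: nj; apply: (invariant_iso (lie_iso_sym iso)).
by case: ni; apply: (invariant_iso iso).
Qed.

End Distinct.

(** * Every algebra is isomorphic to a model *)

Section Coverage.
Variables (k : closedFieldType) (g : lieAlgType k).
Hypothesis two_neq0 : (2 : k) != 0.
Hypotheses (dg : \dim {:g} = 8%N) (ts : two_step_nilpotent g).

(** If [d] is at least 5, there are at most three closed 1-forms, hence at most three products of
    two of them, too few for [d] independent forms. *)
Lemma dim_derived_le4 : (\dim (derived_algebra g) <= 4)%N.
Proof.
rewrite leqNgt; apply/negP => d5; set d := \dim _ in d5.
have nd : (8 - d + d = 8)%N by rewrite subnK // -dg dimvS // subvf.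
have [p H] := admits_gen dg ts (erefl d) nd.
(* Columns 0, 1, 2 stand for the pairs (0,1), (0,2), (1,2), so that the pair [(x, y)] has number
   [x + y - 1]. *)
pose M c j := p c (nth 0 [:: 0; 0; 1] j)%N (nth 0 [:: 1; 2; 2] j)%N.
have [q [c [hc qc hq]]] := lin_dep M (ltnW d5).
case/eqP: qc; apply: (admits_indep dg (erefl d) nd H) hc => [|a b]; first by rewrite size_map size_iota.
have n3 : (8 - d <= 3)%N by rewrite leq_subLR (leq_add d5 (leqnn 3)).
transitivity (\sum_(j < 8 - d) \sum_(i < j) (\sum_(c < d) q c * p c i j) * E i j a b).
  under [RHS]eq_bigr do under eq_bigr do rewrite mulr_suml.
  under [RHS]eq_bigr do rewrite exchange_big.
  rewrite exchange_big; apply: eq_bigr => c' _.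
  rewrite (nth_map 0%N) ?size_iota // nth_iota // add0n /gen mulr_sumr; apply: eq_bigr => j _.
  by rewrite mulr_sumr; apply: eq_bigr => i _; rewrite mulrA.
rewrite big1 // => j _; rewrite big1 // => i _.
have h l : (l < 3)%N -> nth 0%N [:: 0; 0; 1]%N l = i -> nth 0%N [:: 1; 2; 2]%N l = j ->
    \sum_(c < d) q c * p c i j = 0 by move=> /hq h <- <-.
have idx (x y : nat) : (x < y)%N -> (y < 3)%N -> [/\ (x + y - 1 < 3)%N,
    nth 0%N [:: 0; 0; 1]%N (x + y - 1) = x & nth 0%N [:: 1; 2; 2]%N (x + y - 1) = y].
  by move: x y => [|[|x]] [|[|[|y]]].
have [h1 h2 h3] := idx i j (ltn_ord i) (leq_trans (ltn_ord j) n3).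
by rewrite (h _ h1 h2 h3) mul0r.
Qed.

Lemma coverage : exists2 i, (i < 35)%N & lie_isomorphic g (modelType k (table i)).
Proof.
have std_table n Ts : std g n Ts -> all (fun T => [&& (n + size T == 8)%N,
    all (all (fun ij => (ij.1 < n) && (ij.2 < n)))%N T & has (fun i => table i == (n, T)) (iota 0 35)]) Ts ->
    exists2 i, (i < 35)%N & lie_isomorphic g (modelType k (table i)).
  move=> [T hT H] /allP /(_ T hT) /and3P [/eqP sz hp /hasP [i hi /eqP e]].
  exists i; first by move: hi; rewrite mem_iota.
  by rewrite e; apply: admits_model.
have := dim_derived_le4; case dD: (\dim _) => [|[|[|[|[|//]]]]] _.
- apply: (std_table 8%N [:: [::]]); last by vm_compute.
  have [x [z [cxz z0]]] := @coframe_exists _ _ 8 0 dg dD (erefl 8%N).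
  by exists [::]; rewrite ?mem_head //; exists x, z; split=> // c u v; rewrite z0 //= nth_nil.
- by apply: (std_table _ _ (std71 dg ts dD)); vm_compute.
- by apply: (std_table _ _ (std62 dg ts dD)); vm_compute.
- by apply: (std_table _ _ (std53 two_neq0 dg ts dD)); vm_compute.
by apply: (std_table _ _ (std44 two_neq0 dg ts dD)); vm_compute.
Qed.
End Coverage.

Theorem corollary2 (k : closedFieldType)
    (char_not2 : 2%N \notin [pchar k]) (char_not3 : 3%N \notin [pchar k]) :
  exists L : 'I_35 -> lieAlgType k,
    [/\ forall i : 'I_35, \dim {:L i} = 8%N /\ two_step_nilpotent (L i),
        forall i j : 'I_35, lie_isomorphic (L i) (L j) -> i = j
      & forall g : lieAlgType k, \dim {:g} = 8%N -> two_step_nilpotent g ->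
          exists i : 'I_35, lie_isomorphic g (L i)].
Proof.
have two_neq0 : (2 : k) != 0 by move: char_not2; rewrite inE.
exists (fun i => modelType k (table i)); split=> [i|i j iso|g dg ts].
- by split; [exact: dim_model|exact: model_two_step].
- exact/val_inj/(models_distinct two_neq0 (ltn_ord i) (ltn_ord j) iso).
have [i hi iso] := coverage two_neq0 dg ts.
by exists (Ordinal hi).
Qed.
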